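(* Let $\lambda_-<\lambda_+$, let $\Lambda$ be a parameter shift from $\lambda_-$ to $\lambda_+$, and let $a,b:[\lambda_-,\lambda_+]\to\mathbb{R}$ be smooth functions with $b(\lambda)>-1$ and $|a(\lambda)|<\sqrt{b(\lambda)+1}$ for all $\lambda\in[\lambda_-,\lambda_+]$. Consider, for $r>0$, the system $$\dot x_1=-x_1^3+a(\Lambda(s))x_1^2+b(\Lambda(s))x_1-a(\Lambda(s))(b(\Lambda(s))+1)+x_2,\qquad \dot x_2=x_1-x_2,\qquad \dot s=r,$$ with stable paths $(p_1(s),\Lambda(s))$ and $(p_3(s),\Lambda(s))$, where $p_1(s)=\left(-\sqrt{b(\Lambda(s))+1},-\sqrt{b(\Lambda(s))+1}\right)$ and $p_3(s)=\left(\sqrt{b(\Lambda(s))+1},\sqrt{b(\Lambda(s))+1}\right)$, and denote $p_{i\pm}=\lim_{s\to\pm\infty}p_i(s)$. (1) If there exist $s_1<s_2$ such that $-\sqrt{b(\Lambda(s_1))+1}>a(\Lambda(s_2))$ (resp. $\sqrt{b(\Lambda(s_1))+1}<a(\Lambda(s_2))$), then there can be R-tipping away from $p_{1-}$ (resp. $p_{3-}$); that is, there is a parameter shift $\tilde\Lambda$ such that there is R-tipping away from $p_{1-}$ (resp. $p_{3-}$) for $\tilde\Lambda$. (2) If for all $s_1<s_2$, including in the limit as $s_1\to-\infty$ or $s_2\to\infty$, one has $-\sqrt{b(\Lambda(s_1))+1}<a(\Lambda(s_2))$ (resp. $\sqrt{b(\Lambda(s_1))+1}>a(\Lambda(s_2))$),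 where ''including in the limit'' means that $\Lambda(s_1)$ may be replaced by $\lambda_-$ and $\Lambda(s_2)$ by $\lambda_+$, then $(p_1(s),\Lambda(s))$ (resp. $(p_3(s),\Lambda(s))$) is forward inflowing stable and there is no R-tipping away from $p_{1-}$ (resp. $p_{3-}$) for $\Lambda$.
   Context: A parameter shift (from $\lambda_-$ to $\lambda_+$) is a function $\Lambda\in C^2(\mathbb{R},(\lambda_-,\lambda_+))$ with $\lim_{s\to\pm\infty}\Lambda(s)=\lambda_\pm$ and $\lim_{s\to\pm\infty}\Lambda'(s)=0$. Write $\dot x=F(x,\Lambda(s))$, $\dot s=r$ for the displayed system, with $x=(x_1,x_2)\in\mathbb{R}^2$ and $$F(x,\lambda)=\left(-x_1^3+a(\lambda)x_1^2+b(\lambda)x_1-a(\lambda)(b(\lambda)+1)+x_2,\; x_1-x_2\right).$$ Equivalently, with $s=rt$, $\dot x=F(x,\Lambda(rt))$. For each fixed $\lambda\in[\lambda_-,\lambda_+]$ the equilibria of $\dot x=F(x,\lambda)$ are $\left(\pm\sqrt{b(\lambda)+1},\pm\sqrt{b(\lambda)+1}\right)$ (same sign in both components), which are attracting, and the saddle $(a(\lambda),a(\lambda))$. $\mathbb{B}(p,\lambda)$ denotes the basin of attraction of an attracting equilibrium $p$ of $\dot x=F(x,\lambda)$. A stable path $(X(s),\Lambda(s))$ is a continuous family of attracting equilibria $X(s)$ of $\dot x=F(x,\Lambda(s))$, $s\in\mathbb{R}$, with limits $X_\pm=\lim_{s\to\pm\infty}X(s)$ attracting equilibria for $\lambda_\pm$.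 Pullback attractor: for a parameter shift and each $r>0$ there is a unique trajectory $x^r(t)$ of the corresponding non-autonomous system with $x^r(t)\to X_-$ as $t\to-\infty$; it is the pullback attractor to $X_-$. R-tipping away from $X_-$ for a parameter shift means that for some $r>0$ the corresponding $x^r$ does not satisfy $x^r(t)\to X_+$ as $t\to\infty$. Forward inflowing stable: the stable path $(X(s),\Lambda(s))$ is forward inflowing stable if for each $s\in\mathbb{R}$ there is a compact set $K(s)$ such that (i) $X(s)\in\operatorname{Int}K(s)$ for all $s\in\mathbb{R}$; (ii) if $s_1<s_2$ then $K(s_1)\subset K(s_2)$; (iii) if $x\in\partial K(s)$, then $F(x,\Lambda(s))$ points strictly into $K(s)$; (iv) $X_\pm\in\operatorname{Int}K_\pm$, where $K_-=\bigcap_{s\in\mathbb{R}}K(s)$ and $K_+=\overline{\bigcup_{s\in\mathbb{R}}K(s)}$; (v) $K_+\subset\mathbb{B}(X_+,\lambda_+)$ and $K_+$ is compact. Here a vector $v$ at $x\in\partial K$ points strictly into a closed set $K$ if there is $\varepsilon>0$ such that $x+hw\in K$ for all $0<h<\varepsilon$ and all $w$ with $|w-v|<\varepsilon$. *)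

(* Defs.v *)
From HB Require Import structures.
From mathcomp Require Import all_boot all_order all_algebra.
From mathcomp Require Import all_classical all_reals all_analysis.
Set Implicit Arguments.
Unset Strict Implicit.
Unset Printing Implicit Defensive.
Import Order.TTheory GRing.Theory Num.Theory.
Import numFieldNormedType.Exports.
Local Open Scope classical_set_scope.
Local Open Scope ring_scope.

(* The plane is R * R; its norm in the library is the sup norm. No definition
   below changes meaning if it is replaced by the Euclidean norm. *)

Section Defs.
Context {R : realType}.
Implicit Types (lm lp lam r s t : R) (Lam a b : R -> R).
Implicit Types (p v Xm Xp : R * R) (X x : R -> R * R) (F : R * R -> R -> R * R).

(* Derivatives are taken relative to A, hence one-sided at the endpoints of a
   closed interval A; the values of f outside A are irrelevant. *)
Definition smooth_on (A : set R) (f : R -> R) : Prop :=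
  exists2 D : nat -> R -> R,
    {in A, D 0%N =1 f} &
    forall n u, A u ->
      (D n y - D n u) / (y - u) @[y --> within A u^'] --> D n.+1 u.

Definition parameter_shift lm lp Lam : Prop :=
  [/\ forall s, lm < Lam s < lp,
      [/\ forall s, derivable Lam s 1,
          forall s, derivable (derive1 Lam) s 1 &
          continuous (derive1n 2 Lam)],
      Lam s @[s --> -oo] --> lm /\ Lam s @[s --> +oo] --> lp &
      derive1 Lam s @[s --> -oo] --> 0 /\ derive1 Lam s @[s --> +oo] --> 0].

Definition ext_shift lm lp Lam (s : \bar R) : R :=
  match s with
  | EFin s' => Lam s'
  | EPInf => lp
  | ENInf => lm
  end.

(* Solutions of x' = F(x, lam) need only exist forward in time. *)
Definition forward_trajectory F lam p x : Prop :=
  [/\ x 0 = p, {within `[0, +oo[, continuous x} &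
      forall t, 0 < t -> is_derive t 1 x (F (x t) lam)].

Definition basin F p lam : set (R * R) :=
  [set p0 | exists2 x, forward_trajectory F lam p0 x & x t @[t --> +oo] --> p].

(* "Attracting" means asymptotically stable: Lyapunov stable, with a basin that
   is a neighbourhood. *)
Definition attracting_equilibrium F lam p : Prop :=
  [/\ F p lam = 0,
      forall U : set (R * R), nbhs p U ->
        \forall p0 \near p, forall x, forward_trajectory F lam p0 x ->
          forall t, 0 <= t -> U (x t) &
      nbhs p (basin F p lam)].

Definition stable_path F lm lp Lam X Xm Xp : Prop :=
  [/\ continuous X,
      forall s, attracting_equilibrium F (Lam s) (X s),
      X s @[s --> -oo] --> Xm /\ X s @[s --> +oo] --> Xp &
      attracting_equilibrium F lm Xm /\ attracting_equilibrium F lp Xp].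

(* For a parameter shift and each 0 < r such an x exists and is unique. The
   extended system s' = r is reduced to s = r t. *)
Definition pullback_attractor F Lam r Xm x : Prop :=
  (forall t, is_derive t 1 x (F (x t) (Lam (r * t)))) /\
  x t @[t --> -oo] --> Xm.

Definition R_tipping F Lam Xm Xp : Prop :=
  exists r x, [/\ 0 < r, pullback_attractor F Lam r Xm x &
                  ~ (x t @[t --> +oo] --> Xp)].

Definition boundary (K : set (R * R)) : set (R * R) :=
  closure K `\` interior K.

Definition points_strictly_into (K : set (R * R)) p v : Prop :=
  exists2 e : R, 0 < e &
    forall (h : R) (w : R * R), 0 < h < e -> `|w - v| < e -> K (p + h *: w).

Definition forward_inflowing_stable F lm lp Lam X Xm Xp : Prop :=
  stable_path F lm lp Lam X Xm Xp /\
  exists K : R -> set (R * R),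
    let Km := \bigcap_s K s in
    let Kp := closure (\bigcup_s K s) in
    (forall s, compact (K s)) /\
    [/\ forall s, interior (K s) (X s),
        forall s1 s2, s1 < s2 -> K s1 `<=` K s2,
        forall s p, boundary (K s) p ->
          points_strictly_into (K s) p (F p (Lam s)),
        interior Km Xm /\ interior Kp Xp &
        Kp `<=` basin F Xp lp /\ compact Kp].

Definition field_ab a b (x : R * R) lam : R * R :=
  (- x.1 ^+ 3 + a lam * x.1 ^+ 2 + b lam * x.1 - a lam * (b lam + 1) + x.2,
   x.1 - x.2).

Definition p1 b Lam s : R * R :=
  (- Num.sqrt (b (Lam s) + 1), - Num.sqrt (b (Lam s) + 1)).

Definition p3 b Lam s : R * R :=
  (Num.sqrt (b (Lam s) + 1), Num.sqrt (b (Lam s) + 1)).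

End Defs.

(* Main.v *)
(* With B = b + 1 the system reads x1' = g(x1) + (x2 - x1), x2' = x1 - x2, where
   g(x) = - (x - a) (x^2 - B).  It is cooperative, so a first-contact argument
   shows that solutions cannot cross a strict upper (lower) barrier (u1, u2), and
   as soon as g(u) < 0 (resp. > 0) the pair (u, u + e) (resp. (u, u - e)) with a
   small e > 0 is such a barrier.  Everything about p3 follows from p1 through
   x -> -x, a -> -a.

   (2) By compactness of the extended line, a(s2) + sqrt B(s1) >= 3 delta for all
   s1 <= s2.  Then d(s) = delta + sup_(s' <= s) (- sqrt B(s')) is nondecreasing and
   stays between the stable branch - sqrt B and the saddle branch a, so the
   rectangles [c, d(s)] x [c - e, d(s) + e] are forward inflowing, and any solution
   that enters one of them converges to p1+.

   (1) Let Lamt = Lam o phi, where phi is slow except for a quick jump from s1 to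
   s2.  The pullback attractor stays above - sqrt B - h before the jump, can only
   fall a little during the jump, and afterwards stays above
   a + theta (sqrt B - a), hence away from p1+.

   Solutions exist globally for the truncated cubic by Picard iteration, and the
   barriers show that the truncation is not felt. *)

Require Import Defs.
From HB Require Import structures.
From mathcomp Require Import all_boot all_order all_algebra.
From mathcomp Require Import all_classical all_reals all_analysis.
From mathcomp Require Import ring lra.
Set Implicit Arguments.
Unset Strict Implicit.
Unset Printing Implicit Defensive.
Import Order.TTheory GRing.Theory Num.Theory.
Import numFieldNormedType.Exports.
Local Open Scope classical_set_scope.
Local Open Scope ring_scope.

(** * Real calculus *)

Section Calculus.
Context {R : realType}.
Implicit Types (f g F G S D : R -> R) (a b k t u x y z : R).

(** Barriers work forward in time only, whereas the pullback attractor is prescribed at minus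
    infinity. It is obtained by compactness: solutions started ever earlier stay in one small
    square, a cluster point is taken at a fixed time, and continuous dependence backwards in time
    transfers the estimates to all earlier times. Here truncation is essential, because solutions of
    the true cubic may blow up backwards. The running supremum [d] is used through its monotonicity
    alone, so barriers have the form [m + v] with [m] nondecreasing and possibly discontinuous: an
    upward jump of an upper barrier does no harm. As only the order of the times enters, (2) is
    obtained for every rate at once. In (1) the speed is put into the shift, and tipping occurs at
    rate 1; every constant there is measured against the gap between the stable branch at [s1] and
    the saddle branch at [s2]. Stability of the equilibria comes from one-sided linear bounds on the
    cubic ([well]) instead of linearization; these bounds also tolerate coefficients that merely
    converge. *)

Lemma is_derive_cont f (t l : R) : is_derive t 1 f l -> {for t, continuous f}.
Proof.
by move=> [df _]; apply: differentiable_continuous; exact/derivable1_diffP.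
Qed.

Lemma cntD f g t : {for t, continuous f} -> {for t, continuous g} ->
  {for t, continuous (fun s => f s + g s)}.
Proof. exact: cvgD. Qed.

Lemma cntN f t : {for t, continuous f} -> {for t, continuous (fun s => - f s)}.
Proof. exact: cvgN. Qed.

Lemma cnt_cst k t : {for t, continuous (fun=> k : R)}.
Proof. exact: cst_continuous. Qed.

Lemma cntB f g t : {for t, continuous f} -> {for t, continuous g} ->
  {for t, continuous (fun s => f s - g s)}.
Proof. exact: cvgB. Qed.

Lemma cntM f g t : {for t, continuous f} -> {for t, continuous g} ->
  {for t, continuous (fun s => f s * g s)}.
Proof. exact: cvgM. Qed.

Lemma der_eq f t a b : is_derive t 1 f a -> a = b -> is_derive t 1 f b.
Proof. by move=> df <-. Qed.

Lemma derD f g t a b : is_derive t 1 f a -> is_derive t 1 g b ->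
  is_derive t 1 (fun s => f s + g s) (a + b).
Proof. exact: is_deriveD. Qed.

Lemma derB f g t a b : is_derive t 1 f a -> is_derive t 1 g b ->
  is_derive t 1 (fun s => f s - g s) (a - b).
Proof. exact: is_deriveB. Qed.

Lemma derN f t a : is_derive t 1 f a -> is_derive t 1 (fun s => - f s) (- a).
Proof. exact: is_deriveN. Qed.

Lemma derM f g t a b : is_derive t 1 f a -> is_derive t 1 g b ->
  is_derive t 1 (fun s => f s * g s) (f t * b + g t * a).
Proof. exact: is_deriveM. Qed.

Lemma derZ k f t a : is_derive t 1 f a -> is_derive t 1 (fun s => k * f s) (k * a).
Proof. by move=> df; exact: (is_deriveZ k df). Qed.

Lemma der_cst k t : is_derive t 1 (fun=> k) (0 : R).
Proof. exact: is_derive_cst. Qed.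

Lemma der_id t : is_derive t 1 (fun s : R => s) (1 : R).
Proof. exact: is_derive_id. Qed.

Lemma der_comp f g t a b : is_derive (g t) 1 f a -> is_derive t 1 g b ->
  is_derive t 1 (fun s => f (g s)) (a * b).
Proof. exact: is_derive1_comp. Qed.

Lemma derV f t a : f t != 0 -> is_derive t 1 f a ->
  is_derive t 1 (fun s => (f s)^-1) (- (f t) ^- 2 * a).
Proof. exact: is_deriveV. Qed.

Lemma der_sqrt f t a : 0 < f t -> is_derive t 1 f a ->
  is_derive t 1 (fun s => Num.sqrt (f s)) ((2 * Num.sqrt (f t))^-1 * a).
Proof. by move=> f0 df; apply: der_comp => //; exact: is_derive1_sqrt. Qed.

Lemma der_expR f t a : is_derive t 1 f a ->
  is_derive t 1 (fun s => expR (f s)) (expR (f t) * a).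
Proof. by move=> df; apply: der_comp. Qed.

Lemma nondecr_of_derive f (df : R -> R) (a b : R) : a <= b ->
  {within `[a, b], continuous f} ->
  (forall t, a < t < b -> is_derive t 1 f (df t)) ->
  (forall t, a < t < b -> 0 <= df t) -> f a <= f b.
Proof.
move=> ab cf dfE df0; move: ab; rewrite le_eqVlt => /predU1P[->//|ab].
have dfE' x : x \in `]a, b[%R -> is_derive x 1 f (df x) by rewrite in_itv/= => /dfE.
have [c cab fE] := @MVT R f df a b ab dfE' cf.
by rewrite -subr_ge0 fE mulr_ge0 ?subr_ge0 ?(ltW ab)// df0//; move: cab; rewrite in_itv.
Qed.

Lemma nondecr_of_derive_all f (df : R -> R) (a b : R) : a <= b ->
  (forall t, is_derive t 1 f (df t)) ->
  (forall t, a < t < b -> 0 <= df t) -> f a <= f b.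
Proof.
move=> ab dfE df0; apply: (@nondecr_of_derive f df a b) => //.
by apply: continuous_subspaceT => x; exact: (is_derive_cont (dfE x)).
Qed.

(** Both [S - D] and [S + D] are nondecreasing and vanish at [t0]. The absolute value on [S] covers
    the times before [t0], where [S] is nonpositive. *)
Lemma norm_le_of_derive D S (dD dS : R -> R) (t0 t : R) :
  (forall t, is_derive t 1 D (dD t)) -> (forall t, is_derive t 1 S (dS t)) ->
  (forall t, `|dD t| <= dS t) -> D t0 = 0 -> S t0 = 0 -> `|D t| <= `|S t|.
Proof.
move=> hD hS le D0 S0.
have hm u : is_derive u 1 (S - D) (dS u - dD u) by exact: is_deriveB.
have hp u : is_derive u 1 (S + D) (dS u + dD u) by exact: is_deriveD.
have hm0 u : 0 <= dS u - dD u by have := le u; rewrite ler_norml subr_ge0 => /andP[].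
have hp0 u : 0 <= dS u + dD u.
  by have := le u; rewrite ler_norml => /andP[]; rewrite -subr_ge0 opprK addrC.
have [t0t|/ltW tt0] := leP t0 t.
  have := nondecr_of_derive_all t0t hm (fun u _ => hm0 u).
  have := nondecr_of_derive_all t0t hp (fun u _ => hp0 u).
  rewrite ?fctE D0 S0 => h1 h2.
  rewrite ler_norml; apply/andP; split; have := ler_norm (S t); lra.
have := nondecr_of_derive_all tt0 hm (fun u _ => hm0 u).
have := nondecr_of_derive_all tt0 hp (fun u _ => hp0 u).
rewrite ?fctE D0 S0 => h1 h2.
rewrite ler_norml; apply/andP; split; have := ler_norm (- S t); rewrite normrN; lra.
Qed.

(** An integral from a fixed left endpoint is an antiderivative only to the right of that endpoint,
    and no endpoint serves the whole line. [Fab] shows that increments do not depend on the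
    endpoint, which may therefore move with [x]. *)
Lemma primitive f t0 : continuous f ->
  exists2 G, (forall t, is_derive t 1 G (f t)) & G t0 = 0.
Proof.
move=> cf.
pose F a x := (\int[lebesgue_measure]_(t in [set` `[a, x]]) f t)%R.
have dF a x : a < x -> is_derive x 1 (F a) (f x).
  move=> ax.
  have [||d1 d2] := @continuous_FTC1_closed R f a x (x + 1) _ _ ax (cf x).
  - by rewrite ltrDl.
  - apply: continuous_compact_integrable; first exact: segment_compact.
    exact: continuous_subspaceT.
  by apply: DeriveDef; [exact: d1|rewrite -derive1E; exact: d2].
have Fab a b x y : a < x -> b < x -> a < y -> b < y ->
    F a x - F a y = F b x - F b y.
  suff H : forall x y, a < x -> b < x -> a < y -> b < y -> x <= y ->
      F a x - F a y = F b x - F b y.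
    move=> ax bx ay by_; have [xy|/ltW yx] := leP x y; first exact: H.
    by rewrite -opprB (H y x)// opprB.
  move=> {}x {}y ax bx ay by_ xy.
  have dd z : x <= z -> is_derive z 1 (F a - F b) (f z - f z).
    by move=> xz; apply: is_deriveB; apply: dF; exact: lt_le_trans xz.
  have cc : {within `[x, y], continuous (F a - F b)}.
    apply: continuous_in_subspaceT => z; rewrite inE/= in_itv/= => /andP[xz _].
    exact: (is_derive_cont (dd z xz)).
  have dd0 z : z \in `]x, y[%R -> is_derive z 1 (F a - F b) 0.
    by rewrite in_itv/= => /andP[/ltW xz _]; have := dd z xz; rewrite subrr.
  have [c _] := @MVT_segment R (F a - F b) (fun=> 0) x y xy dd0 cc.
  rewrite mul0r => h; have : (F a y - F b y) - (F a x - F b x) = 0 by exact: h.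
  by move=> ?; lra.
pose A x := - (`|x| + `|t0| + 1).
have Ax x : A x < x.
  by have := ler_norm (- x); have := normr_ge0 t0; rewrite normrN /A; lra.
have At x : A x < t0.
  by have := ler_norm (- t0); have := normr_ge0 x; rewrite normrN /A; lra.
exists (fun x => F (A x) x - F (A x) t0); last by rewrite subrr.
move=> t; apply: (@near_eq_is_derive _ _ _ (F (A t) \- cst (F (A t) t0))).
- near=> x; apply: Fab => //.
  near: x. exact: lt_nbhsr.
- rewrite -[X in is_derive _ _ _ X]subr0.
  by apply: is_deriveB; exact: dF.
Unshelve. all: by end_near. Qed.

End Calculus.

(** * Global solutions of Lipschitz systems *)

Section Picard.
Context {R : realType}.
Implicit Types (t s c e : R).

(** Completeness by nested intervals: [2 * c * 2^-1 ^+ n] is the tail of the geometric series, so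
    the intervals of that radius around [u n] are nested, and the supremum of their left ends lies
    in all of them. *)
Lemma geometric_cauchy (u : nat -> R) c : 0 <= c ->
  (forall n, `|u n.+1 - u n| <= c * 2^-1 ^+ n) ->
  exists l, forall n, `|u n - l| <= 2 * c * 2^-1 ^+ n.
Proof.
move=> c0 hu.
have p0 n : 0 <= c * 2^-1 ^+ n by rewrite mulr_ge0// exprn_ge0// invr_ge0.
pose a n := u n - 2 * (c * 2^-1 ^+ n); pose b n := u n + 2 * (c * 2^-1 ^+ n).
have E n : c * 2^-1 ^+ n = 2 * (c * 2^-1 ^+ n.+1) by rewrite exprS; field.
have step n : a n <= a n.+1 /\ b n.+1 <= b n.
  have := hu n; have := E n; rewrite /a /b ler_norml => e1 /andP[h1 h2].
  by split; lra.
have amon m n : (m <= n)%N -> a m <= a n.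
  by move: m n; apply/nondecreasing_seqP => k; exact: (step k).1.
have bmon m n : (m <= n)%N -> b n <= b m.
  by move: m n; apply/nonincreasing_seqP => k; exact: (step k).2.
have ab m n : a m <= b n.
  apply: (le_trans (amon _ _ (leq_maxl m n))); apply: (le_trans _ (bmon _ _ (leq_maxr m n))).
  by rewrite /a /b; have := p0 (maxn m n); lra.
have sa : has_sup (range a).
  by split; [exists (a 0%N), 0%N|exists (b 0%N) => _ [m _ <-]].
exists (sup (range a)) => n.
have h1 : a n <= sup (range a) by apply: ub_le_sup; [exact: sa.2|exists n].
have h2 : sup (range a) <= b n by apply: ge_sup; [exact: sa.1|move=> _ [m _ <-]].
by rewrite ler_norml; move: h1 h2; rewrite /a /b => h1 h2; apply/andP; split; lra.
Qed.

Lemma le0_geometric (x : R) c : (forall n, x <= c * 2^-1 ^+ n) -> x <= 0.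
Proof.
move=> h; have h2 : `|2^-1 : R| < 1 by rewrite ger0_norm ?invr_ge0// invf_lt1 ?ltr1n.
have c0 := @cvg_geometric R c _ h2.
by rewrite -(cvg_lim (@Rhausdorff R) c0); apply: limr_ge; [exact: cvgP c0|exact: nearW].
Qed.

Lemma lt_of_dist_lt (x y e : R) : `|x - y| < e -> y < x + e.
Proof. by rewrite ltr_norml => /andP[? ?]; lra. Qed.

Lemma dist3_lt (x y u v e : R) : `|u - v| < e / 3 -> `|v - y| < e / 3 ->
  `|u - x| < e / 3 -> `|x - y| < e.
Proof.
rewrite !ltr_norml => /andP[? ?] /andP[? ?] /andP[? ?].
by apply/andP; split; lra.
Qed.

(** Contraction in an exponentially weighted sup norm. [W] and [S] are [2 cosh] and [2 sinh] of
    [2 * L * (t - t0)], so [S' = 2 * L * W] and [|S| <= W]: integration from [t0] turns a bound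
    [k * W] into [k / (2 * L) * W]. With Lipschitz constant [L] the Picard operator thus halves
    distances, on the whole line and in both time directions at once. *)
Lemma picard (I : Type) (f : R -> (I -> R) -> I -> R) (L C t0 : R) (p : I -> R) :
  0 < L ->
  (forall t u v (K : R) i, (forall j, `|u j - v j| <= K) ->
     `|f t u i - f t v i| <= L * K) ->
  (forall t i, `|f t p i| <= C) ->
  (forall x : I -> R -> R, (forall i, continuous (x i)) ->
     forall i, continuous (fun t => f t (x ^~ t) i)) ->
  exists x : I -> R -> R, (forall i, x i t0 = p i) /\
    forall i t, is_derive t 1 (x i) (f t (x ^~ t) i).
Proof.
move=> L0 lip fC fcont.
pose E t := expR (2 * L * (t - t0)); pose E' t := expR (- (2 * L * (t - t0))).
pose W t := E t + E' t; pose S t := E t - E' t.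
have dl t : is_derive t 1 (fun s => 2 * L * (s - t0)) (2 * L).
  by apply: (der_eq (derZ _ (derB (der_id t) (der_cst t0 t)))); rewrite subr0 mulr1.
have dE t : is_derive t 1 E (E t * (2 * L)) by exact: der_expR.
have dE' t : is_derive t 1 E' (E' t * - (2 * L)) by apply: der_expR; exact: derN.
have dS t : is_derive t 1 S (2 * L * W t).
  by apply: (der_eq (derB (dE t) (dE' t))); rewrite /W; ring.
have cW : continuous W.
  by move=> t; apply: is_derive_cont; exact: derD.
have E0 t : 0 < E t by exact: expR_gt0.
have E'0 t : 0 < E' t by exact: expR_gt0.
have SW t : `|S t| <= W t.
  by rewrite /S /W ler_norml; have := E0 t; have := E'0 t => *; apply/andP; split; lra.
have W1 t : 1 <= W t.
  have := expR_ge1Dx (2 * L * (t - t0)); have := expR_ge1Dx (- (2 * L * (t - t0))).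
  rewrite -/(E t) -/(E' t) /W; lra.
have S0 : S t0 = 0 by rewrite /S /E /E' subrr mulr0 oppr0 subrr.
have key (D dD : R -> R) (k : R) : (forall t, is_derive t 1 D (dD t)) -> D t0 = 0 ->
    0 <= k -> (forall t, `|dD t| <= k * W t) -> forall t, `|D t| <= k / (2 * L) * W t.
  move=> hD D0 k0 hk t.
  have dkS s : is_derive s 1 (fun s => k / (2 * L) * S s) (k * W s).
    by apply: (der_eq (derZ _ (dS s))); field; exact: lt0r_neq0.
  have := @norm_le_of_derive _ D (fun s => k / (2 * L) * S s) dD (fun s =>
    k * W s) t0 t hD dkS hk D0.
  rewrite S0 mulr0 => /(_ erefl) /le_trans; apply.
  rewrite normrM ger0_norm ?divr_ge0 ?mulr_ge0 ?(ltW L0)//.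
  by rewrite ler_wpM2l ?divr_ge0 ?mulr_ge0 ?(ltW L0).
(* Choice needs a value for every [x]; for a discontinuous one, which never occurs in the iteration,
   [x] itself is returned. *)
have HT (x : I -> R -> R) : exists y : I -> R -> R, (forall i, continuous (x i)) ->
    forall i, y i t0 = p i /\ forall t, is_derive t 1 (y i) (f t (x ^~ t) i).
  have [cx|] := pselect (forall i, continuous (x i)); last by exists x.
  have HG i : exists g, (forall t, is_derive t 1 g (f t (x ^~ t) i)) /\ g t0 = 0.
    by have [g] := @primitive _ (fun t => f t (x ^~ t) i) t0 (fcont x cx i); exists g.
  have [G hG] := choice HG.
  exists (fun i t => G i t + p i) => _ i; split; first by rewrite (hG i).2 add0r.
  by move=> t; apply: (der_eq (derD ((hG i).1 t) (der_cst (p i) t))); rewrite addr0.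
have [T hT] := choice HT.
pose X n := iter n T (fun i _ => p i).
have cX n i : continuous (X n i).
  elim: n i => [i|n IH i]; first exact: cst_continuous.
  by move=> t; apply: is_derive_cont; exact: (hT _ IH i).2.
have X0 n i : X n i t0 = p i by case: n => // n; exact: (hT _ (cX n) i).1.
have dX n i t : is_derive t 1 (X n.+1 i) (f t (fun j => X n j t) i).
  exact: (hT _ (cX n) i).2.
have C0 (i : I) : 0 <= C by apply: le_trans (fC t0 i).
(* [|C|] rather than [C]: that [C] is nonnegative is known only when [I] is inhabited. *)
have [c c0 cE] : exists2 c : R, 0 <= c & `|C| / (2 * L) = c.
  by exists (`|C| / (2 * L)) => //; rewrite divr_ge0// mulr_ge0// ltW.
have cn0 n : 0 <= c * 2^-1 ^+ n by apply: mulr_ge0 => //; rewrite exprn_ge0// invr_ge0.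
have Xstep n i t : `|X n.+1 i t - X n i t| <= c * 2^-1 ^+ n * W t.
  elim: n i t => [i t|n IH i t].
    rewrite expr0 mulr1 -cE.
    apply: (key (fun s => X 1%N i s - X 0%N i s) (fun t => f t p i)) => // [s||s].
    - by apply: (der_eq (derB (dX 0%N i s) (der_cst (p i) s))); rewrite subr0.
    - by rewrite !X0 subrr.
    - apply: (le_trans (fC _ _)); rewrite -[leLHS]mulr1 ler_pM//; first exact: C0 i.
      exact: ler_norm.
  have -> : c * 2^-1 ^+ n.+1 = (L * (c * 2^-1 ^+ n)) / (2 * L).
    by rewrite exprS; field; exact: lt0r_neq0.
  apply: (key (fun s => X n.+2 i s - X n.+1 i s) (fun t => f t (fun j =>
    X n.+1 j t) i - f t (fun j => X n j t) i)).
  - by rewrite !X0 subrr.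
  - exact: mulr_ge0 (ltW L0) (cn0 n).
  - by move=> s; rewrite -mulrA; apply: lip => j; exact: IH.
have [x hx] : exists x : I -> R -> R, forall i t n,
  `|X n i t - x i t| <= 2 * (c * W t) * 2^-1 ^+ n.
  have H i t : exists l, forall n, `|X n i t - l| <= 2 * (c * W t) * 2^-1 ^+ n.
    apply: (@geometric_cauchy (fun n => X n i t));
      first exact: mulr_ge0 c0 (le_trans ler01 (W1 t)).
    by move=> n; rewrite mulrAC; exact: Xstep.
  have [x hx] := choice (fun it : I * R => H it.1 it.2).
  by exists (fun i t => x (i, t)) => i t n; exact: hx (i, t) n.
have cx i : continuous (x i).
  (* The convergence is uniform where [W] is bounded, in particular near [t]. *)
  move=> t; apply/cvgrPdist_lt => /= e e0.
  have [n hn] : exists n, 2 * (c * (W t + 1)) * 2^-1 ^+ n < e / 3.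
    apply: contrapT => /forallNP h.
    suff : e / 3 <= 0 by rewrite leNgt divr_gt0.
    by apply: (@le0_geometric _ (2 * (c * (W t + 1)))) => n; rewrite leNgt; apply/negP/h.
  have hn' s : W s < W t + 1 -> `|X n i s - x i s| < e / 3.
    move=> hs; apply: (le_lt_trans (hx i s n)); apply: le_lt_trans hn.
    by rewrite ler_wpM2r ?exprn_ge0 ?invr_ge0// ler_wpM2l// ler_wpM2l// ltW.
  near=> s.
  have h1 : W s < W t + 1.
    near: s; have /cvgrPdist_lt/(_ 1 ltr01) := cW t.
    by apply: filterS => s; exact: lt_of_dist_lt.
  have h2 : `|X n i t - X n i s| < e / 3.
    by near: s; have /cvgrPdist_lt := cX n i t; apply; rewrite divr_gt0.
  have h3 := hn' s h1; have h4 : `|X n i t - x i t| < e / 3 by apply: hn'; rewrite ltrDl.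
  exact: dist3_lt h2 h3 h4.
(* Both [T x - X n.+1] (by contraction) and [X n.+1 - x] are of order [2^-1 ^+ n]. *)
have Tx i t : T x i t = x i t.
  have H n : `|T x i t - x i t| <= (3 * c * W t) * 2^-1 ^+ n.
    have h1 : `|T x i t - X n.+1 i t| <= (L * (2 * c * 2^-1 ^+ n)) / (2 * L) * W t.
      apply: (key (fun s => T x i s - X n.+1 i s) (fun t => f t (x ^~ t) i - f t (fun j =>
        X n j t) i)).
      - by move=> s; exact: derB ((hT _ cx i).2 s) (dX n i s).
      - by rewrite X0 (hT _ cx i).1 subrr.
      - by rewrite -[2 * c * _]mulrA; apply: mulr_ge0 (ltW L0) (mulr_ge0 _ (cn0 n)).
      - move=> s; rewrite -mulrA; apply: lip => j; rewrite distrC.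
        by apply: (le_trans (hx j s n)); rewrite le_eqVlt; apply/orP; left; apply/eqP; ring.
    have h2 := hx i t n.+1.
    apply: (le_trans (ler_distD (X n.+1 i t) _ _)).
    apply: (le_trans (lerD h1 h2)).
    have -> : L * (2 * c * 2^-1 ^+ n) / (2 * L) * W t + 2 * (c * W t) * 2^-1 ^+ n.+1 = 2 *
      (c * W t * 2^-1 ^+ n).
      by rewrite exprS; field; exact: lt0r_neq0.
    have : 0 <= c * W t * 2^-1 ^+ n.
      by rewrite mulrAC; apply: mulr_ge0 (cn0 n) (le_trans ler01 (W1 t)).
    move=> h; have -> : 3 * c * W t * 2^-1 ^+ n = 3 * (c * W t * 2^-1 ^+ n) by rewrite !mulrA.
    by rewrite ler_wpM2r// ler_nat.
  by have := le0_geometric H; rewrite normr_le0 subr_eq0 => /eqP.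
have Txx i : T x i = x i by apply/funext => t.
exists x; split=> [i|i t]; first by rewrite -Txx (hT _ cx i).1.
by have := (hT _ cx i).2 t; rewrite Txx.
Unshelve. all: by end_near. Qed.

End Picard.

(** * Barriers for planar systems with diffusive coupling *)

Section Barrier.
Context {R : realType}.
Implicit Types (t s T e q d K h : R).

Lemma within_dist T (z : R -> R) t e : {within `[T, +oo[, continuous z} -> T <= t ->
  0 < e -> exists2 d, 0 < d & forall s, T <= s -> `|t - s| < d -> `|z t - z s| < e.
Proof.
move=> cz Tt e0.
have Tt' : `[T, +oo[%classic t by rewrite /= in_itv/= Tt.
move/subspace_continuousP : cz => /(_ t Tt') /cvgrPdist_lt/(_ e e0).
move=> [d /= d0 hd]; exists d => // s Ts ts; apply: hd => //=.
by rewrite in_itv/= Ts.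
Qed.

Lemma derive_gt0_left (z : R -> R) t (l : R) : is_derive t 1 z l -> 0 < l ->
  exists2 d, 0 < d & forall s, t - d < s -> s < t -> z s < z t.
Proof.
move=> [dz zl] l0.
have : h^-1 *: (z (h + t) - z t) @[h --> 0^'] --> l.
  have /cvg_ex[l' hl] := dz; have := hl; rewrite -zl /derive.
  have -> : (fun h => h^-1 *: (z (h + t) - z t)) = (fun h : R =>
    h^-1 *: (z (h *: 1 + t) - z t)).
    by apply/funext => h; rewrite /GRing.scale/= mulr1.
  by move=> {}hl; rewrite (cvg_lim (@Rhausdorff R) hl).
move=> /cvgrPdist_lt/(_ l l0) [d /= d0 hd]; exists d => // s ts st.
have /hd : ball_ Num.norm 0 d (s - t).
  by rewrite /ball_/= sub0r opprB ger0_norm ?subr_ge0 ?(ltW st)//; move: ts; lra.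
rewrite subr_eq0 => /(_ (negbT (lt_eqF st))).
rewrite subrK /GRing.scale/=.
rewrite ltr_norml => /andP[_]; rewrite ltrBlDr ltrDl.
have hi : (s - t)^-1 < 0 by rewrite invr_lt0 subr_lt0.
by rewrite nmulr_rgt0// subr_lt0.
Qed.

(** First contact for [m i + z i], where [m i] may jump upwards. Monotonicity of [m i] does the work
    of continuity on each side of the infimum [tau] of the bad times: a negative value, or a zero
    with positive slope, would force negative values just before [tau], and positive values stay
    positive for a while after [tau]. *)
Lemma barrier (m z dz : bool -> R -> R) T T' :
  (forall i s t, T <= s -> s <= t -> m i s <= m i t) ->
  (forall i, {within `[T, +oo[, continuous (z i)}) ->
  (forall i t, T < t -> t <= T' -> is_derive t 1 (z i) (dz i t)) ->
  (forall i, 0 < m i T + z i T) ->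
  (forall i t, T < t -> t <= T' -> (forall j, 0 <= m j t + z j t) -> m i t + z i t = 0 ->
     0 < dz i t) ->
  forall i t, T <= t -> t <= T' -> 0 < m i t + z i t.
Proof.
move=> mh cz dzh y0 h.
suff : [set t | T <= t <= T' /\ exists i, m i t + z i t <= 0] = set0.
  move=> S0 i t Tt tT'; rewrite ltNge; apply/negP => yt.
  by have : set0 t by rewrite -S0; split; [rewrite Tt|exists i].
apply/eqP/negPn/negP => /set0P S0; set S := [set _ | _] in S0.
have hS : has_inf S by split => //; exists T => t [/andP[]].
pose tau := inf S.
have Ttau : T <= tau by apply: lb_le_inf => // t [/andP[]].
have tauT' : tau <= T'.
  by have [t St] := S0; apply: (@le_trans _ _ t); [apply: ge_inf => //;
    exact: hS.2|case: St => /andP[]].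
have before t j : T <= t -> t < tau -> 0 < m j t + z j t.
  move=> Tt ttau; rewrite ltNge; apply/negP => yt.
  by move: (ttau); rewrite ltNge => /negP; apply; apply: ge_inf; [exact: hS.2|split;
    [rewrite Tt (le_trans (ltW ttau))|exists j]].
have attau j : 0 <= m j tau + z j tau.
  move: Ttau; rewrite le_eqVlt => /predU1P[<-|Ttau]; first exact/ltW.
  rewrite leNgt; apply/negP => yneg.
  have e0 : 0 < - (m j tau + z j tau) by rewrite oppr_gt0.
  have [d d0 hd] := within_dist (cz j) (ltW Ttau) e0.
  pose s := Num.max T (tau - d / 2).
  have Ts : T <= s by rewrite le_max lexx.
  have st : s < tau by rewrite gt_max Ttau ltrBlDr ltrDl divr_gt0.
  have ds : `|tau - s| < d.
    rewrite ger0_norm ?subr_ge0 ?(ltW st)//.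
    have : tau - d / 2 <= s by rewrite le_max lexx orbT.
    lra.
  have := before s j Ts st; have := mh j s tau Ts (ltW st).
  have := hd s Ts ds; rewrite ltr_norml => /andP[? ?] ? ?; lra.
have {}Ttau : T < tau.
  rewrite lt_neqAle Ttau andbT; apply/eqP => Te.
  suff [d d0 hd] : exists2 d, 0 < d & forall s j, T <= s -> s < tau + d -> 0 < m j s + z j s.
    have [t [[/andP[Tt _] [j yj]] ttd]] : exists t, S t /\ t < tau + d.
      by have [t St td] := inf_adherent d0 hS; exists t.
    by have := hd t j Tt ttd; rewrite ltNge yj.
  have hj j : exists2 d, 0 < d & forall s, T <= s -> s < tau + d -> 0 < m j s + z j s.
    have [d d0 hd] := within_dist (cz j) (lexx T) (y0 j).
    exists d => // s Ts std; have := mh j T s (lexx T) Ts.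
    have : `|T - s| < d by rewrite ler0_norm ?subr_le0//; move: std; rewrite -Te; lra.
    by move=> /(hd s Ts); rewrite ltr_norml => /andP[? ?] ?; lra.
  have [d1 d10 h1] := hj true; have [d2 d20 h2] := hj false.
  exists (Num.min d1 d2); first by rewrite lt_min d10.
  move=> s [] Ts std; [apply: h1 => //|apply: h2 => //]; apply: (lt_le_trans std);
    by rewrite lerD2l ge_min lexx ?orbT.
(* Either a component vanishes at [tau], and then it was negative just before, or both are positive,
   and then they remain so beyond [tau], against the choice of the infimum. *)
have [allpos|] := pselect (forall j, 0 < m j tau + z j tau); last first.
  move=> /existsNP[j /negP]; rewrite -leNgt => yj.
  have yj0 : m j tau + z j tau = 0 by apply/eqP; rewrite eq_le yj attau.
  have [d d0 hd] := derive_gt0_left (dzh j tau Ttau tauT') (h j tau Ttau tauT' attau yj0).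
  pose s := Num.max T (tau - d / 2).
  have Ts : T <= s by rewrite le_max lexx.
  have st : s < tau by rewrite gt_max Ttau ltrBlDr ltrDl divr_gt0.
  have ds : tau - d < s by rewrite lt_max ltrD2l ltrN2 gtr_pMr// invf_lt1// ltr1n orbT.
  have := hd s ds st; have := before s j Ts st; have := mh j s tau Ts (ltW st).
  lra.
have hj j : exists2 d, 0 < d & forall s, T <= s -> s < tau + d -> 0 < m j s + z j s.
  have [d d0 hd] := within_dist (cz j) (ltW Ttau) (allpos j).
  exists d => // s Ts std; have [stau|taus] := ltP s tau; first exact: before.
  have := mh j tau s (ltW Ttau) taus.
  have : `|tau - s| < d by rewrite ler0_norm ?subr_le0//; lra.
  by move=> /(hd s Ts); rewrite ltr_norml => /andP[? ?] ?; lra.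
have [d1 d10 h1] := hj true; have [d2 d20 h2] := hj false.
have d0 : 0 < Num.min d1 d2 by rewrite lt_min d10.
have [t [/andP[Tt _] [[] yj]] ttd] := inf_adherent d0 hS; move: yj; rewrite leNgt => /negP;
  apply.
  by apply: h1 => //; apply: (lt_le_trans ttd); rewrite lerD2l ge_min lexx.
by apply: h2 => //; apply: (lt_le_trans ttd); rewrite lerD2l ge_min lexx orbT.
Qed.

Definition psol (g : R -> R -> R) T (x1 x2 : R -> R) :=
  [/\ {within `[T, +oo[, continuous x1}, {within `[T, +oo[, continuous x2},
      forall t, T < t -> is_derive t 1 x1 (g t (x1 t) + (x2 t - x1 t)) &
      forall t, T < t -> is_derive t 1 x2 (x1 t - x2 t)].

Lemma psol_restrict g T T' x1 x2 : T <= T' -> psol g T x1 x2 -> psol g T' x1 x2.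
Proof.
move=> TT' [c1 c2 d1 d2]; have sub : `[T', +oo[ `<=` `[T, +oo[.
  by move=> t /=; rewrite !in_itv/= !andbT; exact: le_trans.
split; [exact: continuous_subspaceW c1|exact: continuous_subspaceW c2| |] => t Tt.
  by apply: d1; exact: le_lt_trans Tt.
by apply: d2; exact: le_lt_trans Tt.
Qed.

Lemma within_oppr T (z : R -> R) : {within `[T, +oo[, continuous z} ->
  {within `[T, +oo[, continuous (fun t => - z t)}.
Proof. by move=> cz t; apply: continuousN; exact: cz. Qed.

Lemma psolN g T x1 x2 : psol g T x1 x2 ->
  psol (fun t x => - g t (- x)) T (fun t => - x1 t) (fun t => - x2 t).
Proof.
move=> [c1 c2 d1 d2]; split; [exact: within_oppr|exact: within_oppr| |] => t Tt.
  by apply: (der_eq (derN (d1 t Tt))); rewrite opprK; ring.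
by apply: (der_eq (derN (d2 t Tt))); ring.
Qed.

(** This is [barrier] for [m + v1 - x1] and [m + v2 - x2]. Cooperativity shows in the contact
    hypotheses: each is required only where the other component is still below its barrier, so that
    the coupling has a favourable bound. *)
Lemma upper_barrier g T T' x1 x2 (m v1 v2 dv1 dv2 : R -> R) :
  psol g T x1 x2 ->
  (forall s t, T <= s -> s <= t -> m s <= m t) ->
  {within `[T, +oo[, continuous v1} -> {within `[T, +oo[, continuous v2} ->
  (forall t, T < t -> is_derive t 1 v1 (dv1 t)) ->
  (forall t, T < t -> is_derive t 1 v2 (dv2 t)) ->
  x1 T < m T + v1 T -> x2 T < m T + v2 T ->
  (forall t, T < t -> t <= T' -> x1 t = m t + v1 t -> x2 t <= m t + v2 t ->
     g t (x1 t) + (x2 t - x1 t) < dv1 t) ->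
  (forall t, T < t -> t <= T' -> x2 t = m t + v2 t -> x1 t <= m t + v1 t ->
     x1 t - x2 t < dv2 t) ->
  forall t, T <= t -> t <= T' -> x1 t < m t + v1 t /\ x2 t < m t + v2 t.
Proof.
move=> [c1 c2 d1 d2] mh cv1 cv2 dv1h dv2h i1 i2 h1 h2.
pose z (b : bool) t := if b then v1 t - x1 t else v2 t - x2 t.
pose dz (b : bool) t := if b then dv1 t - (g t (x1 t) + (x2 t - x1 t))
  else dv2 t - (x1 t - x2 t).
have H : forall b t, T <= t -> t <= T' -> 0 < m t + z b t.
  apply: (@barrier (fun=> m) z dz T T') => //.
  - move=> [] t; [apply: continuousB; [exact: cv1|exact: c1]|apply: continuousB;
    [exact: cv2|exact: c2]].
  - by move=> [] t Tt _; apply: derB; [exact: dv1h|exact: d1|exact: dv2h|exact: d2].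
  - by move=> [] /=; lra.
  - move=> [] t Tt tT' all0 e; have := all0 true; have := all0 false; move: e;
      rewrite /z /dz => e a1 a2; rewrite subr_gt0.
    + by apply: h1 => //; lra.
    + by apply: h2 => //; lra.
by move=> t Tt tT'; have := H true t Tt tT'; have := H false t Tt tT'; rewrite /z; lra.
Qed.

Lemma upper_barrier_cst g T T' x1 x2 u1 u2 :
  psol g T x1 x2 -> u1 < u2 ->
  (forall t, T < t -> t <= T' -> g t u1 + (u2 - u1) < 0) ->
  x1 T < u1 -> x2 T < u2 ->
  forall t, T <= t -> t <= T' -> x1 t < u1 /\ x2 t < u2.
Proof.
move=> px u12 gu i1 i2 t Tt.
have := @upper_barrier g T T' x1 x2 (fun=> 0) (fun=> u1) (fun=> u2) (fun=> 0) (fun=> 0) px.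
have cc (u : R) : {within `[T, +oo[, continuous (fun=> u : R)}.
  by move=> ?; exact: cst_continuous.
move=> /(_ (fun _ _ _ _ => lexx _) (cc _) (cc _)); rewrite !add0r; apply => //.
- move=> s Ts sT' -> x2s; apply: le_lt_trans (gu s Ts sT').
  by rewrite lerD2l lerD2r.
- by move=> s Ts sT' -> x1s; rewrite subr_lt0; exact: le_lt_trans u12.
Qed.

(* The barrier is (q + y, q + (1 + K/3) y) with y relaxing exponentially
   at rate K/6 from d - q to a small rho. *)
Lemma conv_upper g T x1 x2 q d K : psol g T x1 x2 -> q < d -> 0 < K -> K <= 1 ->
  (forall t, T <= t -> x1 t < d /\ x2 t < d) ->
  (forall e, 0 < e -> exists T1, forall t, T1 <= t -> q <= x1 t -> x1 t <= d ->
     g t (x1 t) <= - K * (x1 t - q) + e) ->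
  forall h, 0 < h -> exists T1, forall t, T1 <= t -> x1 t < q + h /\ x2 t < q + h.
Proof.
move=> px qd K0 K1 xd hg h h0.
pose rho := Num.min (h / 4) ((d - q) / 2).
have rho0 : 0 < rho by rewrite lt_min !divr_gt0// subr_gt0.
have rhoh : rho <= h / 4 by rewrite ge_min lexx.
have rhod : rho <= (d - q) / 2 by rewrite ge_min lexx orbT.
clearbody rho.
(* Room for this error: on the first face the drift is at most [- 2 / 3 * K * y + K * rho / 2],
   which is below the slope [- (K / 6) * (y - rho)] because [y > rho]. *)
have e0 : 0 < K * rho / 2 by rewrite divr_gt0// mulr_gt0.
have [T1 hT1] := hg _ e0.
pose T2 := Num.max T T1.
have TT2 : T <= T2 by rewrite le_max lexx.
have T1T2 : T1 <= T2 by rewrite le_max lexx orbT.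
clearbody T2.
pose H := d - q - rho; have H0 : 0 < H by rewrite /H; lra.
have Hd : q + rho + H = d by rewrite /H; ring.
clearbody H.
pose E t := expR (- (K / 6 * (t - T2))).
have E0 t : 0 < E t by exact: expR_gt0.
have ET : E T2 = 1 by rewrite /E subrr mulr0 oppr0 expR0.
have dE t : is_derive t 1 E (E t * - (K / 6)).
  apply: der_expR; apply: derN.
  by apply: (der_eq (derZ _ (derB (der_id t) (der_cst T2 t)))); rewrite subr0 mulr1.
have E1 t : T2 <= t -> E t <= 1.
  move=> Tt; rewrite -expR0 ler_expR oppr_le0 mulr_ge0 ?subr_ge0// divr_ge0 ?ltW//.
pose y t := rho + H * E t; pose dy t := H * (E t * - (K / 6)).
have hdy t : is_derive t 1 y (dy t).
  by apply: (der_eq (derD (der_cst rho t) (derZ H (dE t)))); rewrite add0r.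
have dyE t : dy t = - (K / 6) * (y t - rho) by rewrite /dy /y; ring.
have yrho t : rho < y t by rewrite /y ltrDl mulr_gt0.
have yd t : T2 <= t -> y t <= d - q.
  move=> /E1 e1; rewrite /y; have : H * E t <= H by rewrite ger_pMr.
  lra.
have hv1 t : is_derive t 1 (fun t => q + y t) (dy t).
  by apply: (der_eq (derD (der_cst q t) (hdy t))); rewrite add0r.
have hv2 t : is_derive t 1 (fun t => q + (1 + K / 3) * y t) ((1 + K / 3) * dy t).
  by apply: (der_eq (derD (der_cst q t) (derZ _ (hdy t)))); rewrite add0r.
have px2 := psol_restrict TT2 px.
have B : forall t, T2 <= t -> x1 t < q + y t /\ x2 t < q + (1 + K / 3) * y t.
  move=> t Tt; have [xd1 xd2] := xd T2 TT2.
  suff : x1 t < 0 + (q + y t) /\ x2 t < 0 + (q + (1 + K / 3) * y t) by rewrite !add0r.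
  apply: (@upper_barrier g T2 t x1 x2 (fun=> 0) (fun t => q + y t)
    (fun t => q + (1 + K / 3) * y t) dy (fun t => (1 + K / 3) * dy t)) => //; rewrite ?add0r.
  - exact: (continuous_subspaceT (fun t => is_derive_cont (hv1 t))).
  - exact: (continuous_subspaceT (fun t => is_derive_cont (hv2 t))).
  - by rewrite /y ET mulr1; lra.
  - rewrite /y ET mulr1.
    have : (1 + K / 3) * (rho + H) = (rho + H) + K / 3 * (rho + H) by ring.
    have : 0 < K / 3 * (rho + H) by rewrite mulr_gt0 ?divr_gt0// addr_gt0.
    lra.
  - move=> s Ts _; rewrite !add0r => e1 e2.
    have ysd := yd s (ltW Ts); have ysr := yrho s.
    have gle : g s (x1 s) <= - K * y s + K * rho / 2.
      have := hT1 s (le_trans T1T2 (ltW Ts)); rewrite e1 => /(_ _ _)/le_trans; apply.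
      + by lra.
      + by lra.
      + by rewrite lerD2r; have -> : q + y s - q = y s by ring.
    have : x2 s - x1 s <= K / 3 * y s.
      have : (1 + K / 3) * y s = y s + K / 3 * y s by ring.
      by rewrite e1; lra.
    rewrite dyE; have : K * rho < K * y s by rewrite ltr_pM2l.
    have -> : - (K / 6) * (y s - rho) = - (K * y s) / 6 + K * rho / 6 by field.
    have -> : K / 3 * y s = K * y s / 3 by field.
    move: gle; have -> : - K * y s = - (K * y s) by ring.
    lra.
  (* Second face: since [K <= 1], the factor [(1 + K / 3) * (K / 6)] is at most [2 / 9 * K], less
     than the inward pull [K / 3]. *)
  - move=> s Ts _; rewrite !add0r => e1 e2.
    have ysd := yd s (ltW Ts); have ysr := yrho s.
    rewrite e1 dyE.
    apply: (@le_lt_trans _ _ (- (K / 3 * y s))).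
      have -> : (1 + K / 3) * y s = y s + K / 3 * y s by ring.
      lra.
    have a1 : 0 < K * y s by rewrite mulr_gt0// (lt_trans rho0).
    have a2 : 0 < K * rho by rewrite mulr_gt0.
    have a3 : K * (K * y s) <= K * y s by rewrite ger_pMl.
    have a4 : 0 < K * (K * rho) by rewrite mulr_gt0.
    have -> : (1 + K / 3) * (- (K / 6) * (y s - rho)) =
      - (K * y s) / 6 - K * (K * y s) / 18 + K * rho / 6 + K * (K * rho) / 18 by field.
    have -> : K / 3 * y s = K * y s / 3 by field.
    lra.
(* Waiting time from [1 + u <= expR u]: the exponential part of [y] is then below [rho], so
   [y < 2 * rho], and both components are below [q + 8 / 3 * rho], hence below [q + h]. *)
pose T3 := T2 + 6 / K * (H / rho).
have T23 : T2 <= T3 by rewrite lerDl mulr_ge0 ?divr_ge0 ?ltW.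
exists T3 => t Tt.
have [b1 b2] := B t (le_trans T23 Tt).
have yt : y t < 2 * rho.
  have : 1 + H / rho <= expR (K / 6 * (t - T2)).
    apply: (le_trans _ (expR_ge1Dx _)); rewrite lerD2l.
    have -> : H / rho = K / 6 * (6 / K * (H / rho)) by field; rewrite !gt_eqF.
    rewrite ler_pM2l ?divr_gt0//; move: Tt; rewrite /T3; lra.
  rewrite /y /E expRN => h1.
  have h2 : H / rho < expR (K / 6 * (t - T2)) by apply: lt_le_trans h1; rewrite ltrDr.
  have : H * (expR (K / 6 * (t - T2)))^-1 < rho.
    by rewrite ltr_pdivrMr ?expR_gt0// mulrC -ltr_pdivrMr.
  lra.
have y0 : 0 < y t by exact: lt_trans (yrho t).
have : (1 + K / 3) * y t <= (1 + 1 / 3) * y t by rewrite ler_pM2r//; lra.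
lra.
Qed.

End Barrier.

(** * The cubic nonlinearity and its truncation *)

Section Cubic.
Context {R : realType}.
Implicit Types (t s T e q d K h M A a B x y : R).

Definition cub a B x := - ((x - a) * (x ^+ 2 - B)).

Lemma cubN a B x : - cub a B (- x) = cub (- a) B x.
Proof. by rewrite /cub; ring. Qed.

Definition clamp M x := Num.max (- M) (Num.min M x).

Lemma clamp_id M x : `|x| <= M -> clamp M x = x.
Proof.
by rewrite ler_norml /clamp => /andP[h1 h2]; rewrite (min_idPr h2) (max_idPr h1).
Qed.

Lemma clampE M x : 0 <= M ->
  [\/ clamp M x = x /\ - M <= x <= M, clamp M x = M /\ M <= x | clamp M x = - M /\ x <= - M].
Proof.
move=> M0; rewrite /clamp; have [Mx|xM] := leP M x.
  by rewrite (max_idPr _); [apply: Or32|lra].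
have [h|h] := leP (- M) x; first by apply: Or31; rewrite (ltW xM).
by apply: Or33; rewrite ltW.
Qed.

Lemma norm_clamp M x : 0 <= M -> `|clamp M x| <= M.
Proof.
by move=> M0; have [[-> /andP[? ?]]|[-> _]|[-> _]] := clampE x M0;
  rewrite ler_norml; apply/andP; split; lra.
Qed.

Lemma clamp_dist M x y : 0 <= M -> `|clamp M x - clamp M y| <= `|x - y|.
Proof.
move=> M0; wlog xy : x y / x <= y => [H|].
  have [/H//|/ltW/H] := leP x y; by rewrite distrC [leRHS]distrC.
rewrite [leRHS]ler0_norm ?subr_le0//.
by have [[-> /andP[? ?]]|[-> ?]|[-> ?]] := clampE x M0;
  have [[-> /andP[? ?]]|[-> ?]|[-> ?]] := clampE y M0;
  rewrite ler_norml; apply/andP; split; lra.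
Qed.

Lemma clamp_continuous M : 0 <= M -> continuous (clamp M).
Proof.
move=> M0 x; apply/cvgrPdist_lt => e e0; near=> y.
apply: (le_lt_trans (clamp_dist _ _ M0)).
by near: y; exists e.
Unshelve. all: by end_near. Qed.

Lemma cub_lip a B x y A M : `|a| <= A -> `|B| <= A -> `|x| <= M -> `|y| <= M ->
  `|cub a B x - cub a B y| <= (3 * M ^+ 2 + 2 * A * M + A) * `|x - y|.
Proof.
move=> ha hB hx hy.
have -> : cub a B x - cub a B y = (a * (x + y) + B - (x * x + x * y + y * y)) * (x - y).
  by rewrite /cub; ring.
rewrite normrM ler_wpM2r//.
have hxx : `|x * x| <= M ^+ 2 by rewrite normrM expr2 ler_pM.
have hxy : `|x * y| <= M ^+ 2 by rewrite normrM expr2 ler_pM.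
have hyy : `|y * y| <= M ^+ 2 by rewrite normrM expr2 ler_pM.
have haxy : `|a * (x + y)| <= A * (M + M).
  by rewrite normrM ler_pM// (le_trans (ler_normD _ _))// lerD.
apply: (le_trans (ler_normB _ _)); apply: (le_trans (lerD (ler_normD _ _) (ler_normD _ _))).
have h3 := ler_normD (x * x) (x * y).
have : `|a * (x + y)| + `|B| + (`|x * x| + `|x * y| + `|y * y|) <=
   3 * M ^+ 2 + 2 * A * M + A.
  have : A * (M + M) = 2 * A * M by ring.
  lra.
lra.
Qed.

Lemma cub_bound a B x A M : `|a| <= A -> `|B| <= A -> `|x| <= M ->
  `|cub a B x| <= (M + A) * (M ^+ 2 + A).
Proof.
move=> ha hB hx; rewrite /cub normrN normrM ler_pM//.
  by rewrite (le_trans (ler_normB _ _))// lerD.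
rewrite (le_trans (ler_normB _ _))// lerD//.
by rewrite normrX lerXn2r// nnegrE (le_trans _ hx).
Qed.

(** Both factors of the cubic are at least 2 there. The margin 1 pays for the coupling along a
    barrier pair whose entries differ by 1. *)
Lemma cub_far a B A M : 0 <= A -> `|a| <= A -> `|B| <= A -> A + 2 <= M ->
  cub a B M + 1 < 0.
Proof.
rewrite !ler_norml /cub => A0 /andP[? ?] /andP[? ?] AM.
have h1 : 2 <= M - a by lra.
have h2 : 2 <= M ^+ 2 - B.
  have : (A + 2) * (A + 2) <= M * M by rewrite ler_pM//; lra.
  rewrite expr2; nra.
by have := ler_pM (ler0n _ 2) (ler0n _ 2) h1 h2; lra.
Qed.

Section Flow.
Variables (al be : R -> R) (A : R).
Hypotheses (cal : continuous al) (cbe : continuous be).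
Hypotheses (A0 : 0 <= A) (alA : forall t, `|al t| <= A) (beA : forall t, `|be t| <= A).

Definition tcub M t x := cub (al t) (be t) (clamp M x).

Definition lipc M := (3 * M ^+ 2 + 2 * A * M + A) + 2.

Definition tfield M t (u : bool -> R) (i : bool) :=
  if i then tcub M t (u true) + (u false - u true) else u true - u false.

Lemma lipc_gt0 M : 0 <= M -> 0 < lipc M.
Proof. by move=> M0; rewrite /lipc ltr_wpDl// !addr_ge0// !mulr_ge0// exprn_ge0. Qed.

Lemma tfield_lip M t (u v : bool -> R) K i : 0 <= M -> (forall j, `|u j - v j| <= K) ->
  `|tfield M t u i - tfield M t v i| <= lipc M * K.
Proof.
move=> M0 uv; have K0 : 0 <= K by apply: le_trans (uv true).
have c0 : 0 <= 3 * M ^+ 2 + 2 * A * M + A by rewrite !addr_ge0// !mulr_ge0// exprn_ge0.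
have ht := uv true; have hf := uv false.
have h2 : `|(u true - v true) - (u false - v false)| <= 2 * K.
  by rewrite (le_trans (ler_normB _ _))//; lra.
case: i; rewrite /tfield.
  have -> : tcub M t (u true) + (u false - u true) - (tcub M t (v true) + (v false - v true))
     = (tcub M t (u true) - tcub M t (v true)) - ((u true - v true) - (u false - v false))
       by ring.
  apply: (le_trans (ler_normB _ _)); rewrite /lipc mulrDl lerD//.
  apply: (le_trans (cub_lip (alA t) (beA t) (norm_clamp _ M0) (norm_clamp _ M0))).
  by rewrite ler_wpM2l// (le_trans (clamp_dist _ _ M0)).
have -> : u true - u false - (v true - v false) = (u true - v true) - (u false - v false)
  by ring.
apply: (le_trans h2); rewrite ler_wpM2r// /lipc; lra.
Qed.

Lemma tcub_continuous M (x : R -> R) : 0 <= M -> continuous x ->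
  continuous (fun t => tcub M t (x t)).
Proof.
move=> M0 cx t; have cc : {for t, continuous (fun t => clamp M (x t))}.
  by apply: continuous_comp; [exact: cx|exact: clamp_continuous].
rewrite /tcub /cub; apply: (@cntN _ _ t); apply: (@cntM _ _ _ t);
  first by apply: (@cntB _ _ _ t) => //; exact: cal.
by apply: (@cntB _ _ _ t); [exact: (@cntM _ _ _ t)|exact: cbe].
Qed.

Lemma tflow M T p1 p2 : 0 <= M -> exists x1 x2 : R -> R,
  [/\ x1 T = p1, x2 T = p2,
   forall t, is_derive t 1 x1 (tcub M t (x1 t) + (x2 t - x1 t)) &
   forall t, is_derive t 1 x2 (x1 t - x2 t)].
Proof.
move=> M0.
have [|||x [x0 dx]] := @picard R bool (tfield M) (lipc M)
    ((M + A) * (M ^+ 2 + A) + `|p1| + `|p2|) T (fun b => if b then p1 else p2) (lipc_gt0 M0).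
- by move=> t u v K i; exact: tfield_lip.
- move=> t i; have h1 := cub_bound (alA t) (beA t) (norm_clamp p1 M0).
  have h2 : `|p2 - p1| <= `|p1| + `|p2| by rewrite [leRHS]addrC; exact: ler_normB.
  have h3 : 0 <= (M + A) * (M ^+ 2 + A) by apply: le_trans h1.
  case: i; rewrite /tfield.
    by apply: (le_trans (ler_normD _ _)); rewrite -addrA lerD.
  by rewrite distrC; lra.
- move=> x cx [] t; rewrite /tfield.
    apply: (@cntD _ _ _ t); first exact: (tcub_continuous M0 (cx true)).
    by apply: (@cntB _ _ _ t); exact: cx.
  by apply: (@cntB _ _ _ t); exact: cx.
by exists (x true), (x false); split => [||t|t];
  [exact: x0 true|exact: x0 false|exact: dx true t|exact: dx false t].
Qed.

End Flow.
End Cubic.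

(** * Forward solutions, backward dependence and the pullback attractor *)

Section Existence.
Context {R : realType}.
Implicit Types (t s T e q d K h M A a B x y : R).

Section Flow.
Variables (al be : R -> R) (A : R).
Hypotheses (cal : continuous al) (cbe : continuous be).
Hypotheses (A0 : 0 <= A) (alA : forall t, `|al t| <= A) (beA : forall t, `|be t| <= A).

Lemma psol_all (g : R -> R -> R) T (x1 x2 : R -> R) :
  (forall t, is_derive t 1 x1 (g t (x1 t) + (x2 t - x1 t))) ->
  (forall t, is_derive t 1 x2 (x1 t - x2 t)) -> psol g T x1 x2.
Proof.
move=> d1 d2; split=> [||t _|t _].
- exact: (continuous_subspaceT (fun t => is_derive_cont (d1 t))).
- exact: (continuous_subspaceT (fun t => is_derive_cont (d2 t))).
- exact: d1.
- exact: d2.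
Qed.

(** The barrier pair is [(M - 1, M)]; its first entry is at least [A + 2], as [cub_far] asks, and
    lies where [clamp M] is the identity. The resulting bound shows that the truncation is never
    active along the solution. *)
Lemma tcub_bounded M T (x1 x2 : R -> R) : A + 3 <= M -> psol (tcub al be M) T x1 x2 ->
  `|x1 T| < M - 1 -> `|x2 T| < M ->
  forall t, T <= t -> `|x1 t| < M - 1 /\ `|x2 t| < M.
Proof.
move=> AM px; rewrite !ltr_norml => /andP[l1 u1] /andP[l2 u2] t Tt.
have M1 : `|M - 1| <= M by rewrite ger0_norm; have := A0; lra.
have M1' : `|- (M - 1)| <= M by rewrite normrN.
have AM' : A + 2 <= M - 1 by lra.
have [||a1 a2] := upper_barrier_cst (T' := t) px _ _ u1 u2 Tt (lexx t).
- by rewrite ltrBlDr ltrDl.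
- move=> s _ _; rewrite /tcub clamp_id//; have -> : M - (M - 1) = 1 by ring.
  exact: cub_far A0 (alA s) (beA s) AM'.
have [||||b1 b2] := upper_barrier_cst (T' := t) (u1 := M - 1) (u2 :=
  M) (psolN px) _ _ _ _ Tt (lexx t).
- by rewrite ltrBlDr ltrDl.
- move=> s _ _; rewrite /tcub clamp_id// cubN; have -> : M - (M - 1) = 1 by ring.
  by apply: cub_far A0 _ (beA s) AM'; rewrite normrN.
- by lra.
- by lra.
by rewrite !ltr_norml; split; apply/andP; split; lra.
Qed.

Lemma psol_untruncate M T (x1 x2 : R -> R) : psol (tcub al be M) T x1 x2 ->
  (forall t, T <= t -> `|x1 t| <= M) -> psol (fun t => cub (al t) (be t)) T x1 x2.
Proof.
move=> [c1 c2 d1 d2] h; split => // t Tt.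
by have := d1 t Tt; rewrite /tcub clamp_id// h// ltW.
Qed.

Lemma forward_exists T p1 p2 : exists x1 x2 : R -> R,
  [/\ x1 T = p1, x2 T = p2 & psol (fun t => cub (al t) (be t)) T x1 x2].
Proof.
pose M := A + 3 + `|p1| + `|p2|.
have M0 : 0 <= M by rewrite !addr_ge0.
have AM : A + 3 <= M by rewrite /M -addrA lerDl addr_ge0.
have [x1 [x2 [e1 e2 d1 d2]]] := tflow cal cbe A0 alA beA T p1 p2 M0.
have px := psol_all T d1 d2.
exists x1, x2; split => //; apply: (psol_untruncate px) => t Tt.
have A0' := A0; have p10 := normr_ge0 p1; have p20 := normr_ge0 p2.
have [||h _] := tcub_bounded AM px _ _ Tt; rewrite ?e1 ?e2 /M; [lra|lra|].
by move: h; rewrite /M; lra.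
Qed.

(** Gronwall's inequality run backwards: the squared distance satisfies [D' >= - 4 * L * D], so
    [D * E] is nondecreasing. The radius [d] does not depend on the solutions compared, as a passage
    to a cluster point requires. *)
Lemma backward_dependence M T t e : 0 <= M -> t <= T -> 0 < e ->
  exists2 d, 0 < d & forall x1 x2 y1 y2 : R -> R,
  (forall t, is_derive t 1 x1 (tcub al be M t (x1 t) + (x2 t - x1 t))) ->
  (forall t, is_derive t 1 x2 (x1 t - x2 t)) ->
  (forall t, is_derive t 1 y1 (tcub al be M t (y1 t) + (y2 t - y1 t))) ->
  (forall t, is_derive t 1 y2 (y1 t - y2 t)) ->
  `|x1 T - y1 T| < d -> `|x2 T - y2 T| < d -> `|x1 t - y1 t| < e /\ `|x2 t - y2 t| < e.
Proof.
move=> M0 tT e0.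
pose L := lipc A M; have L0 : 0 < L := lipc_gt0 A0 M0.
pose k := 4 * L.
pose d := e / 2 * expR (- (k / 2 * (T - t))).
have d0 : 0 < d by rewrite mulr_gt0 ?expR_gt0// divr_gt0.
exists d => // x1 x2 y1 y2 dx1 dx2 dy1 dy2 h1 h2.
pose E t := expR (k * t).
have dE s : is_derive s 1 E (E s * k).
  by apply: der_expR; apply: (der_eq (derZ k (der_id s))); rewrite mulr1.
have E0 s : 0 < E s by exact: expR_gt0.
pose u s := x1 s - y1 s; pose v s := x2 s - y2 s.
pose D s := u s * u s + v s * v s.
pose du s := (tcub al be M s (x1 s) + (x2 s - x1 s)) - (tcub al be M s (y1 s) + (y2 s - y1 s)).
pose dv s := (x1 s - x2 s) - (y1 s - y2 s).
have hu s : is_derive s 1 u (du s) := derB (dx1 s) (dy1 s).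
have hv s : is_derive s 1 v (dv s) := derB (dx2 s) (dy2 s).
have hD s : is_derive s 1 D (2 * (u s * du s) + 2 * (v s * dv s)).
  by apply: (der_eq (derD (derM (hu s) (hu s)) (derM (hv s) (hv s)))); ring.
have hDE s : is_derive s 1 (fun s => D s * E s) (E s * (2 * (u s * du s) + 2 * (v s * dv s)
  + k * D s)).
  by apply: (der_eq (derM (hD s) (dE s))); ring.
have sq (a b c : R) : `|c| <= L * Num.max `|a| `|b| -> - (L * (a * a + b * b)) <= a * c.
  move=> hc; have : `|a * c| <= L * (a * a + b * b).
    rewrite normrM; apply: (le_trans (ler_wpM2l (normr_ge0 a) hc)).
    rewrite mulrCA ler_pM2l//.
    have hmm m : `|a| <= m -> m * m <= a * a + b * b -> `|a| * m <= a * a + b * b.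
      by move=> am; apply: le_trans; rewrite ler_wpM2r// (le_trans _ am).
    have na : `|a| * `|a| = a * a by rewrite -normrM ger0_norm// -expr2 sqr_ge0.
    have nb : `|b| * `|b| = b * b by rewrite -normrM ger0_norm// -expr2 sqr_ge0.
    have a2 : 0 <= a * a by rewrite -expr2 sqr_ge0.
    have b2 : 0 <= b * b by rewrite -expr2 sqr_ge0.
    apply: hmm; first by rewrite le_max lexx.
    by have [h|h] := leP `|b| `|a|; rewrite ?na ?nb; lra.
  by rewrite ler_norml => /andP[].
have lipu s : `|du s| <= L * Num.max `|u s| `|v s| /\ `|dv s| <= L * Num.max `|v s| `|u s|.
  have hh (j : bool) : `|(if j then x1 s else x2 s) - (if j then y1 s else y2 s)| <=
    Num.max `|u s| `|v s|.
    by case: j; rewrite le_max lexx ?orbT.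
  split; first exact: (tfield_lip A0 alA beA s true M0 hh).
  by rewrite maxC; exact: (tfield_lip A0 alA beA s false M0 hh).
have hDT : D t * E t <= D T * E T.
  apply: (@nondecr_of_derive_all R (fun s => D s * E s) _ t T tT hDE) => s _.
  apply: mulr_ge0; first exact/ltW/E0.
  have := sq (u s) (v s) (du s) (lipu s).1; have := sq (v s) (u s) (dv s) (lipu s).2.
  have -> : k * D s = 4 * (L * (u s * u s + v s * v s)) by rewrite /k /D; ring.
  by rewrite [v s * v s + _]addrC; lra.
have dd : d * d * E T = e * e / 4 * E t.
  rewrite /d /E.
  have -> : k * T = (k / 2 * (T - t) + k / 2 * (T - t)) + k * t by field.
  rewrite !expRD expRN; have := expR_gt0 (k / 2 * (T - t)).
  set z := expR (k / 2 * (T - t)) => z0; field.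
  exact: lt0r_neq0.
have sqlt (a b : R) : `|a| < b -> a * a < b * b.
  move=> ab; have -> : a * a = `|a| * `|a| by rewrite -normrM ger0_norm// -expr2 sqr_ge0.
  by rewrite ltr_pM.
have DT : D T * E T < e * e * E t.
  apply: (@lt_le_trans _ _ (2 * (d * d * E T))).
    rewrite [2 * _]mulrA ltr_pM2r// /D.
    by have := sqlt _ _ h1; have := sqlt _ _ h2; rewrite -/(u T) -/(v T); lra.
  rewrite dd; have : 0 < e * e * E t by rewrite !mulr_gt0.
  lra.
have Dt : D t < e * e by rewrite -(ltr_pM2r (E0 t)); exact: le_lt_trans DT.
have ltsq (a : R) : a * a < e * e -> `|a| < e.
  move=> ae; rewrite ltNge; apply/negP => ea; move: (ler_pM (ltW e0) (ltW e0) ea ea).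
  have a2 : 0 <= a * a by rewrite -expr2 sqr_ge0.
  by rewrite -normrM ger0_norm// leNgt ae.
have u2 : 0 <= u t * u t by rewrite -expr2 sqr_ge0.
have v2 : 0 <= v t * v t by rewrite -expr2 sqr_ge0.
by split; [apply: (ltsq (u t))|apply: (ltsq (v t))]; apply: le_lt_trans Dt; rewrite /D; lra.
Qed.

Lemma plane_cluster (u v : nat -> R) (c r : R) N :
  (forall n, (N <= n)%N -> `|u n - c| <= r /\ `|v n - c| <= r) ->
  exists p1 p2, `|p1 - c| <= r /\ `|p2 - c| <= r /\
   forall d m, 0 < d -> exists n, [/\ (m <= n)%N, `|u n - p1| < d & `|v n - p2| < d].
Proof.
move=> h.
have cK := compact_setX (@segment_compact R (c - r) (c + r)) (@segment_compact R (c - r) (c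
  + r)).
have inI (x : R) : `[c - r, c + r]%classic x <-> `|x - c| <= r.
  by rewrite /= in_itv/= ler_distl.
have FK : ((fun n => (u n, v n)) @ \oo) (`[c - r, c + r] `*` `[c - r, c + r])%classic.
  by exists N => // n /= Nn; have [h1 h2] := h n Nn; split; apply/inI.
have [[p1 p2] [[/inI K1 /inI K2] cl]] := cK _ _ FK.
exists p1, p2; split => //; split => // d m d0.
have [|_ [[n /= mn <-] [/= b1 b2]]] := cl [set (u n,
  v n) | n in [set n | (m <= n)%N]] (ball (p1, p2) d) _ (nbhsx_ballx _ _ d0).
  by exists m => // n /= mn; exists n.
by exists n; split => //; rewrite distrC; [exact: b1|exact: b2].
Qed.

(* The solution is a cluster point of the solutions started at (q, q) at time -n. *)
Lemma pullback_exists q K h0 : 0 < K -> K <= 1 -> 0 < h0 ->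
  (forall h, 0 < h -> h <= h0 -> exists Th, forall t, t <= Th ->
     cub (al t) (be t) (q + h) <= - (K * h) /\ K * h <= cub (al t) (be t) (q - h)) ->
  exists x1 x2 : R -> R,
  [/\ forall t, is_derive t 1 x1 (cub (al t) (be t) (x1 t) + (x2 t - x1 t)),
      forall t, is_derive t 1 x2 (x1 t - x2 t) &
      forall e, 0 < e -> exists T, forall t, t <= T -> `|x1 t - q| <= e /\ `|x2 t - q| <= e].
Proof.
move=> K0 K1 h00 hh.
pose M := A + 3 + `|q| + 4 * h0.
have q0 := normr_ge0 q; have A0' := A0.
have M0 : 0 <= M by rewrite /M; lra.
have AM : A + 3 <= M by rewrite /M; lra.
have qM (h : R) : `|h| <= 3 * h0 -> `|q + h| < M - 1.
  by move=> hh0; apply: (le_lt_trans (ler_normD _ _)); rewrite /M; lra.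
(* The barrier [(q + h, q + h + K * h / 2)] spends half of the pull [K * h] on the coupling, and
   [K <= 1] keeps both entries within [2 * h] of [q]. The bound is independent of the starting
   time. *)
have box h Th T (x1 x2 : R -> R) : 0 < h -> h <= h0 -> (forall t, t <= Th ->
     cub (al t) (be t) (q + h) <= - (K * h) /\ K * h <= cub (al t) (be t) (q - h)) ->
   psol (tcub al be M) T x1 x2 -> x1 T = q -> x2 T = q ->
   forall t, T <= t -> t <= Th -> `|x1 t - q| <= 2 * h /\ `|x2 t - q| <= 2 * h.
  move=> hp hle hTh px e1 e2 t Tt tTh.
  have nh : `|h| <= 3 * h0 by rewrite gtr0_norm//; lra.
  have Kh : 0 < K * h by rewrite mulr_gt0.
  have Kh1 : K * h <= h by rewrite ger_pMl.
  have [||||a1 a2] := upper_barrier_cst (u1 := q + h) (u2 :=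
    q + h + K * h / 2) px _ _ _ _ Tt tTh.
  - by lra.
  - move=> s _ sTh; rewrite /tcub clamp_id; last by rewrite (le_trans (ltW (qM _ nh)))//; lra.
    by have [? _] := hTh s sTh; lra.
  - by lra.
  - by lra.
  have [||||b1 b2] := upper_barrier_cst (u1 := - q + h) (u2 :=
    - q + h + K * h / 2) (psolN px) _ _ _ _ Tt tTh.
  - by lra.
  - move=> s _ sTh; have -> : - (- q + h) = q + - h by ring.
    rewrite /tcub clamp_id; last by rewrite (le_trans (ltW (qM _ _)))// ?normrN//; lra.
    by have [_ ?] := hTh s sTh; lra.
  - by lra.
  - by lra.
  by rewrite !ler_norml; split; apply/andP; split; lra.
have HX (n : nat) : exists x : (R -> R) * (R -> R), [/\ x.1 (- n%:R) = q, x.2 (- n%:R) = q,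
   forall t, is_derive t 1 x.1 (tcub al be M t (x.1 t) + (x.2 t - x.1 t)) &
   forall t, is_derive t 1 x.2 (x.1 t - x.2 t)].
  by have [x1 [x2 ?]] := tflow cal cbe A0 alA beA (- n%:R) q q M0; exists (x1, x2).
have [X hX] := choice HX.
have [T0 hT0] := hh h0 h00 (lexx _).
have XT0 (n : nat) t : - n%:R <= t -> t <= T0 ->
  `|(X n).1 t - q| <= 2 * h0 /\ `|(X n).2 t - q| <= 2 * h0.
  have [e1 e2 d1 d2] := hX n.
  exact: (box h0 T0 (- n%:R) _ _ h00 (lexx _) hT0 (psol_all _ d1 d2) e1 e2).
have large t : exists N : nat, forall n, (N <= n)%N -> - n%:R <= t.
  exists (Num.bound `|t|) => n Nn; have := archi_boundP (normr_ge0 t).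
  have : (Num.bound `|t|)%:R <= n%:R :> R by rewrite ler_nat.
  by have := ler_norm (- t); rewrite normrN; lra.
have [N0 hN0] := large T0.
have [p1 [p2 [pq1 [pq2 cl]]]] := plane_cluster (fun n Nn => XT0 n T0 (hN0 n Nn) (lexx _)).
have [Y1 [Y2 [eY1 eY2 dY1 dY2]]] := tflow cal cbe A0 alA beA T0 p1 p2 M0.
(* [2 * h] from [box] for a solution passing close to [(p1, p2)] at time [T0], plus [h] for its
   distance to [(Y1, Y2)] at time [t]. As [h] is arbitrarily small, this also yields the limit at
   minus infinity. *)
have near_q h Th : 0 < h -> h <= h0 -> (forall t, t <= Th ->
     cub (al t) (be t) (q + h) <= - (K * h) /\ K * h <= cub (al t) (be t) (q - h)) ->
   forall t, t <= Th -> t <= T0 -> `|Y1 t - q| <= 3 * h /\ `|Y2 t - q| <= 3 * h.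
  move=> hp hle hTh t tTh tT0.
  have [d d0 hd] := backward_dependence M0 tT0 hp.
  have [m hm] := large t; have [n [mn b1 b2]] := cl d m d0.
  have [e1 e2 d1 d2] := hX n.
  have [||a1 a2] := hd _ _ _ _ d1 d2 dY1 dY2; rewrite ?eY1 ?eY2//.
  have [c1 c2] := box h Th _ _ _ hp hle hTh (psol_all (- n%:R) d1 d2) e1 e2 t (hm n mn) tTh.
  have comb (a b : R) : `|b - a| < h -> `|b - q| <= 2 * h -> `|a - q| <= 3 * h.
    rewrite ltr_norml !ler_norml => /andP[? ?] /andP[? ?]; apply/andP; split; lra.
  by split; [exact: comb a1 c1|exact: comb a2 c2].
have YM t : `|Y1 t| <= M.
  have start s : s <= T0 -> `|Y1 s| < M - 1 /\ `|Y2 s| < M.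
    move=> sT0; have [h1 h2] := near_q h0 T0 h00 (lexx _) hT0 s sT0 sT0.
    have := qM _ h1; have := qM _ h2.
    have -> : q + (Y1 s - q) = Y1 s by ring.
    have -> : q + (Y2 s - q) = Y2 s by ring.
    by move=> ? ?; split; lra.
  have [/start[h1 _]|/ltW T0t] := leP t T0; first lra.
  have [s1 s2] := start T0 (lexx _).
  have [h1 _] := tcub_bounded AM (psol_all T0 dY1 dY2) s1 s2 T0t; lra.
exists Y1, Y2; split => // [t|e e0].
  by have := dY1 t; rewrite /tcub clamp_id.
pose h := Num.min h0 (e / 3).
have hp : 0 < h by rewrite lt_min h00 divr_gt0.
have hle : h <= h0 by rewrite ge_min lexx.
have he : 3 * h <= e.
  have : h <= e / 3 by rewrite ge_min lexx orbT.
  lra.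
have [Th hTh] := hh h hp hle.
exists (Num.min Th T0) => t; rewrite le_min => /andP[tTh tT0].
by have [? ?] := near_q h Th hp hle hTh t tTh tT0; split; lra.
Qed.

End Flow.
End Existence.

(** * Derivatives of plane curves by components *)

Section Pairs.
Context {R : realType}.
Implicit Types (t s T : R).

Lemma is_deriveE (W : normedModType R) (f : R -> W) t (l : W) :
  is_derive t 1 f l <-> h^-1 *: (f (h + t) - f t) @[h --> (0 : R)^'] --> l.
Proof.
have E : (fun h : R => h^-1 *: (f (h + t) - f t)) =
    (fun h : R => h^-1 *: ((f \o shift t) (h *: 1) - f t)).
  by apply/funext => h; rewrite /= /GRing.scale/= mulr1.
rewrite E; split=> [[df <-]|h]; first by move: df; rewrite /derivable /derive.
apply: DeriveDef; first by apply/cvg_ex; exists l.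
exact: cvg_lim.
Qed.

Lemma is_derive_pair (x1 x2 : R -> R) t (l1 l2 : R) :
  is_derive t 1 x1 l1 -> is_derive t 1 x2 l2 ->
  is_derive t 1 (fun s => (x1 s, x2 s)) (l1, l2).
Proof.
move=> /is_deriveE h1 /is_deriveE h2; apply/is_deriveE.
exact: (cvg_pair h1 h2).
Qed.

Lemma fst_continuous : continuous (fst : R * R -> R).
Proof. by move=> [x y]; exact: cvg_fst. Qed.

Lemma snd_continuous : continuous (snd : R * R -> R).
Proof. by move=> [x y]; exact: cvg_snd. Qed.

Lemma is_derive_fst (x : R -> R * R) t (l : R * R) :
  is_derive t 1 x l -> is_derive t 1 (fun s => (x s).1) l.1.
Proof.
move=> /is_deriveE h; apply/is_deriveE.
exact: continuous_cvg (@fst_continuous l) h.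
Qed.

Lemma is_derive_snd (x : R -> R * R) t (l : R * R) :
  is_derive t 1 x l -> is_derive t 1 (fun s => (x s).2) l.2.
Proof.
move=> /is_deriveE h; apply/is_deriveE.
exact: continuous_cvg (@snd_continuous l) h.
Qed.

End Pairs.

(** * Convergence to attracting equilibria *)

Section Wells.
Context {R : realType}.
Implicit Types (t s T e q d c K h M A a B x y : R).

Lemma cubB a B a' B' x : cub a' B' x - cub a B x =
  (a' - a) * x ^+ 2 + (B' - B) * x - (a' * (B' - B) + (a' - a) * B).
Proof. by rewrite /cub; ring. Qed.

Lemma cub_unif a B M e : 0 <= M -> 0 < e -> exists2 d, 0 < d &
  forall a' B' x, `|a' - a| <= d -> `|B' - B| <= d -> `|x| <= M ->
    `|cub a' B' x - cub a B x| <= e.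
Proof.
move=> M0 e0.
pose C := M ^+ 2 + M + (`|a| + 1) + `|B| + 1.
have M2 : 0 <= M ^+ 2 by rewrite exprn_ge0.
have C0 : 0 < C by rewrite /C; have := normr_ge0 a; have := normr_ge0 B; lra.
exists (Num.min 1 (e / C)); first by rewrite lt_min ltr01 divr_gt0.
move=> a' B' x; rewrite !le_min => /andP[a1 ae] /andP[B1 Be] xM.
have d0 : 0 <= e / C by rewrite divr_ge0 ?ltW.
have -> : e = e / C * C by field; exact: lt0r_neq0.
move: ae Be d0; set d := e / C => ae Be d0.
rewrite cubB.
have h1 : `|(a' - a) * x ^+ 2| <= d * M ^+ 2.
  by rewrite normrM ler_pM// normrX lerXn2r// nnegrE.
have h2 : `|(B' - B) * x| <= d * M by rewrite normrM ler_pM.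
have h3 : `|a' * (B' - B)| <= d * (`|a| + 1).
  rewrite normrM mulrC ler_pM//; have := ler_normD (a' - a) a; rewrite subrK; lra.
have h4 : `|(a' - a) * B| <= d * `|B| by rewrite normrM ler_pM.
apply: (le_trans (ler_normB _ _)).
apply: (le_trans (lerD (ler_normD _ _) (ler_normD _ _))).
by rewrite /C !mulrDr !mulr1 in h3 *; lra.
Qed.

(** A certificate of attraction at linear rate [K] on [[c, d]], for the reaction term without the
    coupling. The normalization [K <= 1] is the one that [conv_upper] asks for. *)
Definition well a B c q d K := [/\ c < q < d, 0 < K <= 1,
  forall x, q <= x -> x <= d -> cub a B x <= - K * (x - q) &
  forall x, c <= x -> x <= q -> K * (q - x) <= cub a B x].

Lemma well_root a B c q d K : well a B c q d K -> cub a B q = 0.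
Proof.
move=> [/andP[/ltW cq /ltW qd] _ h1 h2].
have := h1 q (lexx _) qd; have := h2 q cq (lexx _); rewrite !subrr !mulr0 => ? ?.
by apply/eqP; rewrite eq_le; apply/andP.
Qed.

Lemma well_sub a B c q d c' d' K : well a B c q d K -> c <= c' -> c' < q -> q < d' ->
  d' <= d -> well a B c' q d' K.
Proof.
move=> [_ hK h1 h2] cc cq qd dd; split => //; first by rewrite cq.
- by move=> x qx xd; apply: h1 => //; exact: le_trans dd.
- by move=> x cx xq; apply: h2 => //; exact: le_trans cx.
Qed.

Lemma wellN a B c q d K : well a B c q d K -> well (- a) B (- d) (- q) (- c) K.
Proof.
move=> [/andP[cq qd] hK h1 h2]; split => //; first by rewrite !ltrN2 qd.
- move=> x qx xc; rewrite -cubN.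
  have := h2 (- x); rewrite lerNr lerNl => /(_ xc qx).
  have -> : - K * (x - - q) = - (K * (q - - x)) by ring.
  by rewrite lerN2.
- move=> x dx xq; rewrite -cubN.
  have := h1 (- x); rewrite lerNr lerNl => /(_ xq dx).
  have -> : K * (- q - x) = - (- K * (- x - q)) by ring.
  by rewrite lerN2.
Qed.

Lemma psol_cubN (al be : R -> R) T (x1 x2 : R -> R) :
  psol (fun t => cub (al t) (be t)) T x1 x2 ->
  psol (fun t => cub (- al t) (be t)) T (fun t => - x1 t) (fun t => - x2 t).
Proof.
move=> /psolN [c1 c2 d1 d2]; split => // t Tt.
by have := d1 t Tt; rewrite cubN.
Qed.

(** The barrier starts halfway between the data and [d]. Its second entry [w] exceeds the first by
    at most half of the pull [K * (u - q)] and does not pass [d]. *)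
Lemma well_stay_upper a B c q d K T (x1 x2 : R -> R) : well a B c q d K ->
  psol (fun=> cub a B) T x1 x2 -> x1 T < d -> x2 T < d ->
  forall t, T <= t -> x1 t < d /\ x2 t < d.
Proof.
move=> [/andP[_ qd] /andP[K0 K1] h _] px x1d x2d t Tt.
pose m := Num.max q (Num.max (x1 T) (x2 T)).
have md : m < d by rewrite !gt_max qd x1d.
have qm : q <= m by rewrite le_max lexx.
have x1m : x1 T <= m by rewrite !le_max lexx orbT.
have x2m : x2 T <= m by rewrite !le_max lexx !orbT.
clearbody m.
pose u := (m + d) / 2.
have mu : m < u by rewrite /u; lra.
have ud : u < d by rewrite /u; lra.
clearbody u.
pose w := Num.min d (u + K * (u - q) / 2).
have Ku : 0 < K * (u - q) by rewrite mulr_gt0//; lra.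
have uw : u < w by rewrite lt_min ud/=; lra.
have wd : w <= d by rewrite ge_min lexx.
have wu : w <= u + K * (u - q) / 2 by rewrite ge_min lexx orbT.
have [||| ? ?] := upper_barrier_cst (T' := t) px uw _ _ _ Tt (lexx t).
- move=> s _ _; have := h u; rewrite mulNr => hu.
  by have := hu _ _; lra.
- by lra.
- by lra.
by split; lra.
Qed.

Lemma well_stay a B c q d K T (x1 x2 : R -> R) : well a B c q d K ->
  psol (fun=> cub a B) T x1 x2 -> c < x1 T < d -> c < x2 T < d ->
  forall t, T <= t -> c < x1 t < d /\ c < x2 t < d.
Proof.
move=> hw px /andP[c1 d1] /andP[c2 d2] t Tt.
have [e1 e2] := well_stay_upper hw px d1 d2 Tt.
have [||f1 f2] := well_stay_upper (wellN hw) (psol_cubN px) _ _ Tt; rewrite ?ltrN2//.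
by split; apply/andP; split => //; rewrite -ltrN2.
Qed.

(** The system is only asymptotically autonomous. On the bounded range between [q] and [d] the cubic
    depends uniformly on its coefficients, so the time dependence becomes the vanishing error [e]
    that [conv_upper] tolerates. *)
Lemma well_conv_upper a B c q d K T (al be x1 x2 : R -> R) : well a B c q d K ->
  psol (fun t => cub (al t) (be t)) T x1 x2 ->
  (forall e, 0 < e -> exists T1, forall t, T1 <= t -> `|al t - a| <= e /\ `|be t - B| <= e) ->
  (forall t, T <= t -> x1 t < d /\ x2 t < d) ->
  forall h, 0 < h -> exists T1, forall t, T1 <= t -> x1 t < q + h /\ x2 t < q + h.
Proof.
move=> [/andP[_ qd] /andP[K0 K1] hu _] px hab xd.
apply: (conv_upper px qd K0 K1 xd) => e e0.
have [del del0 hdel] := cub_unif a B (M := `|q| + `|d|) (addr_ge0 (normr_ge0 _) (normr_ge0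
  _)) e0.
have [T1 hT1] := hab del del0.
exists T1 => t T1t qx xd'; have [h1 h2] := hT1 t T1t.
have xM : `|x1 t| <= `|q| + `|d|.
  have := ler_norm d; have := ler_norm (- q); rewrite normrN => ? ?.
  have := normr_ge0 d; have := normr_ge0 q => ? ?.
  by rewrite ler_norml; apply/andP; split; lra.
have := hdel _ _ _ h1 h2 xM; rewrite ler_norml => /andP[_].
have := hu _ qx xd'; lra.
Qed.

Lemma well_conv a B c q d K T (al be x1 x2 : R -> R) : well a B c q d K ->
  psol (fun t => cub (al t) (be t)) T x1 x2 ->
  (forall e, 0 < e -> exists T1, forall t, T1 <= t -> `|al t - a| <= e /\ `|be t - B| <= e) ->
  (forall t, T <= t -> c < x1 t < d /\ c < x2 t < d) ->
  forall h, 0 < h -> exists T1, forall t, T1 <= t -> `|x1 t - q| < h /\ `|x2 t - q| < h.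
Proof.
move=> hw px hab xd h h0.
have xu t : T <= t -> x1 t < d /\ x2 t < d by move=> /xd[/andP[_ ?] /andP[_ ?]].
have xl t : T <= t -> - x1 t < - c /\ - x2 t < - c.
  by move=> /xd[/andP[? _] /andP[? _]]; rewrite !ltrN2.
have [|T2 hT2] := well_conv_upper (wellN hw) (psol_cubN px) _ xl h0.
  move=> e /hab[T1 hT1]; exists T1 => t /hT1[h1 h2]; split => //.
  by rewrite -opprD normrN.
have [T1 hT1] := well_conv_upper hw px hab xu h0.
exists (Num.max T1 T2) => t; rewrite ge_max => /andP[/hT1[a1 a2] /hT2[b1 b2]].
by rewrite !ltr_norml; split; apply/andP; split; lra.
Qed.

End Wells.

(** * From scalar components to the plane *)

Section PlaneTopology.
Context {R : realType}.
Implicit Types (r h e T t : R) (p x : R * R).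

Lemma nbhs_squareP p (U : set (R * R)) : nbhs p U <->
  exists2 r, 0 < r & forall x, `|x.1 - p.1| < r -> `|x.2 - p.2| < r -> U x.
Proof.
split=> [/nbhs_ballP[r /= r0 hr]|[r r0 hr]].
  exists r => // x h1 h2; apply: hr; split; rewrite /ball/= distrC; [exact: h1|exact: h2].
apply/nbhs_ballP; exists r => //= x [h1 h2]; apply: hr; rewrite distrC; [exact: h1|exact: h2].
Qed.

Lemma cvg_plane_pinftyP (x : R -> R * R) p : x t @[t --> +oo] --> p <->
  forall h, 0 < h -> exists T, forall t, T <= t ->
    `|(x t).1 - p.1| < h /\ `|(x t).2 - p.2| < h.
Proof.
split=> [hx h h0|hx U /nbhs_squareP[r r0 hr]].
  have [|M [_ hM]] := hx [set y | `|y.1 - p.1| < h /\ `|y.2 - p.2| < h].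
    by apply/nbhs_squareP; exists h.
  by exists (M + 1) => t Mt; apply: hM; rewrite (lt_le_trans _ Mt)// ltrDl.
have [T hT] := hx r r0; exists T; split; first exact: num_real.
by move=> t /ltW /hT[? ?]; exact: hr.
Qed.

Lemma cvg_plane_ninftyP (x : R -> R * R) p : x t @[t --> -oo] --> p <->
  forall h, 0 < h -> exists T, forall t, t <= T ->
    `|(x t).1 - p.1| < h /\ `|(x t).2 - p.2| < h.
Proof.
split=> [hx h h0|hx U /nbhs_squareP[r r0 hr]].
  have [|M [_ hM]] := hx [set y | `|y.1 - p.1| < h /\ `|y.2 - p.2| < h].
    by apply/nbhs_squareP; exists h.
  by exists (M - 1) => t Mt; apply: hM; rewrite (le_lt_trans Mt)// ltrBlDr ltrDl.
have [T hT] := hx r r0; exists T; split; first exact: num_real.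
by move=> t /ltW /hT[? ?]; exact: hr.
Qed.

Lemma cvg_real_pinftyP (f : R -> R) l : f t @[t --> +oo] --> l <->
  forall h, 0 < h -> exists T, forall t, T <= t -> `|f t - l| < h.
Proof.
split=> [/cvgrPdist_lt hf h h0|hf].
  have [M [_ hM]] := hf h h0.
  by exists (M + 1) => t Mt; rewrite distrC; apply: hM; rewrite (lt_le_trans _ Mt)// ltrDl.
apply/cvgrPdist_lt => e e0; have [T hT] := hf e e0; exists T; split; first exact: num_real.
by move=> t /ltW /hT; rewrite distrC.
Qed.

Lemma cvg_real_ninftyP (f : R -> R) l : f t @[t --> -oo] --> l <->
  forall h, 0 < h -> exists T, forall t, t <= T -> `|f t - l| < h.
Proof.
split=> [/cvgrPdist_lt hf h h0|hf].
  have [M [_ hM]] := hf h h0.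
  by exists (M - 1) => t Mt; rewrite distrC; apply: hM;
    rewrite (le_lt_trans Mt)// ltrBlDr ltrDl.
apply/cvgrPdist_lt => e e0; have [T hT] := hf e e0; exists T; split; first exact: num_real.
by move=> t /ltW /hT; rewrite distrC.
Qed.

End PlaneTopology.

(** * Basins, attraction and inward-pointing fields on squares *)

Section Planar.
Context {R : realType}.
Variables (a b : R -> R).
Implicit Types (lam t T q c d K h r : R) (p : R * R) (x : R -> R * R).

Lemma fieldE p lam : field_ab a b p lam =
  (cub (a lam) (b lam + 1) p.1 + (p.2 - p.1), p.1 - p.2).
Proof. by rewrite /field_ab /cub; congr (_, _); ring. Qed.

Lemma psol_of_trajectory (lam : R -> R) T x : {within `[T, +oo[, continuous x} ->
  (forall t, T < t -> is_derive t 1 x (field_ab a b (x t) (lam t))) ->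
  psol (fun t => cub (a (lam t)) (b (lam t) + 1)) T (fun t => (x t).1) (fun t => (x t).2).
Proof.
move=> cx dx; split => [t|t|t Tt|t Tt].
- exact: continuous_cvg (@fst_continuous R (x t)) (cx t).
- exact: continuous_cvg (@snd_continuous R (x t)) (cx t).
- by have := is_derive_fst (dx t Tt); rewrite fieldE.
- by have := is_derive_snd (dx t Tt); rewrite fieldE.
Qed.

Lemma trajectory_of_psol (lam : R -> R) T (x1 x2 : R -> R) :
  psol (fun t => cub (a (lam t)) (b (lam t) + 1)) T x1 x2 ->
  {within `[T, +oo[, continuous (fun t => (x1 t, x2 t))} /\
  forall t, T < t -> is_derive t 1 (fun t => (x1 t, x2 t)) (field_ab a b (x1 t, x2 t) (lam t)).
Proof.
move=> [c1 c2 d1 d2]; split=> [t|t Tt]; first exact: cvg_pair (c1 t) (c2 t).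
by rewrite fieldE; exact: is_derive_pair (d1 t Tt) (d2 t Tt).
Qed.

Lemma well_basin lam c q d K p : well (a lam) (b lam + 1) c q d K ->
  c < p.1 < d -> c < p.2 < d -> basin (field_ab a b) (q, q) lam p.
Proof.
move=> hw p1cd p2cd.
pose A := `|a lam| + `|b lam + 1|.
have A0 : 0 <= A by rewrite addr_ge0.
have aA (t : R) : `|a lam| <= A by rewrite lerDl.
have bA (t : R) : `|b lam + 1| <= A by rewrite lerDr.
have [x1 [x2 [e1 e2 px]]] := forward_exists (fun=> cvg_cst _) (fun=> cvg_cst _) A0 aA bA 0
  p.1 p.2.
have [cx dx] := @trajectory_of_psol (fun=> lam) 0 x1 x2 px.
exists (fun t => (x1 t, x2 t)); first by split => //; rewrite e1 e2 -surjective_pairing.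
apply/cvg_plane_pinftyP => h h0.
apply: (well_conv hw px _ _ h0) => [e e0|].
  by exists 0 => t _; rewrite !subrr normr0 ltW.
by apply: well_stay hw px _ _; rewrite ?e1 ?e2.
Qed.

(** Smaller squares around [q] are wells again by [well_sub], and solutions do not leave a well:
    this is Lyapunov stability. *)
Lemma well_attracting lam c q d K : well (a lam) (b lam + 1) c q d K ->
  attracting_equilibrium (field_ab a b) lam (q, q).
Proof.
move=> hw; have [/andP[cq qd] hK _ _] := hw.
have inside r y : `|y - q| < r -> q - r < y < q + r.
  by rewrite ltr_norml => /andP[? ?]; apply/andP; split; lra.
split.
- by rewrite fieldE/= !subrr addr0 (well_root hw).
- move=> U /nbhs_squareP[r r0 hr].
  pose c' := Num.max c (q - r); pose d' := Num.min d (q + r).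
  have c'q : c' < q by rewrite gt_max cq/=; lra.
  have qd' : q < d' by rewrite lt_min qd/=; lra.
  have cc : c <= c' by rewrite le_max lexx.
  have dd : d' <= d by rewrite ge_min lexx.
  have hw' := well_sub hw cc c'q qd' dd.
  apply/nbhs_squareP; exists (Num.min (q - c') (d' - q)); first by rewrite lt_min !subr_gt0 c'q.
  move=> p /=; rewrite !lt_min => /andP[u1 u2] /andP[v1 v2] x [x0 cx dx] t t0.
  have px := psol_of_trajectory (lam := fun=> lam) cx dx.
  have [||h1 h2] := well_stay hw' px _ _ t0.
  + by rewrite x0; move: u1 u2; rewrite !ltr_norml => /andP[? ?] /andP[? ?]; apply/andP;
    split; lra.
  + by rewrite x0; move: v1 v2; rewrite !ltr_norml => /andP[? ?] /andP[? ?]; apply/andP;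
    split; lra.
  have qrc : q - r <= c' by rewrite le_max lexx orbT.
  have qrd : d' <= q + r by rewrite ge_min lexx orbT.
  apply: hr => /=; rewrite ltr_norml.
  + by case/andP: h1 => ? ?; apply/andP; split; lra.
  + by case/andP: h2 => ? ?; apply/andP; split; lra.
- apply/nbhs_squareP; exists (Num.min (q - c) (d - q)); first by rewrite lt_min !subr_gt0 cq.
  move=> p /=; rewrite !lt_min => /andP[u1 u2] /andP[v1 v2].
  apply: (well_basin hw).
  + by move: u1 u2; rewrite !ltr_norml => /andP[? ?] /andP[? ?]; apply/andP; split; lra.
  + by move: v1 v2; rewrite !ltr_norml => /andP[? ?] /andP[? ?]; apply/andP; split; lra.
Qed.

(** On the side itself the sign of [v] decides; off it, the distance [d - y] cannot be covered in a
    short time at a speed of at most [|v| + 1]. *)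
Lemma points_into_side (y v d : R) : y <= d -> (y = d -> v < 0) ->
  exists2 e, 0 < e & forall h w, 0 < h -> h < e -> `|w - v| < e -> y + h * w <= d.
Proof.
rewrite le_eqVlt => /predU1P[->|yd] hv.
  have v0 := hv erefl; exists (- v); first by rewrite oppr_gt0.
  move=> h w h0 _; rewrite ltr_norml => /andP[_ wv].
  by rewrite gerDl pmulr_rle0//; lra.
pose e := Num.min 1 ((d - y) / (`|v| + 1)).
have v1 : 0 < `|v| + 1 by rewrite ltr_wpDl.
have e0 : 0 < e by rewrite lt_min ltr01 divr_gt0// subr_gt0.
have e1 : e <= 1 by rewrite ge_min lexx.
have ed : e <= (d - y) / (`|v| + 1) by rewrite ge_min lexx orbT.
exists e => // h w h0 he wv.
have hd : h * (`|v| + 1) <= d - y by rewrite -ler_pdivlMr//; exact: le_trans (ltW he) ed.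
have wle : w <= `|v| + 1.
  move: wv; rewrite ltr_norml => /andP[_ ?]; have := ler_norm v; lra.
have : h * w <= h * (`|v| + 1) by rewrite ler_pM2l.
lra.
Qed.

Lemma square_points_into (c d g : R) p v : 0 < g ->
  c <= p.1 <= d -> c - g <= p.2 <= d + g ->
  (p.1 = c -> 0 < v.1) -> (p.1 = d -> v.1 < 0) ->
  (p.2 = c - g -> 0 < v.2) -> (p.2 = d + g -> v.2 < 0) ->
  points_strictly_into (`[c, d]%classic `*` `[c - g, d + g]%classic) p v.
Proof.
move=> g0 /andP[c1 d1] /andP[c2 d2] hc1 hd1 hc2 hd2.
have [e1 e10 h1] := points_into_side d1 hd1.
have [e2 e20 h2] := points_into_side d2 hd2.
have [||e3 e30 h3] := @points_into_side (- p.1) (- v.1) (- c).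
- by rewrite lerN2.
- by move=> /oppr_inj /hc1; rewrite oppr_lt0.
have [||e4 e40 h4] := @points_into_side (- p.2) (- v.2) (- (c - g)).
- by rewrite lerN2.
- by move=> /oppr_inj /hc2; rewrite oppr_lt0.
have [e e0 he] : exists2 e, 0 < e & [/\ e <= e1, e <= e2, e <= e3 & e <= e4].
  exists (Num.min (Num.min e1 e2) (Num.min e3 e4)); first by rewrite !lt_min e10 e20 e30.
  by split; rewrite !ge_min lexx ?orbT.
have [k1 k2 k3 k4] := he; exists e => // h w /andP[h0 hlt].
rewrite prod_normE/= gt_max => /andP[w1 w2].
have {}h1 := h1 h w.1 h0 (lt_le_trans hlt k1) (lt_le_trans w1 k1).
have {}h2 := h2 h w.2 h0 (lt_le_trans hlt k2) (lt_le_trans w2 k2).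
have m3 : `|- w.1 - - v.1| < e3 by rewrite -opprD normrN; exact: lt_le_trans k3.
have m4 : `|- w.2 - - v.2| < e4 by rewrite -opprD normrN; exact: lt_le_trans k4.
have := h3 h _ h0 (lt_le_trans hlt k3) m3; have := h4 h _ h0 (lt_le_trans hlt k4) m4.
rewrite !mulrN -!opprD !lerN2 => ? ?.
by split => /=; rewrite in_itv/=; apply/andP.
Qed.

End Planar.

(** * Growing rectangles: inflowing stability and absence of tipping *)

Section Diag.
Context {R : realType}.

Lemma diag_continuous (f : R -> R) : continuous f -> continuous (fun s => (f s, f s)).
Proof.
move=> cf s U /nbhs_squareP[r r0 hr].
have /cvgrPdist_lt/(_ r r0) := cf s.
by apply: filterS => t ft; apply: hr => /=; rewrite distrC.
Qed.

(** [d] enters as the monotone part [m] of [upper_barrier], and [t |-> d (r * t)] is monotone for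
    every rate. Of the pull [2 * g], one [g] pays for the coupling and the other keeps the contact
    strict. *)
Lemma inflowing_upper (al be d : R -> R) (g D T r : R) (x1 x2 : R -> R) : 0 < g ->
  (forall s t, s <= t -> d s <= d t) ->
  (forall s, cub (al s) (be s) (d s) <= - (2 * g)) ->
  (forall s, d s + g <= D - g) -> 0 <= r ->
  psol (fun t => cub (al (r * t)) (be (r * t))) T x1 x2 ->
  x1 T < d (r * T) -> x2 T < d (r * T) ->
  forall t, T <= t -> x1 t < D /\ x2 t < D.
Proof.
move=> g0 dmon cubd dD r0 px h1 h2 t Tt.
have cc (u : R) : {within `[T, +oo[, continuous (fun=> u : R)}.
  by move=> ?; exact: cst_continuous.
suff : x1 t < d (r * t) + 0 /\ x2 t < d (r * t) + g.
  by have := dD (r * t); rewrite addr0; lra.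
apply: (@upper_barrier R _ T t x1 x2 (fun t =>
  d (r * t)) (fun=> 0) (fun=> g) (fun=> 0) (fun=> 0) px) => //.
- by move=> s u _ su; apply: dmon; rewrite ler_wpM2l.
- by rewrite addr0.
- by lra.
- by move=> s _ _; rewrite addr0 => e1 e2; have := cubd (r * s); rewrite -e1; lra.
- by move=> s _ _; rewrite addr0 => e1 e2; lra.
Qed.

End Diag.

Section Inflowing.
Context {R : realType}.
Variables (a b : R -> R) (lm lp : R) (Lam : R -> R).
Variables (q c d : R -> R) (qm qp g C D K : R).
Let al s := a (Lam s).
Let be s := b (Lam s) + 1.
Hypotheses (g0 : 0 < g) (cg : forall s, c s + g <= q s) (dg : forall s, q s <= d s - g).
Hypotheses (cmon : forall s t, s <= t -> c t <= c s) (dmon : forall s t, s <= t -> d s <= d t).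
Hypotheses (cubd : forall s, cub (al s) (be s) (d s) <= - (2 * g))
           (cubc : forall s, 2 * g <= cub (al s) (be s) (c s)).
Hypotheses (qcont : continuous q) (qlm : q s @[s --> -oo] --> qm) (qlp : q s @[s --> +oo]
  --> qp).
Hypotheses (wells : forall s, exists c d K, well (al s) (be s) c (q s) d K)
           (wellm : exists c d K, well (a lm) (b lm + 1) c qm d K)
           (wellp : well (a lp) (b lp + 1) C qp D K).
Hypotheses (Cc : forall s, C + g <= c s - g) (dD : forall s, d s + g <= D - g).
Hypotheses (alp : al s @[s --> +oo] --> a lp) (bep : be s @[s --> +oo] --> b lp + 1).

(** For [t <= s] the value [q t] lies in the interval at [t], hence with the same margin in the
    larger one at [s]; the margin survives as [t] tends to minus infinity. This puts the limit point
    into the interior of the intersection of all boxes. *)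
Lemma limit_branch_between s : c s + g <= qm <= d s - g.
Proof.
apply/andP; split; rewrite leNgt; apply/negP => lt.
  have /cvg_real_ninftyP/(_ (c s + g - qm)) := qlm; rewrite subr_gt0 => /(_ lt)[T hT].
  pose t := Num.min s T; have ts : t <= s by rewrite ge_min lexx.
  have := hT t; rewrite ge_min lexx orbT => /(_ isT).
  have := cg t; have := cmon ts; rewrite ltr_norml => ? ? /andP[? ?]; lra.
have /cvg_real_ninftyP/(_ (qm - (d s - g))) := qlm; rewrite subr_gt0 => /(_ lt)[T hT].
pose t := Num.min s T; have ts : t <= s by rewrite ge_min lexx.
have := hT t; rewrite ge_min lexx orbT => /(_ isT).
have := dg t; have := dmon ts; rewrite ltr_norml => ? ? /andP[? ?]; lra.
Qed.

Let F := field_ab a b.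
Let X s := (q s, q s).
Let box s : set (R * R) := (`[c s, d s] `*` `[c s - g, d s + g])%classic.

Lemma boxP s p : box s p <-> c s <= p.1 <= d s /\ c s - g <= p.2 <= d s + g.
Proof. by rewrite /box /= !in_itv. Qed.

Lemma inflowing_stable_path : stable_path F lm lp Lam X (qm, qm) (qp, qp).
Proof.
split.
- exact: diag_continuous.
- by move=> s; have [c' [d' [K' hw]]] := wells s;
  exact: (@well_attracting _ a b (Lam s) _ _ _ _ hw).
- split.
    apply/cvg_plane_ninftyP => h h0; have /cvg_real_ninftyP/(_ h h0)[T hT] := qlm.
    by exists T => t /hT.
  apply/cvg_plane_pinftyP => h h0; have /cvg_real_pinftyP/(_ h h0)[T hT] := qlp.
  by exists T => t /hT.
- by split; [have [c' [d' [K' hw]]] := wellm;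
  exact: (@well_attracting _ a b lm _ _ _ _ hw)|exact: (@well_attracting _ a b lp _ _ _ _
    wellp)].
Qed.

Lemma interior_box (q0 : R) (U : set (R * R)) s : box s `<=` U -> c s < q0 < d s ->
  interior U (q0, q0).
Proof.
move=> sU /andP[cq qd]; apply/nbhs_squareP.
exists (Num.min (q0 - c s) (d s - q0)); first by rewrite lt_min !subr_gt0 cq.
move=> p /=; rewrite !lt_min => /andP[u1 u2] /andP[v1 v2]; apply: sU; apply/boxP.
move: u1 u2 v1 v2; rewrite !ltr_norml => /andP[? ?] /andP[? ?] /andP[? ?] /andP[? ?].
have := g0; split; apply/andP; split; lra.
Qed.

Lemma inflowing_stable : forward_inflowing_stable F lm lp Lam X (qm, qm) (qp, qp).
Proof.
split; first exact: inflowing_stable_path.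
have cK s : compact (box s) by apply: compact_setX; exact: segment_compact.
(* Closing the union may add points, so the comparison square is closed, yet still inside the open
   square of [wellp]. *)
have Kp_sub : closure (\bigcup_s box s) `<=` (`[C + g, D - g] `*` `[C + g, D - g])%classic.
  have cl : closed (`[C + g, D - g] `*` `[C + g, D - g])%classic.
    by apply: compact_closed; [exact: norm_hausdorff|apply: compact_setX;
      exact: segment_compact].
  rewrite [X in _ `<=` X](closure_id _).1//;
    apply: closure_subset => p [s _ /boxP[/andP[? ?] /andP[? ?]]].
  have := Cc s; have := dD s; have := g0 => ? ? ?.
  by split; rewrite /= in_itv/=; apply/andP; split; lra.
exists box => /=; split => //; split.
- move=> s; apply: (@interior_box _ _ s) => //; have := cg s; have := dg s; have := g0 => ? ? ?.
  by apply/andP; split; lra.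
- move=> s1 s2 /ltW s12 p /boxP[/andP[? ?] /andP[? ?]]; apply/boxP.
  by have := cmon s12; have := dmon s12 => ? ?; split; apply/andP; split; lra.
- move=> s p [pK _].
  have /boxP[h1 h2] : box s p.
    by move: pK; rewrite -(closure_id _).1//; apply: compact_closed => //;
      exact: norm_hausdorff.
  have := g0; have := cubd s; have := cubc s; rewrite -/(al s) -/(be s) => ? ? ?.
  case/andP: (h1) => ? ?; case/andP: (h2) => ? ?.
  (* Where the first coordinate is extremal, the pull [2 * g] dominates a coupling of at most [g];
     where the second one is, the second equation alone gives inward speed at least [g]. *)
  apply: square_points_into => // e; rewrite /F fieldE/= ?e -/(al s) -/(be s); lra.
- split.
    apply/nbhs_squareP; exists g => // p /= p1 p2 s _; apply/boxP.
    move: p1 p2; rewrite !ltr_norml => /andP[? ?] /andP[? ?].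
    have := g0; have /andP[? ?] := limit_branch_between s => ?.
    by split; apply/andP; split; lra.
  (* A single late box already has the limit in its interior, by the margin [g]. *)
  have /cvg_real_pinftyP/(_ g g0)[T hT] := qlp.
  apply: (@interior_box _ _ T); first by move=> p pK; apply: subset_closure; exists T.
  have := hT T (lexx _); rewrite ltr_norml => /andP[? ?].
  by have := cg T; have := dg T => ? ?; apply/andP; split; lra.
- split.
    move=> p /Kp_sub[/=]; rewrite !in_itv/= => /andP[? ?] /andP[? ?]; have := g0 => ?.
    by apply: (well_basin wellp); apply/andP; split; lra.
  apply: (subclosed_compact _ _ Kp_sub); first exact: closed_closure.
  by apply: compact_setX; exact: segment_compact.
Qed.

Lemma inflowing_no_tipping : ~ R_tipping F Lam (qm, qm) (qp, qp).
Proof.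
move=> [r [x [r0 [dx xm]]]]; apply.
have g0' := g0.
have g4 : 0 < g / 4 by rewrite divr_gt0.
have /cvg_plane_ninftyP/(_ _ g4)[T1 hT1] := xm.
have /cvg_real_ninftyP/(_ _ g4)[T2 hT2] := qlm.
(* Early enough, the trajectory and the branch are both within [g / 4] of [qm], so the trajectory is
   inside the box at [r * T]. *)
pose T := Num.min T1 (T2 / r).
have [x1m x2m] : `|(x T).1 - qm| < g / 4 /\ `|(x T).2 - qm| < g / 4.
  by apply: hT1; rewrite ge_min lexx.
have qT : `|q (r * T) - qm| < g / 4.
  by apply: hT2; rewrite mulrC -ler_pdivlMr// ge_min lexx orbT.
have px : psol (fun t => cub (al (r * t)) (be (r * t))) T (fun t => (x t).1) (fun t => (x t).2).
  apply: (@psol_of_trajectory R a b (fun t => Lam (r * t))) => //.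
  apply: continuous_subspaceT => t; have [d1 _] := dx t.
  by apply: differentiable_continuous; exact/derivable1_diffP.
move: x1m x2m qT; rewrite !ltr_norml => /andP[? ?] /andP[? ?] /andP[? ?].
have := cg (r * T); have := dg (r * T) => ? ?.
have up := inflowing_upper g0 dmon cubd dD (ltW r0) px.
have cubd' s : cub (- al s) (be s) (- c s) <= - (2 * g).
  have -> : cub (- al s) (be s) (- c s) = - cub (al s) (be s) (c s) by rewrite /cub; ring.
  by rewrite lerN2; exact: cubc.
have dmon' s t : s <= t -> - c s <= - c t by move=> /cmon; rewrite lerN2.
have dD' s : - c s + g <= - C - g by have := Cc s; lra.
have lo := inflowing_upper g0 dmon' cubd' dD' (ltW r0) (psol_cubN px).
have lim e : 0 < e -> exists T1, forall t, T1 <= t ->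
    `|al (r * t) - a lp| <= e /\ `|be (r * t) - (b lp + 1)| <= e.
  move=> e0; have /cvg_real_pinftyP/(_ e e0)[S1 h1] := alp.
  have /cvg_real_pinftyP/(_ e e0)[S2 h2] := bep.
  exists (Num.max (S1 / r) (S2 / r)) => t; rewrite ge_max !ler_pdivrMr// mulrC => /andP[t1 t2].
  by split; apply: ltW; [exact: h1|exact: h2].
apply/cvg_plane_pinftyP => h h0.
apply: (well_conv wellp px lim _ h0) => t Tt.
have [||u1 u2] := up _ _ t Tt; [lra|lra|].
have [||l1 l2] := lo _ _ t Tt; [lra|lra|].
by split; apply/andP; split => //; rewrite -ltrN2.
Qed.

End Inflowing.

(** * Forward inflowing stability *)

Section Margin.
Context {R : realType}.
Implicit Types (f e : R -> R) (s t l T : R).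

Lemma pos_with_limits f (l1 l2 : R) : continuous f ->
  f s @[s --> -oo] --> l1 -> f s @[s --> +oo] --> l2 -> 0 < l1 -> 0 < l2 ->
  (forall s, 0 < f s) -> exists2 d, 0 < d & forall s, d <= f s.
Proof.
move=> cf /cvg_real_ninftyP f1 /cvg_real_pinftyP f2 l10 l20 f0.
have [T1 h1] := f1 (l1 / 2) (divr_gt0 l10 (ltr0n _ 2)).
have [T2 h2] := f2 (l2 / 2) (divr_gt0 l20 (ltr0n _ 2)).
pose T := Num.max T1 T2.
have T12 : T1 <= T by rewrite le_max lexx.
have T22 : T2 <= T by rewrite le_max lexx orbT.
have [c _ hc] := EVT_min T12 (continuous_subspaceT cf).
exists (Num.min (f c) (Num.min (l1 / 2) (l2 / 2))).
  by rewrite !lt_min f0 !divr_gt0.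
move=> s; rewrite !ge_min; have [sT1|T1s] := leP s T1.
  by have := h1 s sT1; rewrite ltr_norml => /andP[h _]; apply/orP; right; apply/orP; left; lra.
have [sT|Ts] := leP s T.
  by rewrite hc// in_itv/= (ltW T1s).
have := h2 s (le_trans T22 (ltW Ts)); rewrite ltr_norml => /andP[h _].
by apply/orP; right; apply/orP; right; lra.
Qed.

Lemma cvg_ninfty_addC f l k : f s @[s --> -oo] --> l -> (f s + k) @[s --> -oo] --> l + k.
Proof.
move=> /cvg_real_ninftyP hf; apply/cvg_real_ninftyP => h /hf[T hT]; exists T => t /hT.
by rewrite opprD addrACA subrr addr0.
Qed.

Lemma cvg_pinfty_addC f l k : f s @[s --> +oo] --> l -> (f s + k) @[s --> +oo] --> l + k.
Proof.
move=> /cvg_real_pinftyP hf; apply/cvg_real_pinftyP => h /hf[T hT]; exists T => t /hT.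
by rewrite opprD addrACA subrr addr0.
Qed.

(** For [s1] near minus infinity the margin [d1] decides, for [s2] near plus infinity the margin
    [d2], and the remaining ordered pairs lie in the compact square [Q]. *)
Lemma ordered_margin f e (fm fp em ep : R) : continuous f -> continuous e ->
  f s @[s --> -oo] --> fm -> f s @[s --> +oo] --> fp ->
  e s @[s --> -oo] --> em -> e s @[s --> +oo] --> ep ->
  (forall s1 s2, s1 <= s2 -> 0 < f s2 + e s1) ->
  (forall s, 0 < f s + em) -> (forall s, 0 < fp + e s) ->
  0 < fm + em -> 0 < fp + em -> 0 < fp + ep ->
  exists2 d, 0 < d & forall s1 s2, s1 <= s2 -> d <= f s2 + e s1.
Proof.
move=> cf ce fm_ fp_ em_ ep_ h hm hp hmm hpm hpp.
have [d1 d10 hd1] : exists2 d, 0 < d & forall s, d <= f s + em.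
  apply: (@pos_with_limits (fun s => f s + em) (fm + em) (fp + em)) => //.
  - by move=> s; apply: (@cntD _ _ _ s); [exact: cf|exact: cnt_cst].
  - exact: cvg_ninfty_addC.
  - exact: cvg_pinfty_addC.
have [d2 d20 hd2] : exists2 d, 0 < d & forall s, d <= e s + fp.
  apply: (@pos_with_limits (fun s => e s + fp) (em + fp) (ep + fp)) => //.
  - by move=> s; apply: (@cntD _ _ _ s); [exact: ce|exact: cnt_cst].
  - exact: cvg_ninfty_addC.
  - exact: cvg_pinfty_addC.
  - by rewrite addrC.
  - by rewrite addrC.
  - by move=> s; rewrite addrC.
have /cvg_real_ninftyP/(_ (d1 / 2))[|S1 hS1] := em_; first exact: divr_gt0.
have /cvg_real_pinftyP/(_ (d2 / 2))[|S2' hS2'] := fp_; first exact: divr_gt0.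
pose S2 := Num.max S1 S2'.
have S12 : S1 <= S2 by rewrite le_max lexx.
have hS2 t : S2 <= t -> `|f t - fp| < d2 / 2.
  by move=> St; apply: hS2'; rewrite (le_trans _ St)// le_max lexx orbT.
pose Q : set (R * R) := (`[S1, S2] `*` `[S1, S2])%classic.
have Q0 : Q !=set0 by exists (S1, S1); split; rewrite /= in_itv/= lexx.
have cQ : compact Q by apply: compact_setX; exact: segment_compact.
(* [Num.max] sends wrongly ordered pairs to the diagonal, so a minimum over the square replaces one
   over the triangle. *)
pose H (p : R * R) := f (Num.max p.1 p.2) + e p.1.
have cH : continuous H.
  move=> p; apply: cvgD.
    apply: (@continuous_comp _ _ _ (fun p : R * R => Num.max p.1 p.2) f) => //; last exact: cf.
    apply: continuous_max; [exact: fst_continuous|exact: snd_continuous].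
  by apply: (@continuous_comp _ _ _ fst e); [exact: fst_continuous|exact: ce].
have [c _ hc] := compact_EVT_min Q0 cQ (continuous_subspaceT cH).
have Hc : 0 < H c by apply: h; rewrite le_max lexx.
exists (Num.min (H c) (Num.min (d1 / 2) (d2 / 2))); first by rewrite !lt_min Hc !divr_gt0.
move=> s1 s2 s12; rewrite !ge_min.
have [a1|a1] := leP s1 S1.
  have := hS1 s1 a1; have := hd1 s2; rewrite ltr_norml => ? /andP[? ?].
  by apply/orP; right; apply/orP; left; lra.
have [a2|a2] := leP S2 s2.
  have := hS2 s2 a2; have := hd2 s1; rewrite ltr_norml => ? /andP[? ?].
  by apply/orP; right; apply/orP; right; lra.
apply/orP; left; have := hc (s1, s2); rewrite /H /= (max_idPr s12); apply.
by rewrite inE; split; rewrite /= in_itv/=; apply/andP; split; lra.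
Qed.

(** The margin [3 * del] is shared out: [del] above the stable branch, [2 * del] below the saddle
    branch at all later times. *)
Lemma running_sup (al be : R -> R) (A del : R) : 0 < del ->
  (forall s, `|be s| <= A) ->
  (forall s1 s2, s1 <= s2 -> 3 * del <= al s2 + be s1) ->
  exists d : R -> R, [/\ forall s t, s <= t -> d s <= d t,
    forall s, - be s + del <= d s & forall s t, s <= t -> d s <= al t - 2 * del].
Proof.
move=> del0 beA h.
pose S s := [set - be s' | s' in [set s' | s' <= s]].
have S0 s : S s !=set0 by exists (- be s); exists s => /=.
have hub s : has_ubound (S s).
  by exists A => _ [s' _ <-]; have := beA s'; rewrite ler_norml => /andP[? ?]; lra.
exists (fun s => sup (S s) + del); split.
- move=> s t st; rewrite lerD2r; apply: ge_sup => // _ [s' /= s's <-].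
  by apply: ub_le_sup => //; exists s' => //=; exact: le_trans st.
- by move=> s; rewrite lerD2r; apply: ub_le_sup => //; exists s => /=.
- move=> s t st; suff : sup (S s) <= al t - 3 * del by lra.
  apply: ge_sup => // _ [s' /= s's <-].
  by have := h s' t (le_trans s's st); lra.
Qed.

(** [al] is the saddle and [- be], [be] are the stable equilibria. Taking the factor [x + be] out of
    the cubic leaves [al - x] and [be - x], both at least [del] for [x <= al - del]; hence the rate
    [del ^+ 2]. *)
Lemma well_left (al be del c d : R) : 0 < del -> del <= 1 -> al <= be -> del <= al + be ->
  c < - be -> - be < d -> d <= al - del -> well al (be ^+ 2) c (- be) d (del ^+ 2).
Proof.
move=> d0 d1 ab dab cb bd dal; split.
- by rewrite cb.
- by rewrite exprn_gt0//= exprn_ile1// ltW.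
- move=> x bx xd; rewrite /cub.
  have -> : - ((x - al) * (x ^+ 2 - be ^+ 2)) = - ((al - x) * (be - x) * (x - - be)) by ring.
  rewrite mulNr lerN2 expr2 ler_wpM2r ?subr_ge0//.
  by apply: ler_pM; lra.
- move=> x cx xb; rewrite /cub.
  have -> : - ((x - al) * (x ^+ 2 - be ^+ 2)) = (al - x) * (be - x) * (- be - x) by ring.
  rewrite expr2 ler_wpM2r ?subr_ge0//.
  by apply: ler_pM; lra.
Qed.

End Margin.

Section PartTwo.
Context {R : realType}.

Lemma inflowing_barrier (al be : R -> R) (alm alp bem bep A0 : R) :
  (forall s, be s <= A0) ->
  continuous al -> continuous be ->
  al s @[s --> -oo] --> alm -> al s @[s --> +oo] --> alp ->
  be s @[s --> -oo] --> bem -> be s @[s --> +oo] --> bep ->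
  (forall s, `|al s| < be s) -> `|alm| < bem -> `|alp| < bep ->
  (forall s1 s2, s1 < s2 -> - be s1 < al s2) ->
  (forall s, - bem < al s) -> (forall s, - be s < alp) -> - bem < alp ->
  exists (d : R -> R) (g c C D K : R),
  [/\ 0 < g,
      (forall s, c + g <= - be s) /\ (forall s, - be s <= d s - g),
      forall s t, s <= t -> d s <= d t,
      (forall s, cub (al s) (be s ^+ 2) (d s) <= - (2 * g)) /\
      (forall s, 2 * g <= cub (al s) (be s ^+ 2) c) &
      [/\ forall s, exists c d K, well (al s) (be s ^+ 2) c (- be s) d K,
          exists c d K, well alm (bem ^+ 2) c (- bem) d K,
          well alp (bep ^+ 2) C (- bep) D K,
          C + g <= c - g & forall s, d s + g <= D - g]].
Proof.
move=> hA cal cbe alm_ alp_ bem_ bep_ hs hm hp h12 h1 h2 hmp.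
have abs (x y : R) : `|x| < y -> [/\ 0 < x + y, x < y & 0 < y].
  by rewrite ltr_norml => /andP[? ?]; split; lra.
have [del0 del00 hdel0] : exists2 d, 0 < d & forall s1 s2, s1 <= s2 -> d <= al s2 + be s1.
  apply: (ordered_margin cal cbe alm_ alp_ bem_ bep_).
  - move=> s1 s2; rewrite le_eqVlt => /predU1P[->|/h12]; last lra.
    by have [] := abs _ _ (hs s2).
  - by move=> s; have := h1 s; lra.
  - by move=> s; have := h2 s; lra.
  - by have [] := abs _ _ hm.
  - lra.
  - by have [] := abs _ _ hp.
(* The bound 1 makes [del ^+ 2] an admissible rate; [alp + bep] leaves room for the limiting well,
   whose right end is [alp - del]. *)
pose del := Num.min 1 (Num.min del0 (alp + bep) / 3).
have [_ _ bep0] := abs _ _ hp; have [hp0 hp1 _] := abs _ _ hp.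
have del_gt0 : 0 < del by rewrite lt_min ltr01 divr_gt0// lt_min del00.
have del1 : del <= 1 by rewrite ge_min lexx.
have deld : 3 * del <= del0.
  have : del <= Num.min del0 (alp + bep) / 3 by rewrite ge_min lexx orbT.
  have : Num.min del0 (alp + bep) <= del0 by rewrite ge_min lexx.
  lra.
have delp : 3 * del <= alp + bep.
  have : del <= Num.min del0 (alp + bep) / 3 by rewrite ge_min lexx orbT.
  have : Num.min del0 (alp + bep) <= alp + bep by rewrite ge_min lexx orbT.
  lra.
clearbody del.
have beA s : `|be s| <= A0.
  by have [_ _ ?] := abs _ _ (hs s); rewrite gtr0_norm.
have h3 s1 s2 : s1 <= s2 -> 3 * del <= al s2 + be s1.
  by move=> /hdel0; lra.
have [d [dmon dlo dhi]] := running_sup del_gt0 beA h3.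
have dp s : d s <= alp - 2 * del.
  rewrite leNgt; apply/negP => lt.
  have /cvg_real_pinftyP/(_ (d s - (alp - 2 * del))) := alp_; rewrite subr_gt0 => /(_ lt)[T hT].
  pose t := Num.max s T.
  have st : s <= t by rewrite le_max lexx.
  have := dhi s t st; have := hT t; rewrite le_max lexx orbT => /(_ isT).
  by rewrite ltr_norml => /andP[_ ?] ?; lra.
have bepA : bep <= A0.
  rewrite leNgt; apply/negP => lt.
  have /cvg_real_pinftyP/(_ (bep - A0)) := bep_; rewrite subr_gt0 => /(_ lt)[T hT].
  by have := hT T (lexx _); have := hA T; rewrite ltr_norml => ? /andP[? _]; lra.
(* At [d s] each of the three factors of the cubic has modulus at least [del], so the cubic is at
   most [- del ^+ 3], that is [- (2 * g)]. *)
pose g := del ^+ 3 / 2.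
have g0 : 0 < g by rewrite divr_gt0// exprn_gt0.
have del3 : del ^+ 3 <= del.
  by rewrite exprS ger_pMr// exprn_ile1// ltW.
have gd : g <= del / 2 by rewrite /g; lra.
have c3 (x y z e : R) : 0 <= e -> e <= x -> e <= y -> e <= z -> e ^+ 3 <= x * y * z.
  by move=> e0 ? ? ?; rewrite !exprS expr0 mulr1 mulrA ler_pM ?mulr_ge0// ler_pM.
have E (x u v : R) : cub u (v ^+ 2) x = (u - x) * (v - x) * - (x + v) by rewrite /cub; ring.
(* Left of all branches, at [- (A0 + 1)], the three factors are at least 1, so the lower side can be
   constant. [C] lies 2 further left and [D] lies at least [del] above every [d s]; both leave room
   for [2 * g <= del <= 1]. *)
exists d, g, (- (A0 + 1)), (- (A0 + 3)), (alp - del), (del ^+ 2).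
have d1 : del ^+ 3 <= 1 by lra.
split => //; [split|split|split].
- by move=> s; have := hA s; lra.
- by move=> s; have := dlo s; lra.
- move=> s; have := dlo s; have := dhi s s (lexx _); have [? ? ?] := abs _ _ (hs s) => ? ?.
  have := @c3 (al s - d s) (be s - d s) (d s + be s) del.
  by rewrite E mulrN lerN2 /g; set X := _ * _ * _ => h; have := h _ _ _ _; lra.
- move=> s; have [? ? ?] := abs _ _ (hs s); have := hA s => ?.
  have := @c3 (al s - - (A0 + 1)) (be s - - (A0 + 1)) (- (- (A0 + 1) + be s)) 1.
  by rewrite E /g expr1n; set X := _ * _ * _ => h; have := h _ _ _ _; lra.
- move=> s; exists (- be s - 1), (al s - del), (del ^+ 2).
  have [? ? ?] := abs _ _ (hs s); have := h3 s s (lexx _).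
  by move=> ?; apply: well_left => //; lra.
- have [? ? ?] := abs _ _ hm.
  pose dm := Num.min 1 ((alm + bem) / 2).
  have dm0 : 0 < dm by rewrite lt_min ltr01 divr_gt0.
  have dm1 : dm <= 1 by rewrite ge_min lexx.
  have dm2 : dm <= (alm + bem) / 2 by rewrite ge_min lexx orbT.
  exists (- bem - 1), (alm - dm), (dm ^+ 2).
  by apply: well_left => //; lra.
- by apply: well_left => //; lra.
- by lra.
- by move=> s; have := dp s; lra.
Qed.

End PartTwo.

(** * Smooth coefficients on the closed parameter interval *)

Section SmoothOn.
Context {R : realType}.
Variables (lm lp : R).
Hypothesis hl : lm < lp.
Implicit Types (f a : R -> R) (u y t s e l : R).
Let A : set R := `[lm, lp]%classic.

Lemma segmentE u : A u <-> lm <= u <= lp.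
Proof. by rewrite /A /= in_itv. Qed.

Lemma diff_quotient_continuous f (l u : R) : A u ->
  (f y - f u) / (y - u) @[y --> within A u^'] --> l ->
  f y @[y --> within A (nbhs u)] --> f u.
Proof.
move=> Au /cvgrPdist_lt/(_ 1 ltr01) [d /= d0 hd].
apply/cvgrPdist_lt => e e0.
have k0 : 0 < `|l| + 1 by rewrite ltr_wpDl.
exists (Num.min d (e / (`|l| + 1))) => /=; first by rewrite lt_min d0 divr_gt0.
move=> y /=; rewrite lt_min => /andP[yd ye] Ay.
have [->|yu] := eqVneq y u; first by rewrite subrr normr0.
have := hd y yd yu Ay => h.
have q1 : `|(f y - f u) / (y - u)| < `|l| + 1.
  have -> : (f y - f u) / (y - u) = l - (l - (f y - f u) / (y - u)) by ring.
  by apply: (le_lt_trans (ler_normB _ _)); rewrite ltrD2l.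
have yu0 : 0 < `|u - y| by rewrite normr_gt0 subr_eq0 eq_sym.
rewrite distrC; have -> : f y - f u = (f y - f u) / (y - u) * (y - u).
  by rewrite divfK// subr_eq0.
rewrite normrM [`|y - u|]distrC.
apply: (@lt_trans _ _ ((`|l| + 1) * `|u - y|)); first by rewrite ltr_pM2r.
by rewrite mulrC -ltr_pdivlMr.
Qed.

Lemma diff_quotient_derive f (l u : R) : lm < u < lp ->
  (f y - f u) / (y - u) @[y --> within A u^'] --> l -> is_derive u 1 f l.
Proof.
move=> /andP[lu ul] /cvgrPdist_lt h; apply/is_deriveE/cvgrPdist_lt => e e0.
have [d /= d0 hd] := h e e0.
exists (Num.min d (Num.min (u - lm) (lp - u))) => /=; first by rewrite !lt_min d0 !subr_gt0 lu.
move=> k /=; rewrite !lt_min sub0r normrN => /andP[kd /andP[k1 k2]] k0.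
have := hd (k + u); rewrite /= opprD addrCA subrr addr0 normrN => /(_ kd).
rewrite -subr_eq0 addrK => /(_ k0); rewrite mulrC; apply.
move: k1 k2; rewrite !ltr_norml => /andP[? ?] /andP[? ?].
by apply/segmentE; apply/andP; split; lra.
Qed.

Lemma smooth_on_continuous a : smooth_on A a -> {within A, continuous a}.
Proof.
move=> [D D0 hD]; apply/subspace_continuousP => u Au.
have := diff_quotient_continuous Au (hD 0%N u Au).
rewrite (D0 u (mem_set Au)) => h; apply: cvg_trans h.
apply: near_eq_cvg; rewrite near_withinE; apply: nearW => y Ay.
by rewrite (D0 y (mem_set Ay)).
Qed.

Lemma within_segment_dist f u e : {within A, continuous f} -> A u -> 0 < e ->
  exists2 d, 0 < d & forall y, A y -> `|y - u| < d -> `|f y - f u| < e.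
Proof.
move=> /subspace_continuousP cf Au e0.
have /cvgrPdist_lt/(_ e e0) [d /= d0 hd] := cf u Au.
by exists d => // y Ay yu; rewrite distrC; apply: hd => //=; rewrite distrC.
Qed.

Lemma within_segment_bounded f : {within A, continuous f} ->
  exists2 M, 0 < M & forall u, A u -> `|f u| <= M.
Proof.
move=> cf.
have [c1 _ h1] := EVT_max (ltW hl) cf; have [c2 _ h2] := EVT_min (ltW hl) cf.
exists (`|f c1| + `|f c2| + 1); first by rewrite ltr_wpDl// addr_ge0.
move=> u Au; have := h1 u Au; have := h2 u Au.
have := ler_norm (f c1); have := ler_norm (- f c2); rewrite normrN => *.
have := normr_ge0 (f c1); have := normr_ge0 (f c2) => ? ?.
by rewrite ler_norml; apply/andP; split; lra.
Qed.

(** The first derivative is bounded because it is itself differentiable, hence continuous, on a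
    compact segment. *)
Lemma smooth_on_derive a : smooth_on A a -> exists da : R -> R,
  (forall u, lm < u < lp -> is_derive u 1 a (da u)) /\
  exists2 M, 0 < M & forall u, A u -> `|da u| <= M.
Proof.
move=> [D D0 hD]; exists (D 1%N); split.
  move=> u /andP[lu ul].
  have Au : A u by apply/segmentE; rewrite !ltW.
  apply: (@near_eq_is_derive _ _ _ (D 0%N)).
    near=> y; apply: D0; apply/mem_set/segmentE; apply/andP; split; apply: ltW.
      by near: y; exact: lt_nbhsr.
    by near: y; exact: lt_nbhsl.
  by apply: (diff_quotient_derive _ (hD 0%N u Au)); rewrite lu.
apply: within_segment_bounded; apply/subspace_continuousP => u Au.
exact: diff_quotient_continuous Au (hD 1%N u Au).
Unshelve. all: by end_near. Qed.

Section Compose.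
Variable L : R -> R.
Hypothesis LA : forall s, A (L s).

Lemma compose_continuous f : {within A, continuous f} -> continuous L ->
  continuous (fun s => f (L s)).
Proof.
move=> cf cL s; apply/cvgrPdist_lt => e e0.
have [d d0 hd] := within_segment_dist cf (LA s) e0.
have /cvgrPdist_lt/(_ d d0) := cL s.
by apply: filterS => t st; rewrite distrC; apply: hd => //; rewrite distrC.
Qed.

Lemma compose_cvg_pinfty f l : {within A, continuous f} -> A l ->
  L s @[s --> +oo] --> l -> f (L s) @[s --> +oo] --> f l.
Proof.
move=> cf Al /cvg_real_pinftyP hL; apply/cvg_real_pinftyP => e e0.
have [d d0 hd] := within_segment_dist cf Al e0.
by have [T hT] := hL d d0; exists T => t /hT; exact: hd.
Qed.

Lemma compose_cvg_ninfty f l : {within A, continuous f} -> A l ->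
  L s @[s --> -oo] --> l -> f (L s) @[s --> -oo] --> f l.
Proof.
move=> cf Al /cvg_real_ninftyP hL; apply/cvg_real_ninftyP => e e0.
have [d d0 hd] := within_segment_dist cf Al e0.
by have [T hT] := hL d d0; exists T => t /hT; exact: hd.
Qed.

End Compose.
End SmoothOn.

(** * Part (2) for both stable branches *)

Section Setting.
Context {R : realType}.
Variables (lm lp : R) (Lam a b : R -> R).
Hypotheses (hl : lm < lp) (hLam : parameter_shift lm lp Lam).
Hypotheses (ha : smooth_on `[lm, lp] a) (hb : smooth_on `[lm, lp] b).
Hypothesis hb1 : forall lam : R, lm <= lam <= lp -> -1 < b lam.
Hypothesis hab : forall lam : R, lm <= lam <= lp -> `|a lam| < Num.sqrt (b lam + 1).
Implicit Types (l s t u : R).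

Definition root1 (b : R -> R) l := Num.sqrt (b l + 1).
Let rt := root1 b.

Lemma shift_in s : lm < Lam s < lp.
Proof. by case: hLam. Qed.

Lemma shift_in_segment s : `[lm, lp]%classic (Lam s).
Proof. by apply/segmentE; have /andP[? ?] := shift_in s; rewrite !ltW. Qed.

Lemma segment_lm : `[lm, lp]%classic lm. Proof. by apply/segmentE; rewrite lexx ltW. Qed.
Lemma segment_lp : `[lm, lp]%classic lp. Proof. by apply/segmentE; rewrite lexx ltW. Qed.

Lemma shift_continuous : continuous Lam.
Proof.
case: hLam => _ [d _ _] _ _ s.
by apply: differentiable_continuous; exact/derivable1_diffP.
Qed.

Lemma root1_continuous : {within `[lm, lp], continuous rt}.
Proof.
apply/subspace_continuousP => u Au; have /subspace_continuousP/(_ u Au) cbu :=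
  smooth_on_continuous hb.
have sc : {for b u, continuous (fun x : R => Num.sqrt (x + 1))}.
  apply: (@continuous_comp _ _ _ (fun x : R => x + 1) Num.sqrt); last exact: sqrt_continuous.
  by apply: (@cntD _ _ _ (b u)); [exact: cvg_id|exact: cnt_cst].
exact: continuous_cvg sc cbu.
Qed.

Lemma root1_gt0 l : lm <= l <= lp -> 0 < rt l.
Proof. by move=> /hb1 h; rewrite sqrtr_gt0; lra. Qed.

Lemma root1_sqr l : lm <= l <= lp -> rt l ^+ 2 = b l + 1.
Proof. by move=> /hb1 h; rewrite sqr_sqrtr//; lra. Qed.

Let lmi : lm <= lm <= lp. Proof. exact/segmentE/segment_lm. Qed.
Let lpi : lm <= lp <= lp. Proof. exact/segmentE/segment_lp. Qed.
Let Lai s : lm <= Lam s <= lp. Proof. exact/segmentE/shift_in_segment. Qed.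

Let Lam_m : Lam s @[s --> -oo] --> lm. Proof. by case: hLam => _ _ []. Qed.
Let Lam_p : Lam s @[s --> +oo] --> lp. Proof. by case: hLam => _ _ []. Qed.

Lemma b_cvg_pinfty : (b (Lam s) + 1) @[s --> +oo] --> b lp + 1.
Proof. exact: cvg_pinfty_addC (compose_cvg_pinfty shift_in_segment (smooth_on_continuous
  hb) segment_lp Lam_p). Qed.

Lemma cvg_ninftyN (f : R -> R) l : f s @[s --> -oo] --> l -> (- f s) @[s --> -oo] --> - l.
Proof.
move=> /cvg_real_ninftyP h; apply/cvg_real_ninftyP => e /h[T hT]; exists T => t /hT.
by rewrite -opprD normrN.
Qed.

Lemma cvg_pinftyN (f : R -> R) l : f s @[s --> +oo] --> l -> (- f s) @[s --> +oo] --> - l.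
Proof.
move=> /cvg_real_pinftyP h; apply/cvg_real_pinftyP => e /h[T hT]; exists T => t /hT.
by rewrite -opprD normrN.
Qed.

Lemma within_oppr_seg (f : R -> R) : {within `[lm, lp], continuous f} ->
  {within `[lm, lp], continuous (fun l => - f l)}.
Proof. by move=> cf u; apply: continuousN; exact: cf. Qed.

(* a' is a (for p1) or -a (for p3) *)
Lemma inflowing_barrier_shift a' : {within `[lm, lp], continuous a'} ->
  (forall l, lm <= l <= lp -> `|a' l| < rt l) ->
  (forall s1 s2, s1 < s2 -> - rt (Lam s1) < a' (Lam s2)) ->
  (forall s, - rt lm < a' (Lam s)) -> (forall s, - rt (Lam s) < a' lp) ->
  - rt lm < a' lp ->
  exists (d : R -> R) (g c C D K : R),
  [/\ 0 < g,
      (forall s, c + g <= - rt (Lam s)) /\ (forall s, - rt (Lam s) <= d s - g),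
      forall s t, s <= t -> d s <= d t,
      (forall s, cub (a' (Lam s)) (b (Lam s) + 1) (d s) <= - (2 * g)) /\
      (forall s, 2 * g <= cub (a' (Lam s)) (b (Lam s) + 1) c) &
      [/\ forall s, exists c d K, well (a' (Lam s)) (b (Lam s) + 1) c (- rt (Lam s)) d K,
          exists c d K, well (a' lm) (b lm + 1) c (- rt lm) d K,
          well (a' lp) (b lp + 1) C (- rt lp) D K,
          C + g <= c - g & forall s, d s + g <= D - g]].
Proof.
move=> ca' ha' h1 h2 h3 h4.
have [A _ hA] := within_segment_bounded hl root1_continuous.
have hA' s : rt (Lam s) <= A by apply: le_trans (hA _ (shift_in_segment s)); exact: ler_norm.
have [d [g [c [C [D [K [g0 hcd mon [cd cc] [w1 w2 w3 hC hD]]]]]]]] :=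
  @inflowing_barrier R (fun s => a' (Lam s)) (fun s =>
    rt (Lam s)) (a' lm) (a' lp) (rt lm) (rt lp) A hA'
   (compose_continuous shift_in_segment ca' shift_continuous)
   (compose_continuous shift_in_segment root1_continuous shift_continuous)
   (compose_cvg_ninfty shift_in_segment ca' segment_lm Lam_m)
   (compose_cvg_pinfty shift_in_segment ca' segment_lp Lam_p)
   (compose_cvg_ninfty shift_in_segment root1_continuous segment_lm Lam_m)
   (compose_cvg_pinfty shift_in_segment root1_continuous segment_lp Lam_p)
   (fun s => ha' _ (Lai s)) (ha' _ lmi) (ha' _ lpi) h1 h2 h3 h4.
exists d, g, c, C, D, K; split => //.
- by split=> s; rewrite -root1_sqr.
- by split => // [s||]; rewrite -root1_sqr.
Qed.

Lemma part2_left :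
  (forall s1 s2, s1 < s2 -> - rt (Lam s1) < a (Lam s2)) ->
  (forall s, - rt lm < a (Lam s)) -> (forall s, - rt (Lam s) < a lp) ->
  - rt lm < a lp ->
  forward_inflowing_stable (field_ab a b) lm lp Lam (p1 b Lam) (- rt lm, - rt lm) (- rt lp,
    - rt lp)
  /\ ~ R_tipping (field_ab a b) Lam (- rt lm, - rt lm) (- rt lp, - rt lp).
Proof.
move=> h1 h2 h3 h4.
have [d [g [c [C [D [K [g0 [hc hd] mon [cd cc] [w1 w2 w3 hC hD]]]]]]]] :=
  inflowing_barrier_shift (smooth_on_continuous ha) hab h1 h2 h3 h4.
have cq : continuous (fun s => - rt (Lam s)).
  by move=> s; apply: (@cntN _ _ s); exact: (compose_continuous shift_in_segment
    root1_continuous shift_continuous).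
have qm := cvg_ninftyN (compose_cvg_ninfty shift_in_segment root1_continuous segment_lm Lam_m).
have qp := cvg_pinftyN (compose_cvg_pinfty shift_in_segment root1_continuous segment_lp Lam_p).
split.
- apply: (@inflowing_stable R a b lm lp Lam (fun s =>
  - rt (Lam s)) (fun=> c) d (- rt lm) (- rt lp) g C D K) => //.
- apply: (@inflowing_no_tipping R a b lp Lam (fun s =>
  - rt (Lam s)) (fun=> c) d (- rt lm) (- rt lp) g C D K) => //.
  + exact: (compose_cvg_pinfty shift_in_segment (smooth_on_continuous ha) segment_lp Lam_p).
  + exact: b_cvg_pinfty.
Qed.

Lemma part2_right :
  (forall s1 s2, s1 < s2 -> a (Lam s2) < rt (Lam s1)) ->
  (forall s, a (Lam s) < rt lm) -> (forall s, a lp < rt (Lam s)) ->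
  a lp < rt lm ->
  forward_inflowing_stable (field_ab a b) lm lp Lam (p3 b Lam) (rt lm, rt lm) (rt lp, rt lp)
  /\ ~ R_tipping (field_ab a b) Lam (rt lm, rt lm) (rt lp, rt lp).
Proof.
move=> h1 h2 h3 h4.
have [|||||d [g [c [C [D [K [g0 [hc hd] mon [cd cc] [w1 w2 w3 hC hD]]]]]]]] :=
  inflowing_barrier_shift (within_oppr_seg (smooth_on_continuous ha)).
- by move=> l /hab; rewrite normrN.
- by move=> s1 s2 /h1; rewrite ltrN2.
- by move=> s; rewrite ltrN2.
- by move=> s; rewrite ltrN2.
- by rewrite ltrN2.
(* Reflection swaps the ends of a well: the moving upper side [d] becomes the moving lower side
   [- d s], and the constant [c] becomes the constant upper side [- c]. *)
have well_opp (al be c0 q d0 K0 : R) : well (- al) be c0 (- q) d0 K0 ->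
  well al be (- d0) q (- c0) K0.
  by move=> /wellN; rewrite !opprK.
have cubO (al be x : R) : cub al be (- x) = - cub (- al) be x.
  by rewrite /cub; ring.
have cq : continuous (fun s => rt (Lam s)) :=
  compose_continuous shift_in_segment root1_continuous shift_continuous.
have qm := compose_cvg_ninfty shift_in_segment root1_continuous segment_lm Lam_m.
have qp := compose_cvg_pinfty shift_in_segment root1_continuous segment_lp Lam_p.
have k1 s : - d s + g <= rt (Lam s) by have := hd s; lra.
have k2 s : rt (Lam s) <= - c - g by have := hc s; lra.
have k3 s t : s <= t -> - d t <= - d s by move=> /mon; rewrite lerN2.
have k4 s : cub (a (Lam s)) (b (Lam s) + 1) (- c) <= - (2 * g) by rewrite cubO lerN2.
have k5 s : 2 * g <= cub (a (Lam s)) (b (Lam s) + 1) (- d s) by rewrite cubO lerNr.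
have v1 s : exists c d K, well (a (Lam s)) (b (Lam s) + 1) c (rt (Lam s)) d K.
  by have [c' [d' [K' /well_opp w]]] := w1 s; exists (- d'), (- c'), K'.
have v2 : exists c d K, well (a lm) (b lm + 1) c (rt lm) d K.
  by have [c' [d' [K' /well_opp w]]] := w2; exists (- d'), (- c'), K'.
have v3 := well_opp _ _ _ _ _ _ w3.
have k6 s : - D + g <= - d s - g by have := hD s; lra.
have k7 (s : R) : - c + g <= - C - g by lra.
split.
- exact: (@inflowing_stable R a b lm lp Lam (fun s => rt (Lam s)) (fun s =>
  - d s) (fun=> - c) (rt lm) (rt lp) g (- D) (- C) K).
- apply: (@inflowing_no_tipping R a b lp Lam (fun s => rt (Lam s)) (fun s =>
  - d s) (fun=> - c) (rt lm) (rt lp) g (- D) (- C) K) => //.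
  + exact: (compose_cvg_pinfty shift_in_segment (smooth_on_continuous ha) segment_lp Lam_p).
  + exact: b_cvg_pinfty.
Qed.

End Setting.

(** * R-tipping for a slow-fast-slow reparametrization *)

Section Ramp.
Context {R : realType}.
Implicit Types (t s u k M : R).

Definition logistic k t : R := (1 + expR (- (k * t)))^-1.

Lemma logistic_den_gt0 k t : 0 < 1 + expR (- (k * t)) :> R.
Proof. by rewrite addr_gt0 ?expR_gt0. Qed.

Lemma logistic_derive k t : is_derive t 1 (logistic k) (k * (logistic k t * (1 - logistic k
  t))).
Proof.
have d1 : is_derive t 1 (fun t => - (k * t)) (- k).
  by apply: (der_eq (derN (derZ k (der_id t)))); rewrite mulr1.
have d2 := derD (der_cst 1 t) (der_expR d1).
have n0 : 1 + expR (- (k * t)) != 0 by rewrite gt_eqF// logistic_den_gt0.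
have d3 : is_derive t 1 (logistic k) _ := derV (f := fun t => 1 + expR (- (k * t))) n0 d2.
apply: (der_eq d3); rewrite /logistic.
move: (expR _) n0 => e n0; field; exact: n0.
Qed.

Lemma logistic_bounds k t : 0 < logistic k t < 1.
Proof.
rewrite /logistic invr_gt0 logistic_den_gt0/= invf_lt1 ?logistic_den_gt0// ltrDl expR_gt0 //.
Qed.

Lemma logisticN k t : logistic k (- t) = 1 - logistic k t.
Proof.
rewrite /logistic mulrN opprK expRN; have := expR_gt0 (k * t); move: (expR _) => e e0.
by field; rewrite !gt_eqF// ?addr_gt0.
Qed.

Lemma logistic_le_expR k t : logistic k t <= expR (k * t).
Proof.
rewrite /logistic -[leRHS]invrK -expRN lef_pV2 ?posrE ?logistic_den_gt0 ?expR_gt0//.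
by rewrite lerDr.
Qed.

Lemma expR_ge_sqr u : 0 <= u -> u ^+ 2 / 4 <= expR u.
Proof.
move=> u0; have h := expR_ge1Dx (u / 2).
have -> : expR u = expR (u / 2) * expR (u / 2) by rewrite -expRD; congr expR; field.
apply: (@le_trans _ _ ((1 + u / 2) * (1 + u / 2))); last first.
  by apply: ler_pM => //; rewrite addr_ge0// divr_ge0.
by rewrite expr2; lra.
Qed.

(** A logistic jump from [s1] to [s2], steep enough to be almost over within time [tau], plus a slow
    linear drift [ep * t]. The drift carries [phi] to both infinities, so that a composed shift
    keeps its limits. *)
Lemma ramp (s1 s2 tau mu : R) : s1 < s2 -> 0 < tau -> 0 < mu ->
  exists phi dphi ddphi : R -> R,
  [/\ forall t, is_derive t 1 phi (dphi t),
      (forall t, is_derive t 1 dphi (ddphi t)) /\ continuous ddphi,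
      (exists M, forall t, 0 <= dphi t <= M) /\
      (forall t, tau <= `|t| -> dphi t <= mu),
      `|phi (- tau) - s1| <= mu /\ `|phi tau - s2| <= mu &
      (forall M, exists T, forall t, t <= T -> phi t <= M) /\
      (forall M, exists T, forall t, T <= t -> M <= phi t)].
Proof.
move=> s12 tau0 mu0.
pose c := s2 - s1; have c0 : 0 < c by rewrite subr_gt0.
pose ep := Num.min (mu / 2) (mu / (2 * tau)).
have ep0 : 0 < ep by rewrite lt_min !divr_gt0// mulr_gt0.
have ep1 : ep <= mu / 2 by rewrite ge_min lexx.
have ept : ep * tau <= mu / 2.
  have : ep <= mu / (2 * tau) by rewrite ge_min lexx orbT.
  move=> h; apply: (@le_trans _ _ (mu / (2 * tau) * tau)); first by rewrite ler_pM2r.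
  by have -> : mu / (2 * tau) * tau = mu / 2 by field; exact: lt0r_neq0.
clearbody ep.
(* By [expR_ge_sqr], [c * k * expR (- (k * tau))] is at most [4 * c / (tau ^+ 2 * k)], which this
   [k] brings below [mu / 2]. The summand 1 gives [k >= 1], so the bound also holds without the
   factor [k]. *)
pose k := 1 + 8 * c / (mu * tau ^+ 2).
have t20 : 0 < tau ^+ 2 by rewrite exprn_gt0.
have k1 : 1 <= k by rewrite lerDl divr_ge0// ?mulr_ge0// ?ltW// mulr_gt0.
have k0 : 0 < k by rewrite (lt_le_trans ltr01).
have kexp : c * (k * expR (- (k * tau))) <= mu / 2.
  have h1 := expR_ge_sqr (mulr_ge0 (ltW k0) (ltW tau0)).
  have h2 : 0 < (k * tau) ^+ 2 / 4 by rewrite divr_gt0// exprn_gt0// mulr_gt0.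
  rewrite expRN.
  have h3 : (expR (k * tau))^-1 <= ((k * tau) ^+ 2 / 4)^-1.
    by rewrite lef_pV2 ?posrE ?expR_gt0.
  apply: (@le_trans _ _ (c * (k * ((k * tau) ^+ 2 / 4)^-1))).
    by rewrite ler_pM2l// ler_pM2l.
  have -> : c * (k * ((k * tau) ^+ 2 / 4)^-1) = 4 * c / tau ^+ 2 / k.
    by field; rewrite !gt_eqF.
  rewrite ler_pdivrMr//.
  have -> : mu / 2 * k = mu / 2 + 4 * c / tau ^+ 2.
    by rewrite /k; field; rewrite !gt_eqF.
  by rewrite lerDr divr_ge0// ltW.
have expk : c * expR (- (k * tau)) <= mu / 2.
  apply: le_trans kexp; rewrite ler_pM2l// ler_peMl// ltW// expR_gt0//.
clearbody k.
pose S := logistic k.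
have S01 t : 0 < S t /\ S t < 1 by have /andP[] := logistic_bounds k t.
pose phi t := s1 + ep * t + c * S t.
pose dphi t := ep + c * (k * (S t * (1 - S t))).
pose ddphi t := c * (k * (k * (S t * (1 - S t)) * (1 - 2 * S t))).
have SN u : S (- u) = 1 - S u := logisticN k u.
have dS t : is_derive t 1 S (k * (S t * (1 - S t))) := logistic_derive k t.
have cS t : {for t, continuous S} by exact: is_derive_cont (dS t).
have SS0 t : 0 <= S t * (1 - S t).
  by have [? ?] := S01 t; rewrite mulr_ge0; lra.
have SS1 t : S t * (1 - S t) <= 1.
  by have [? ?] := S01 t; rewrite -[leRHS]mulr1 ler_pM//; lra.
have Stau : S (- tau) <= expR (- (k * tau)) by rewrite -mulrN; exact: logistic_le_expR.
have Sfar t : tau <= `|t| -> S t * (1 - S t) <= expR (- (k * tau)).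
  have aux u : tau <= u -> S (- u) * (1 - S (- u)) <= expR (- (k * tau)).
    move=> tu; have [h1 h2] := S01 (- u).
    apply: (@le_trans _ _ (S (- u))); first by rewrite ger_pMr//; lra.
    apply: (le_trans (logistic_le_expR k (- u))).
    by rewrite ler_expR mulrN lerN2 ler_pM2l.
  have [t0|/ltW t0] := leP 0 t.
    rewrite ger0_norm// => /aux; rewrite SN.
    by have -> : (1 - S t) * (1 - (1 - S t)) = S t * (1 - S t) by ring.
  by rewrite ler0_norm// => /aux; rewrite opprK.
exists phi, dphi, ddphi; split.
- move=> t; apply: (der_eq (derD (derD (der_cst s1 t) (derZ ep (der_id t))) (derZ c (dS t)))).
  by rewrite /dphi; ring.
- split=> t.
    apply: (der_eq (derD (der_cst ep t) (derZ c (derZ k (derM (dS t) (derB (der_cst 1 t)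
      (dS t))))))).
    by rewrite /ddphi; ring.
  have c1 : {for t, continuous (fun t => 1 - S t)} by apply: (@cntB _ _ _ t);
    [exact: cnt_cst|exact: cS].
  apply: (@cntM _ _ _ t); first exact: cnt_cst.
  apply: (@cntM _ _ _ t); first exact: cnt_cst.
  apply: (@cntM _ _ _ t).
    apply: (@cntM _ _ _ t); first exact: cnt_cst.
    by apply: (@cntM _ _ _ t).
  apply: (@cntB _ _ _ t); first exact: cnt_cst.
  by apply: (@cntM _ _ _ t); [exact: cnt_cst|exact: cS].
- split.
    exists (ep + c * k) => t; apply/andP; split.
      by rewrite addr_ge0 ?(ltW ep0)// mulr_ge0 ?(ltW c0)// mulr_ge0// ltW.
    by rewrite lerD2l ler_pM2l// ger_pMr.
  move=> t /Sfar h; rewrite /dphi.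
  have : c * (k * (S t * (1 - S t))) <= c * (k * expR (- (k * tau))) by rewrite ler_pM2l//
    ler_pM2l.
  lra.
- have h : c * S (- tau) <= mu / 2 by apply: le_trans expk; rewrite ler_pM2l.
  have h0 : 0 <= c * S (- tau) by rewrite mulr_ge0 ?(ltW c0)// ltW// (S01 _).1.
  have e0 : 0 <= ep * tau by rewrite mulr_ge0// ltW.
  rewrite /phi; split.
    have -> : s1 + ep * - tau + c * S (- tau) - s1 = c * S (- tau) - ep * tau by ring.
    by rewrite ler_norml; apply/andP; split; lra.
  have -> : s1 + ep * tau + c * S tau - s2 = ep * tau - c * S (- tau).
    by rewrite SN /c; ring.
  by rewrite ler_norml; apply/andP; split; lra.
- have cS0 t : 0 <= c * S t <= c.
    have [? ?] := S01 t; apply/andP; split; first by apply: mulr_ge0; exact: ltW.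
    by rewrite ger_pMr// ltW.
  split=> M.
    exists ((M - s1 - c) / ep) => t; rewrite ler_pdivlMr// mulrC => h.
    by have /andP[? ?] := cS0 t; rewrite /phi; lra.
  exists ((M - s1) / ep) => t; rewrite ler_pdivrMr// mulrC => h.
  by have /andP[? ?] := cS0 t; rewrite /phi; lra.
Qed.

End Ramp.

(** * Moving lower barriers and the tipping estimate *)

Section LowerBarriers.
Context {R : realType}.
Implicit Types (t s u T : R).

(** The offset [gam / 2] between the two barriers costs the first equation half of [gam] and gives
    the second one a rise of [gam / 2], so both outrun a [psi] rising more slowly than [gam / 2]. *)
Lemma slow_lower_barrier (g : R -> R -> R) T T' (x1 x2 psi dpsi : R -> R) (gam : R) :
  psol g T x1 x2 -> (forall t, is_derive t 1 psi (dpsi t)) ->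
  0 < gam -> (forall t, T < t -> t <= T' -> dpsi t < gam / 2 /\ gam <= g t (psi t)) ->
  psi T < x1 T -> psi T - gam / 2 < x2 T ->
  forall t, T <= t -> t <= T' -> psi t < x1 t /\ psi t - gam / 2 < x2 t.
Proof.
move=> px dp g0 hg i1 i2 t Tt tT'.
have dn u : is_derive u 1 (fun t => - psi t) (- dpsi u) by apply: derN.
have dn2 u : is_derive u 1 (fun t => - psi t + gam / 2) (- dpsi u).
  by apply: (der_eq (derD (dn u) (der_cst (gam / 2) u))); rewrite addr0.
suff : - x1 t < 0 + - psi t /\ - x2 t < 0 + (- psi t + gam / 2) by rewrite !add0r; lra.
apply: (@upper_barrier R _ T T' _ _ (fun=> 0) (fun t => - psi t) (fun t => - psi t + gam / 2)
  (fun t => - dpsi t) (fun t => - dpsi t) (psolN px)) => //; rewrite ?add0r.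
- exact: (continuous_subspaceT (fun u => is_derive_cont (dn u))).
- exact: (continuous_subspaceT (fun u => is_derive_cont (dn2 u))).
- by lra.
- by lra.
- move=> s Ts sT'; rewrite !add0r opprK => /oppr_inj -> h.
  by have [? ?] := hg s Ts sT'; lra.
- move=> s Ts sT'; rewrite !add0r => h1 h2.
  by have [? ?] := hg s Ts sT'; lra.
Qed.

(** For the short fast phase, in which the sign of the cubic is uncontrolled. With equal entries the
    coupling is favourable on both faces, so it is enough to fall faster than the cubic can push. *)
Lemma falling_lower_barrier (g : R -> R -> R) T T' (x1 x2 : R -> R) (w N : R) :
  psol g T x1 x2 ->
  (forall t, T < t -> t <= T' -> - N < g t (w - N * (t - T))) -> 0 < N ->
  w < x1 T -> w < x2 T ->
  forall t, T <= t -> t <= T' -> w - N * (t - T) < x1 t /\ w - N * (t - T) < x2 t.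
Proof.
move=> px hg N0 i1 i2 t Tt tT'.
have dn u : is_derive u 1 (fun t => - (w - N * (t - T))) N.
  apply: (der_eq (derN (derB (der_cst w u) (derZ N (derB (der_id u) (der_cst T u)))))).
  by ring.
suff : - x1 t < 0 + - (w - N * (t - T)) /\ - x2 t < 0 + - (w - N * (t - T)) by rewrite
  !add0r !ltrN2.
have cc := continuous_subspaceT (A := `[T, +oo[%classic) (fun u => is_derive_cont (dn u)).
apply: (@upper_barrier R _ T T' _ _ (fun=> 0) (fun t => - (w - N * (t - T)))
  (fun t => - (w - N * (t - T))) (fun=> N) (fun=> N) (psolN px)) => //;
  rewrite ?add0r ?subrr ?mulr0 ?subr0 ?ltrN2//.
- move=> s Ts sT'; rewrite !add0r opprK => /oppr_inj -> h.
  by have := hg s Ts sT'; lra.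
- move=> s Ts sT'; rewrite !add0r => h1 h2; lra.
Qed.

End LowerBarriers.

Section Tipping.
Context {R : realType}.
Implicit Types (t s h T : R).

Lemma lip_of_derive (f df : R -> R) (L : R) s t : (forall u : R, is_derive u 1 f (df u)) ->
  (forall u, `|df u| <= L) -> `|f s - f t| <= L * `|s - t|.
Proof.
move=> dfE dfL; wlog st : s t / t <= s => [H|].
  by have [/H//|/ltW/H] := leP t s; rewrite distrC [X in _ <= _ * X]distrC.
have [c _ ->] := @MVT_segment R f df t s st (fun u _ => dfE u)
  (continuous_subspaceT (fun u => is_derive_cont (dfE u))).
by rewrite normrM ler_wpM2r.
Qed.

Lemma cub_factor (u v x : R) : cub u (v ^+ 2) x = (x - u) * (v - x) * (v + x).
Proof. by rewrite /cub; ring. Qed.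

Lemma mul3_ge (x y z e1 e2 e3 : R) : 0 <= e1 -> 0 <= e2 -> 0 <= e3 ->
  e1 <= x -> e2 <= y -> e3 <= z -> e1 * e2 * e3 <= x * y * z.
Proof. by move=> ? ? ? ? ? ?; rewrite ler_pM ?mulr_ge0// ler_pM. Qed.

Lemma cub_below_left (u v h : R) : 0 < h -> 0 <= v + u -> 0 <= v ->
  h * h * h <= cub u (v ^+ 2) (- v - h).
Proof.
move=> h0 uv v0; have -> : cub u (v ^+ 2) (- v - h) = (v + u + h) * (v + v + h) * h.
  by rewrite cub_factor; ring.
by apply: mul3_ge; lra.
Qed.

(** The point lies between the saddle [u] and the right equilibrium [v], where the cubic is
    positive; [th <= 1 / 2] keeps half of the factor [v - u]. *)
Lemma cub_convex_comb (u v th e : R) : 0 < th -> th <= 1 / 2 -> 0 < e ->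
  e <= v - u -> e <= v + u ->
  th * e * (e / 2) * e <= cub u (v ^+ 2) (u + th * (v - u)).
Proof.
move=> th0 th1 e0 uv1 uv2.
have -> : cub u (v ^+ 2) (u + th * (v - u)) =
    th * (v - u) * ((v - u) * (1 - th)) * (v + u + th * (v - u)).
  by rewrite cub_factor; ring.
have p0 : 0 <= th * (v - u) by rewrite mulr_ge0 ?ltW//; lra.
apply: mul3_ge; first by rewrite mulr_ge0 ?ltW.
- by rewrite divr_ge0// ltW.
- exact: ltW.
- by rewrite ler_pM2l.
- by apply: ler_pM; lra.
- lra.
Qed.

Lemma pullback_along (al be phi : R -> R) (A del alm bem : R) :
  continuous al -> continuous be ->
  0 < A -> (forall s, `|al s| <= A) -> (forall s, `|be s| <= A) ->
  0 < del -> del <= 1 -> del <= bem - alm -> del <= bem + alm ->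
  al s @[s --> -oo] --> alm -> be s @[s --> -oo] --> bem ->
  continuous phi -> (forall M, exists T, forall t, t <= T -> phi t <= M) ->
  exists x1 x2 : R -> R,
  [/\ forall t, is_derive t 1 x1 (cub (al (phi t)) (be (phi t) ^+ 2) (x1 t) + (x2 t - x1 t)),
      forall t, is_derive t 1 x2 (x1 t - x2 t) &
      forall e, 0 < e -> exists T, forall t, t <= T ->
        `|x1 t - - bem| <= e /\ `|x2 t - - bem| <= e].
Proof.
move=> cal0 cbe0 A0 alA beA d0 d1 g1 g2 alm_ bem_ cphi phim.
have cal : continuous (fun t => al (phi t)).
  by move=> t; apply: continuous_comp; [exact: cphi|exact: cal0].
have cbe : continuous (fun t => be (phi t) ^+ 2).
  move=> t; have cb : {for t, continuous (fun t => be (phi t))}.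
    by apply: continuous_comp; [exact: cphi|exact: cbe0].
  exact: (@cntM _ _ _ t cb cb).
have A20 : 0 <= A + A ^+ 2 by rewrite addr_ge0 ?exprn_ge0 ?ltW.
have alA2 t : `|al (phi t)| <= A + A ^+ 2 by rewrite (le_trans (alA _))// lerDl exprn_ge0// ltW.
have beA2 t : `|be (phi t) ^+ 2| <= A + A ^+ 2.
  rewrite normrX; apply: (@le_trans _ _ (A ^+ 2)); last by rewrite lerDr ltW.
  by rewrite lerXn2r// nnegrE ltW.
have d20 : 0 < del / 2 by rewrite divr_gt0.
(* Half of the rate of the limiting well; the other half absorbs the deviation of the coefficients
   from their limits. *)
pose K := (del / 2) ^+ 2 / 2.
have K0 : 0 < K by rewrite divr_gt0// exprn_gt0.
have K1 : K <= 1.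
  have : (del / 2) ^+ 2 <= 1 by rewrite exprn_ile1//; lra.
  by rewrite /K; lra.
have hw : well alm (bem ^+ 2) (- bem - 1) (- bem) (alm - del / 2) ((del / 2) ^+ 2).
  by apply: well_left; lra.
apply: (@pullback_exists R _ _ _ cal cbe A20 alA2 beA2 (- bem) K (del / 2) K0 K1 d20).
move=> h h0 hd.
have Kh : 0 < K * h by rewrite mulr_gt0.
have [e e0 he] := cub_unif alm (bem ^+ 2) (M := `|bem| + 1) (addr_ge0 (normr_ge0 _) ler01) Kh.
have /cvg_real_ninftyP/(_ e e0)[T1 hT1] := alm_.
have bem2_ : be s ^+ 2 @[s --> -oo] --> bem ^+ 2 by exact: (cvgM bem_ bem_).
have /cvg_real_ninftyP/(_ e e0)[T2 hT2] := bem2_.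
have [T hT] := phim (Num.min T1 T2).
exists T => t /hT; rewrite le_min => /andP[t1 t2].
have a1 := ltW (hT1 _ t1); have a2 := ltW (hT2 _ t2).
have [_ _ w1 w2] := hw.
have nb := ler_norm bem; have nb' := ler_norm (- bem); rewrite normrN in nb'.
have n0 := normr_ge0 bem.
have K2 : (del / 2) ^+ 2 * h = 2 * (K * h) by rewrite /K; field.
split.
- have := he _ _ (- bem + h) a1 a2; rewrite !ler_norml => hh.
  have /hh/andP[_ b1] : - (`|bem| + 1) <= - bem + h <= `|bem| + 1.
    by clear -nb nb' n0 h0 hd d1; apply/andP; split; lra.
  have := w1 (- bem + h); rewrite mulNr addrAC subrr add0r K2 => w.
  have b2 : cub alm (bem ^+ 2) (- bem + h) <= - (2 * (K * h)).
    by apply: w; clear -h0 hd g2; lra.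
  by clear -b1 b2; lra.
- have := he _ _ (- bem - h) a1 a2; rewrite !ler_norml => hh.
  have /hh/andP[b1 _] : - (`|bem| + 1) <= - bem - h <= `|bem| + 1.
    by clear -nb nb' n0 h0 hd d1; apply/andP; split; lra.
  have := w2 (- bem - h); have -> : - bem - (- bem - h) = h by ring.
  rewrite K2 => w.
  have b2 : 2 * (K * h) <= cub alm (bem ^+ 2) (- bem - h).
    by apply: w; clear -h0 hd d1; lra.
  by clear -b1 b2; lra.
Qed.

Lemma tipping_core (al be dal dbe : R -> R) (A L del alm bem s1 s2 : R) :
  (forall s : R, is_derive s 1 al (dal s)) -> (forall s : R, is_derive s 1 be (dbe s)) ->
  0 < L -> (forall s, `|dal s| <= L) -> (forall s, `|dbe s| <= L) ->
  0 < A -> (forall s, `|al s| <= A) -> (forall s, `|be s| <= A) ->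
  0 < del -> del <= 1 ->
  (forall s, del <= be s - al s) -> (forall s, del <= be s + al s) ->
  del <= bem - alm -> del <= bem + alm ->
  al s @[s --> -oo] --> alm -> be s @[s --> -oo] --> bem ->
  s1 < s2 -> al s2 < - be s1 ->
  exists phi dphi ddphi x1 x2 : R -> R,
  [/\ forall t, is_derive t 1 phi (dphi t),
      (forall t, is_derive t 1 dphi (ddphi t)) /\ continuous ddphi,
      exists M, forall t, 0 <= dphi t <= M,
      (forall M, exists T, forall t, t <= T -> phi t <= M) /\
      (forall M, exists T, forall t, T <= t -> M <= phi t) &
      [/\ forall t, is_derive t 1 x1 (cub (al (phi t)) (be (phi t) ^+ 2) (x1 t) + (x2 t -
        x1 t)),
          forall t, is_derive t 1 x2 (x1 t - x2 t),
          forall e, 0 < e -> exists T, forall t, t <= T ->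
            `|x1 t - - bem| <= e /\ `|x2 t - - bem| <= e &
          exists T, forall t, T <= t -> - be (phi t) + del <= x1 t]].
Proof.
move=> dalE dbeE L0 dalL dbeL A0 alA beA d0 d1 gap1 gap2 gapm1 gapm2 alm_ bem_ s12 cross.
have cal : continuous al by move=> s; exact: is_derive_cont (dalE s).
have cbe : continuous be by move=> s; exact: is_derive_cont (dbeE s).
(* The gap between the stable branch before the jump and the saddle branch after it. All losses
   below are counted in units of [D / 32]. *)
pose D := - be s1 - al s2.
have D0 : 0 < D by rewrite subr_gt0.
have absA s : [/\ - A <= al s, al s <= A, - A <= be s & be s <= A].
  by have := alA s; have := beA s; rewrite !ler_norml => /andP[? ?] /andP[? ?]; split.
have [th [th0 th1 thA]] : exists th : R, [/\ 0 < th, th <= 1 / 2 & th * (2 * A) <= D / 4].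
  exists (Num.min (1 / 2) (D / (8 * A))); split.
  - by rewrite lt_min !divr_gt0// mulr_gt0.
  - by rewrite ge_min lexx.
  - apply: (@le_trans _ _ (D / (8 * A) * (2 * A))).
      by rewrite ler_pM2r ?mulr_gt0// ge_min lexx orbT.
    by rewrite le_eqVlt; apply/orP; left; apply/eqP; field; exact: lt0r_neq0.
pose h := D / 8; have h0 : 0 < h by rewrite divr_gt0.
have [g1 [g10 g1h g1h3]] : exists g : R, [/\ 0 < g, g <= h & g <= h * h * h].
  by exists (Num.min h (h * h * h)); split; rewrite ?lt_min ?ge_min ?lexx ?orbT ?h0 ?mulr_gt0.
pose g2 := th * del * (del / 2) * del.
have g20 : 0 < g2 by rewrite !mulr_gt0// divr_gt0.
(* With [L * mu = m / 32], the moving barriers are slower than [g1 / 2] and [g2 / 2], and the branch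
   values at the two ends of the jump are off by at most [D / 32]. *)
have [m [m0 m1 m2 mD]] : exists m : R, [/\ 0 < m, m <= g1, m <= g2 & m <= D].
  exists (Num.min g1 (Num.min g2 D)).
  by split; rewrite ?lt_min ?ge_min ?lexx ?orbT ?g10 ?g20 ?D0.
pose mu := m / (32 * L).
have mu0 : 0 < mu by rewrite divr_gt0// mulr_gt0.
have Lmu : L * mu = m / 32 by rewrite /mu; field; exact: lt0r_neq0.
pose A2 := A + A ^+ 2.
have A20 : 0 < A2 by rewrite addr_gt0// exprn_gt0.
have alA2 s : `|al s| <= A2 by rewrite (le_trans (alA s))// lerDl exprn_ge0// ltW.
have beA2 s : `|be s ^+ 2| <= A2.
  rewrite normrX; apply: (@le_trans _ _ (A ^+ 2)); last by rewrite lerDr ltW.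
  by rewrite lerXn2r// nnegrE ltW.
(* [N] exceeds the modulus of the cubic on the range crossed during the jump; [tau] then makes a
   fall at speed [N] over the time [2 * tau] cost [D / 8]. *)
pose M := A + D.
pose N := (M + A2) * (M ^+ 2 + A2) + 1.
have N0 : 0 < N.
  by rewrite ltr_wpDl// mulr_ge0// addr_ge0 ?exprn_ge0 ?(ltW A20)//; rewrite addr_ge0 ?ltW.
have cubN x s : `|x| <= M -> - N < cub (al s) (be s ^+ 2) x.
  move=> xM; have := cub_bound (alA2 s) (beA2 s) xM; rewrite ler_norml /N => /andP[? _]; lra.
pose tau := D / (16 * N).
have tau0 : 0 < tau by rewrite divr_gt0// mulr_gt0.
have Ntau : N * (2 * tau) = D / 8 by rewrite /tau; field; exact: lt0r_neq0.
have [phi [dphi [ddphi [hphi hdd [[B hB] far] [ph1 ph2] [phm php]]]]] := ramp s12 tau0 mu0.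
have cphi : continuous phi by move=> t; exact: is_derive_cont (hphi t).
have [x1 [x2 [dx1 dx2 xm]]] := pullback_along cal cbe A0 alA beA d0 d1 gapm1 gapm2 alm_
  bem_ cphi phm.
exists phi, dphi, ddphi, x1, x2; split => //; first by exists B.
split => //.
have dbp t : is_derive t 1 (fun t => be (phi t)) (dbe (phi t) * dphi t) by exact: der_comp.
have dap t : is_derive t 1 (fun t => al (phi t)) (dal (phi t) * dphi t) by exact: der_comp.
have slow (u : R -> R) t : (forall s, `|u s| <= L) -> tau <= `|t| ->
  `|u (phi t) * dphi t| <= m / 32.
  move=> uL tt; rewrite normrM -Lmu ler_pM//; have /andP[b0 _] := hB t.
  by rewrite ger0_norm// far.
pose psiA t := - be (phi t) - h.
have dpsiA t : is_derive t 1 psiA (- (dbe (phi t) * dphi t)).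
  by apply: (der_eq (derB (derN (dbp t)) (der_cst h t))); rewrite subr0.
(* At very early times both the pullback attractor and [- be (phi t)] are close to [- bem], and
   [psiA] lies [h] below the latter. *)
have startA : exists T, [/\ T <= - tau, psiA T < x1 T & psiA T - g1 / 2 < x2 T].
  have h4 : 0 < h / 4 by rewrite divr_gt0.
  have [T1 hT1] := xm _ h4.
  have /cvg_real_ninftyP/(_ _ h4)[S hS] := bem_.
  have [T2 hT2] := phm S.
  pose T := Num.min (- tau) (Num.min T1 T2).
  have e1 : T <= - tau by rewrite ge_min lexx.
  have e2 : T <= T1 by rewrite !ge_min lexx orbT.
  have e3 : T <= T2 by rewrite !ge_min lexx !orbT.
  clearbody T; exists T; have [u1 u2] := hT1 T e2; have := hS _ (hT2 T e3); rewrite /psiA.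
  move: u1 u2; rewrite !ler_norml ltr_norml => /andP[b1 _] /andP[b2 _] /andP[b3 _].
  by split => //; clear -b1 b2 b3 h0 g10; lra.
have [T [Ttau iA1 iA2]] := startA.
have [A1 A2'] : psiA (- tau) < x1 (- tau) /\ psiA (- tau) - g1 / 2 < x2 (- tau).
  have px := psol_all (g := fun t => cub (al (phi t)) (be (phi t) ^+ 2)) T dx1 dx2.
  apply: (slow_lower_barrier px dpsiA g10 _ iA1 iA2 Ttau (lexx _)) => t Tt tt.
  have tt' : tau <= `|t| by rewrite -normrN (le_trans _ (ler_norm _))// lerNr.
  split.
    have := slow dbe t dbeL tt'; rewrite ler_norml => /andP[b1 _].
    by clear -b1 m0 m1; lra.
  have k1 := gap1 (phi t); have k2 := gap2 (phi t); apply: (le_trans g1h3).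
  by apply: cub_below_left => //; clear -k1 k2 d0; lra.
have close1 : `|be (phi (- tau)) - be s1| <= m / 32.
  by apply: (le_trans (lip_of_derive _ _ dbeE dbeL)); rewrite -Lmu ler_pM2l.
(* Losses before the jump: 4 units from [h], at most 2 from the offset [g1 / 2], and 1 from missing
   [s1]. The fall adds 4 more. *)
pose w := - be s1 - 7 / 32 * D.
have hD : h = D / 8 by [].
have [w1 w2] : w < x1 (- tau) /\ w < x2 (- tau).
  move: A1 A2' close1; rewrite /psiA /w ler_norml => b1 b2 /andP[_ b3].
  by clear -b1 b2 b3 mD g10 g1h hD D0; split; lra.
have [B1 B2] : - be s1 - 11 / 32 * D < x1 tau /\ - be s1 - 11 / 32 * D < x2 tau.
  have px := psol_all (g := fun t => cub (al (phi t)) (be (phi t) ^+ 2)) (- tau) dx1 dx2.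
  have tt : - tau <= tau by clear -tau0; lra.
  have := falling_lower_barrier (T' := tau) (N := N) px _ N0 w1 w2 tt (lexx _).
  have -> : tau - - tau = 2 * tau by ring.
  rewrite Ntau => hf; have [|b1 b2] := hf; last first.
    by clear -b1 b2; rewrite /w in b1 b2; split; lra.
  move=> t t1 t2; apply: cubN.
  have n1 : 0 <= N * (t - - tau) by rewrite mulr_ge0 ?(ltW N0)//; clear -t1; lra.
  have n2 : N * (t - - tau) <= D / 8 by rewrite -Ntau ler_pM2l//; clear -t2; lra.
  have [_ _ b1 b2] := absA s1; rewrite ler_norml /M /w.
  have DA : D <= 2 * A by rewrite /D; have [b3 _ _ _] := absA s2; clear -b1 b3; lra.
  by clear -b1 b2 n1 n2 D0 DA A0; apply/andP; split; lra.
(* After the jump [psi] is at most [11 / 32 * D] above [al s2], while the solution is still more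
   than [21 / 32 * D] above it. *)
pose psi s := al s + th * (be s - al s).
have dpsi t : is_derive t 1 (fun t => psi (phi t))
    (dal (phi t) * dphi t + th * (dbe (phi t) * dphi t - dal (phi t) * dphi t)).
  exact: (derD (dap t) (derZ th (derB (dbp t) (dap t)))).
have thm (x : R) : x <= 2 * (m / 32) -> th * x <= m / 32.
  move=> xm'; apply: (@le_trans _ _ (th * (2 * (m / 32)))); first by rewrite ler_pM2l.
  have : th * (2 * (m / 32)) <= 1 / 2 * (2 * (m / 32)).
    by rewrite ler_wpM2r//; clear -m0; lra.
  by move=> b1; clear -b1; lra.
have psi_s2 : psi (phi tau) <= al s2 + 11 / 32 * D.
  have l1 : `|al (phi tau) - al s2| <= m / 32.
    by apply: (le_trans (lip_of_derive _ _ dalE dalL)); rewrite -Lmu ler_pM2l.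
  have l2 : `|be (phi tau) - be s2| <= m / 32.
    by apply: (le_trans (lip_of_derive _ _ dbeE dbeL)); rewrite -Lmu ler_pM2l.
  move: l1 l2; rewrite !ler_norml => /andP[b1 b2] /andP[b3 b4].
  have [b5 b6 b7 b8] := absA s2.
  have : th * (be (phi tau) - al (phi tau) - 2 * A) <= m / 32.
    by apply: thm; clear -b1 b2 b3 b4 b5 b8; lra.
  rewrite mulrBr /psi => b9; clear -b2 b9 thA mD D0; lra.
have startC1 : psi (phi tau) < x1 tau.
  by clear -psi_s2 B1 D0; rewrite /D in B1 psi_s2 D0 *; lra.
have startC2 : psi (phi tau) - g2 / 2 < x2 tau.
  by clear -psi_s2 B2 D0 g20; rewrite /D in B2 psi_s2 D0 *; lra.
exists tau => t taut.
have px := psol_all (g := fun t => cub (al (phi t)) (be (phi t) ^+ 2)) tau dx1 dx2.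
have [|h1 _] := slow_lower_barrier (T' := t) px dpsi g20 _ startC1 startC2 taut (lexx _).
  move=> u tu _.
  have tt : tau <= `|u| by rewrite (le_trans (ltW tu))// ler_norm.
  split; last exact: cub_convex_comb.
  have := slow dal u dalL tt; have := slow dbe u dbeL tt.
  move: (dal _ * _) (dbe _ * _) => X Y; rewrite !ler_norml => /andP[b1 b2] /andP[b3 b4].
  have b5 : th * (Y - X) <= m / 32 by apply: thm; clear -b2 b3; lra.
  by clear -b4 b5 m0 m2; lra.
(* [psi] is above the saddle, which in turn is at least [del] above the stable branch. *)
have b1 := gap1 (phi t); have b2 := gap2 (phi t).
have p0 : 0 <= th * (be (phi t) - al (phi t)).
  by rewrite mulr_ge0 ?(ltW th0)//; clear -b1 d0; lra.
by move: h1; rewrite /psi => h1; clear -h1 p0 b2; lra.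
Qed.

End Tipping.

Section BoundedLimits.
Context {R : realType}.

Lemma bounded_with_limits (f : R -> R) (l1 l2 : R) : continuous f ->
  f s @[s --> -oo] --> l1 -> f s @[s --> +oo] --> l2 ->
  exists2 M, 0 < M & forall s, `|f s| <= M.
Proof.
move=> cf /cvg_real_ninftyP/(_ 1 ltr01)[T1 h1] /cvg_real_pinftyP/(_ 1 ltr01)[T2 h2].
pose T := Num.max T1 T2.
have T12 : T1 <= T by rewrite le_max lexx.
have T22 : T2 <= T by rewrite le_max lexx orbT.
have [c1 _ hc1] := EVT_max T12 (continuous_subspaceT cf).
have [c2 _ hc2] := EVT_min T12 (continuous_subspaceT cf).
have k1 := normr_ge0 (f c1); have k2 := normr_ge0 (f c2).
have k3 := normr_ge0 l1; have k4 := normr_ge0 l2.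
exists (`|f c1| + `|f c2| + `|l1| + `|l2| + 1); first by lra.
have near_le (x l : R) : `|x - l| < 1 -> `|x| <= `|l| + 1.
  by move=> xl; have := ler_normD (x - l) l; rewrite subrK; lra.
move=> s; have [sT1|T1s] := leP s T1.
  by have := near_le _ _ (h1 s sT1); lra.
have [sT|Ts] := leP s T.
  have sI : s \in `[T1, T] by rewrite in_itv/= (ltW T1s).
  have := hc1 s sI; have := hc2 s sI; have := ler_norm (f c1).
  have := ler_norm (- f c2); rewrite normrN => *.
  by rewrite ler_norml; apply/andP; split; lra.
by have := near_le _ _ (h2 s (le_trans T22 (ltW Ts))); lra.
Qed.

Lemma cvg0_mul_bounded (f g : R -> R) M (F : set_system R) {FF : Filter F} :
  (forall t, `|g t| <= M) -> f t @[t --> F] --> (0 : R) -> (f t * g t) @[t --> F] --> (0 : R).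
Proof.
move=> gM /cvgrPdist_lt hf; apply/cvgrPdist_lt => e e0.
have M0 : 0 <= M by apply: le_trans (gM 0).
have M1 : 0 < M + 1 by lra.
have := hf (e / (M + 1)) (divr_gt0 e0 M1); apply: filterS => t.
rewrite !sub0r !normrN normrM ltr_pdivlMr// => h; apply: le_lt_trans h.
by rewrite ler_wpM2l//; have := gM t; lra.
Qed.

End BoundedLimits.

(** * Parameter shifts under reparametrization *)

Section Reparametrization.
Context {R : realType}.
Variables (lm lp : R) (Lam phi dphi ddphi : R -> R) (M : R).
Hypothesis hLam : parameter_shift lm lp Lam.
Hypotheses (dphiE : forall t : R, is_derive t 1 phi (dphi t))
           (ddphiE : forall t : R, is_derive t 1 dphi (ddphi t)) (cdd : continuous ddphi).
Hypothesis dphiM : forall t, `|dphi t| <= M.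
Hypotheses (phim : forall M, exists T, forall t, t <= T -> phi t <= M)
           (phip : forall M, exists T, forall t, T <= t -> M <= phi t).

Lemma reparam_ninfty (f : R -> R) (l : R) : f s @[s --> -oo] --> l ->
  f (phi t) @[t --> -oo] --> l.
Proof.
move=> /cvg_real_ninftyP hf; apply/cvg_real_ninftyP => e /hf[S hS].
by have [T hT] := phim S; exists T => t /hT/hS.
Qed.

Lemma reparam_pinfty (f : R -> R) (l : R) : f s @[s --> +oo] --> l ->
  f (phi t) @[t --> +oo] --> l.
Proof.
move=> /cvg_real_pinftyP hf; apply/cvg_real_pinftyP => e /hf[S hS].
by have [T hT] := phip S; exists T => t /hT/hS.
Qed.

(** The new derivative is the old one at [phi t] times [dphi t]; boundedness of [dphi] lets it still
    tend to 0. *)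
Lemma reparam_shift : parameter_shift lm lp (fun t => Lam (phi t)).
Proof.
have [inl [d1 d2 cd2] [Lm Lp] [dLm dLp]] := hLam.
have hd1 (s : R) : is_derive s 1 Lam (derive1 Lam s) by rewrite derive1E; exact: derivableP.
have hd2 (s : R) : is_derive s 1 (derive1 Lam) (derive1n 2 Lam s).
  by rewrite /derive1n/= derive1E; exact: derivableP.
have e1 (t : R) : is_derive t 1 (fun t => Lam (phi t)) (derive1 Lam (phi t) * dphi t).
  exact: der_comp.
have E1 : derive1 (fun t => Lam (phi t)) = fun t => derive1 Lam (phi t) * dphi t.
  by apply/funext => t; rewrite derive1E; exact: derive_val.
pose D2 t := derive1 Lam (phi t) * ddphi t + dphi t * (derive1n 2 Lam (phi t) * dphi t).
have e2 (t : R) : is_derive t 1 (fun t => derive1 Lam (phi t) * dphi t) (D2 t).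
  exact: (derM (der_comp (hd2 (phi t)) (dphiE t)) (ddphiE t)).
have E2 : derive1n 2 (fun t => Lam (phi t)) = D2.
  rewrite /derive1n/= E1; apply/funext => t; rewrite derive1E; exact: derive_val.
have cphi t : {for t, continuous phi} by exact: is_derive_cont (dphiE t).
have cdphi t : {for t, continuous dphi} by exact: is_derive_cont (ddphiE t).
split.
- by move=> t; exact: inl.
- split.
  + by move=> t; have [] := e1 t.
  + by move=> t; rewrite E1; have [] := e2 t.
  + rewrite E2 => t; apply: (@cntD _ _ _ t); apply: (@cntM _ _ _ t).
    * by apply: (@continuous_comp _ _ _ phi (derive1 Lam)) => //; exact: is_derive_cont (hd2 _).
    * exact: cdd.
    * exact: cdphi.
    * apply: (@cntM _ _ _ t); last exact: cdphi.
      by apply: (@continuous_comp _ _ _ phi (derive1n 2 Lam)) => //; exact: cd2.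
- by split; [exact: reparam_ninfty|exact: reparam_pinfty].
- rewrite E1; split.
    by apply: (cvg0_mul_bounded dphiM); exact: reparam_ninfty dLm.
  by apply: (cvg0_mul_bounded dphiM); exact: reparam_pinfty dLp.
Qed.

End Reparametrization.

(** * Part (1) for both stable branches *)

Section PartOne.
Context {R : realType}.
Variables (lm lp : R) (Lam a b : R -> R).
Hypotheses (hl : lm < lp) (hLam : parameter_shift lm lp Lam).
Hypotheses (ha : smooth_on `[lm, lp] a) (hb : smooth_on `[lm, lp] b).
Hypothesis hb1 : forall lam : R, lm <= lam <= lp -> -1 < b lam.
Hypothesis hab : forall lam : R, lm <= lam <= lp -> `|a lam| < Num.sqrt (b lam + 1).
Implicit Types (l s t u : R).
Let rt := root1 b.

(** On the compact segment the root has a positive minimum, so its derivative inherits a bound from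
    that of [b]. *)
Lemma root_derivative : exists drt : R -> R,
  (forall u, lm < u < lp -> is_derive u 1 rt (drt u)) /\
  exists2 M, 0 < M & forall u, lm <= u <= lp -> `|drt u| <= M.
Proof.
have [db [dbE [M M0 hM]]] := smooth_on_derive hl hb.
have [c cI hc] := EVT_min (ltW hl) (root1_continuous hb).
have rc0 : 0 < rt c by apply: (root1_gt0 hb1); move: cI; rewrite in_itv.
exists (fun u => (2 * rt u)^-1 * db u); split.
  move=> u ui; apply: der_sqrt.
    have ui' : lm <= u <= lp by case/andP: ui => ? ?; rewrite !ltW.
    by have := hb1 ui'; lra.
  by apply: (der_eq (derD (dbE u ui) (der_cst 1 u))); rewrite addr0.
exists ((2 * rt c)^-1 * M); first by rewrite mulr_gt0// invr_gt0 mulr_gt0.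
move=> u ui; have ru : rt c <= rt u by apply: hc; rewrite in_itv.
have r0 : 0 < rt u by exact: lt_le_trans ru.
rewrite normrM ler_pM//; last by apply: hM; exact/segmentE.
by rewrite ger0_norm ?invr_ge0 ?mulr_ge0 ?(ltW r0)// lef_pV2 ?posrE ?mulr_gt0// ler_pM2l.
Qed.

Lemma uniform_gap a' : {within `[lm, lp], continuous a'} ->
  (forall l, lm <= l <= lp -> `|a' l| < rt l) ->
  exists del : R, [/\ 0 < del, del <= 1 &
    forall l, lm <= l <= lp -> del <= rt l - a' l /\ del <= rt l + a' l].
Proof.
move=> ca' ha'.
have c1 : {within `[lm, lp], continuous (fun l => rt l - a' l)}.
  by move=> l; apply: cvgB; [exact: (root1_continuous hb)|exact: ca'].
have c2 : {within `[lm, lp], continuous (fun l => rt l + a' l)}.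
  by move=> l; apply: cvgD; [exact: (root1_continuous hb)|exact: ca'].
have [l1 l1I h1] := EVT_min (ltW hl) c1.
have [l2 l2I h2] := EVT_min (ltW hl) c2.
have k1 : 0 < rt l1 - a' l1.
  by move: l1I; rewrite in_itv => /ha'; rewrite ltr_norml => /andP[_ ?]; lra.
have k2 : 0 < rt l2 + a' l2.
  by move: l2I; rewrite in_itv => /ha'; rewrite ltr_norml => /andP[? _]; lra.
exists (Num.min 1 (Num.min (rt l1 - a' l1) (rt l2 + a' l2))); split.
- by rewrite !lt_min ltr01 k1.
- by rewrite ge_min lexx.
- move=> l li; split; rewrite !ge_min.
    by rewrite (h1 l) ?orbT// in_itv.
  by rewrite (h2 l) ?orbT// in_itv.
Qed.

(** Stated for a general [a'], so that [- a] can be inserted to treat the right branch by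
    reflection. *)
Lemma tipping_shift a' s1 s2 : smooth_on `[lm, lp] a' ->
  (forall l, lm <= l <= lp -> `|a' l| < rt l) ->
  s1 < s2 -> a' (Lam s2) < - rt (Lam s1) ->
  exists Lamt x1 x2 : R -> R,
  [/\ parameter_shift lm lp Lamt,
      forall t, is_derive t 1 x1
        (cub (a' (Lamt t)) (b (Lamt t) + 1) (x1 t) + (x2 t - x1 t)),
      forall t, is_derive t 1 x2 (x1 t - x2 t),
      forall e, 0 < e -> exists T, forall t, t <= T ->
        `|x1 t - - rt lm| <= e /\ `|x2 t - - rt lm| <= e &
      exists2 del, 0 < del & exists T, forall t, T <= t -> - rt (Lamt t) + del <= x1 t].
Proof.
move=> ha0' ha' s12 cross.
have ca' := smooth_on_continuous ha0'.
have [inl [d1 d2 _] [Lm Lp] [dLm dLp]] := hLam.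
have hd1 s : is_derive s 1 Lam (derive1 Lam s) by rewrite derive1E; exact: derivableP.
have cL' : continuous (derive1 Lam).
  by move=> s; apply: differentiable_continuous; exact/derivable1_diffP.
have [ML ML0 hML] := bounded_with_limits cL' dLm dLp.
have [da' [da'E [Ma Ma0 hMa]]] := smooth_on_derive hl ha0'.
have [drt [drtE [Mr Mr0 hMr]]] := root_derivative.
have [A1 A10 hA1] := within_segment_bounded hl ca'.
have [A2 A20 hA2] := within_segment_bounded hl (root1_continuous hb).
have [del [del0 del1 hdel]] := uniform_gap ca' ha'.
have lmi : lm <= lm <= lp by rewrite lexx ltW.
have Li s : lm <= Lam s <= lp by case/andP: (inl s) => ? ?; rewrite !ltW.
have k1 s : is_derive s 1 (fun s => a' (Lam s)) (da' (Lam s) * derive1 Lam s).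
  exact: der_comp (da'E _ (inl s)) (hd1 s).
have k2 s : is_derive s 1 (fun s => rt (Lam s)) (drt (Lam s) * derive1 Lam s).
  exact: der_comp (drtE _ (inl s)) (hd1 s).
have k3 : 0 < (Ma + Mr) * ML by rewrite mulr_gt0// addr_gt0.
have k4 s : `|da' (Lam s) * derive1 Lam s| <= (Ma + Mr) * ML.
  rewrite normrM ler_pM//; apply: (@le_trans _ _ Ma); last by rewrite lerDl ltW.
  by apply: hMa; exact/segmentE.
have k5 s : `|drt (Lam s) * derive1 Lam s| <= (Ma + Mr) * ML.
  by rewrite normrM ler_pM//; apply: (@le_trans _ _ Mr); [exact: hMr|rewrite lerDr ltW].
have k6 : 0 < A1 + A2 by rewrite addr_gt0.
have k7 s : `|a' (Lam s)| <= A1 + A2.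
  by apply: (@le_trans _ _ A1); [apply: hA1; exact/segmentE|rewrite lerDl ltW].
have k8 s : `|rt (Lam s)| <= A1 + A2.
  by apply: (@le_trans _ _ A2); [apply: hA2; exact/segmentE|rewrite lerDr ltW].
have k9 s : del <= rt (Lam s) - a' (Lam s) by case: (hdel _ (Li s)).
have k10 s : del <= rt (Lam s) + a' (Lam s) by case: (hdel _ (Li s)).
have [k11 k12] := hdel _ lmi.
have sL := shift_in_segment hLam.
have k13 := compose_cvg_ninfty sL ca' (segment_lm hl) Lm.
have k14 := compose_cvg_ninfty sL (root1_continuous hb) (segment_lm hl) Lm.
have [phi [dphi [ddphi [x1 [x2 [h1 [h2 h3] [M hM] [h4 h5] [l1 l2 l3 [T hT]]]]]]]] :=
  tipping_core k1 k2 k3 k4 k5 k6 k7 k8 del0 del1 k9 k10 k11 k12 k13 k14 s12 cross.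
exists (fun t => Lam (phi t)), x1, x2; split.
- apply: (reparam_shift hLam h1 h2 h3 (M := M)) => // t.
  by have /andP[p0 pM] := hM t; rewrite ger0_norm.
- by move=> t; have := l1 t; rewrite (root1_sqr hb1)//; exact: Li.
- exact: l2.
- exact: l3.
- by exists del => //; exists T.
Qed.

Lemma part1_left s1 s2 : s1 < s2 -> a (Lam s2) < - rt (Lam s1) ->
  exists Lamt : R -> R, parameter_shift lm lp Lamt /\
    R_tipping (field_ab a b) Lamt (- rt lm, - rt lm) (- rt lp, - rt lp).
Proof.
move=> s12 cross.
have [Lamt [x1 [x2 [sh d1 d2 xm [del del0 [T hT]]]]]] := tipping_shift ha hab s12 cross.
(* Rate 1 is enough, the speed of the jump being part of [Lamt]. *)
exists Lamt; split => //; exists 1, (fun t => (x1 t, x2 t)); split => //.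
- split; first by move=> t; rewrite mul1r fieldE; exact: is_derive_pair (d1 t) (d2 t).
  apply/cvg_plane_ninftyP => h h0 /=.
  have [S hS] := xm (h / 2) (divr_gt0 h0 (ltr0n _ 2)); exists S => t /hS[u1 u2].
  by split; lra.
- move=> /cvg_plane_pinftyP /= hx.
  have d20 : 0 < del / 2 by rewrite divr_gt0.
  have [T1 hT1] := hx _ d20.
  have [_ _ [_ Lp] _] := sh.
  have /cvg_real_pinftyP/(_ _ d20)[T2 hT2] :=
    compose_cvg_pinfty (shift_in_segment sh) (root1_continuous hb) (segment_lp hl) Lp.
  pose t := Num.max T (Num.max T1 T2).
  have t0 : T <= t by rewrite le_max lexx.
  have t1 : T1 <= t by rewrite !le_max lexx orbT.
  have t2 : T2 <= t by rewrite !le_max lexx !orbT.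
  have := hT t t0; have [+ _] := hT1 t t1; have := hT2 t t2.
  rewrite !ltr_norml -/rt => /andP[? ?] /andP[? ?]; lra.
Qed.

Lemma smooth_on_opp : smooth_on `[lm, lp] (fun l => - a l).
Proof.
have [D D0 hD] := ha; exists (fun n l => - D n l).
  by move=> l lI; rewrite /= D0.
move=> n u Au.
have -> : (fun y => (- D n y - - D n u) / (y - u)) = (fun y => - ((D n y - D n u) / (y - u))).
  by apply/funext => y; ring.
exact: cvgN (hD n u Au).
Qed.

Lemma part1_right s1 s2 : s1 < s2 -> rt (Lam s1) < a (Lam s2) ->
  exists Lamt : R -> R, parameter_shift lm lp Lamt /\
    R_tipping (field_ab a b) Lamt (rt lm, rt lm) (rt lp, rt lp).
Proof.
move=> s12 cross.
have hab' l : lm <= l <= lp -> `|- a l| < rt l by rewrite normrN; exact: hab.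
have cross' : - a (Lam s2) < - rt (Lam s1) by rewrite ltrN2.
have [Lamt [x1 [x2 [sh d1 d2 xm [del del0 [T hT]]]]]] :=
  tipping_shift smooth_on_opp hab' s12 cross'.
exists Lamt; split => //; exists 1, (fun t => (- x1 t, - x2 t)); split => //.
- split.
    move=> t; rewrite mul1r fieldE /=; apply: is_derive_pair.
      by apply: (der_eq (derN (d1 t))); rewrite /cub; ring.
    by apply: (der_eq (derN (d2 t))); ring.
  apply/cvg_plane_ninftyP => h h0 /=.
  have [S hS] := xm (h / 2) (divr_gt0 h0 (ltr0n _ 2)); exists S => t /hS.
  by rewrite -!opprD !normrN !opprK => -[u1 u2]; split; lra.
- move=> /cvg_plane_pinftyP /= hx.
  have d20 : 0 < del / 2 by rewrite divr_gt0.
  have [T1 hT1] := hx _ d20.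
  have [_ _ [_ Lp] _] := sh.
  have /cvg_real_pinftyP/(_ _ d20)[T2 hT2] :=
    compose_cvg_pinfty (shift_in_segment sh) (root1_continuous hb) (segment_lp hl) Lp.
  pose t := Num.max T (Num.max T1 T2).
  have t0 : T <= t by rewrite le_max lexx.
  have t1 : T1 <= t by rewrite !le_max lexx orbT.
  have t2 : T2 <= t by rewrite !le_max lexx !orbT.
  have := hT t t0; have [+ _] := hT1 t t1; have := hT2 t t2.
  rewrite !ltr_norml -/rt => /andP[? ?] /andP[? ?]; lra.
Qed.

End PartOne.

(** * Limits of the stable branches, and the theorem *)

Section Limits.
Context {R : realType}.
Variables (lm lp : R) (b : R -> R).
Hypotheses (hl : lm < lp) (hb : smooth_on `[lm, lp] b).

Lemma root_cvg (L : R -> R) : parameter_shift lm lp L ->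
  root1 b (L s) @[s --> -oo] --> root1 b lm /\ root1 b (L s) @[s --> +oo] --> root1 b lp.
Proof.
move=> sh; have [_ _ [Lm Lp] _] := sh; split.
  exact: (compose_cvg_ninfty (shift_in_segment sh) (root1_continuous hb) (segment_lm hl) Lm).
exact: (compose_cvg_pinfty (shift_in_segment sh) (root1_continuous hb) (segment_lp hl) Lp).
Qed.

Lemma diag_cvg_ninfty (f : R -> R) (l : R) : f s @[s --> -oo] --> l ->
  (f s, f s) @[s --> -oo] --> (l, l).
Proof.
move=> /cvg_real_ninftyP hf; apply/cvg_plane_ninftyP => h /hf[T hT].
by exists T => t /hT.
Qed.

Lemma diag_cvg_pinfty (f : R -> R) (l : R) : f s @[s --> +oo] --> l ->
  (f s, f s) @[s --> +oo] --> (l, l).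
Proof.
move=> /cvg_real_pinftyP hf; apply/cvg_plane_pinftyP => h /hf[T hT].
by exists T => t /hT.
Qed.

Lemma p1_cvg (L : R -> R) : parameter_shift lm lp L ->
  p1 b L s @[s --> -oo] --> (- root1 b lm, - root1 b lm) /\
  p1 b L s @[s --> +oo] --> (- root1 b lp, - root1 b lp).
Proof.
move=> /root_cvg[cm cp]; split; first exact: (diag_cvg_ninfty (cvg_ninftyN cm)).
exact: (diag_cvg_pinfty (cvg_pinftyN cp)).
Qed.

Lemma p3_cvg (L : R -> R) : parameter_shift lm lp L ->
  p3 b L s @[s --> -oo] --> (root1 b lm, root1 b lm) /\
  p3 b L s @[s --> +oo] --> (root1 b lp, root1 b lp).
Proof.
move=> /root_cvg[cm cp]; split; first exact: (diag_cvg_ninfty cm).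
exact: (diag_cvg_pinfty cp).
Qed.

End Limits.

Unset Implicit Arguments.

Theorem proposition6p1 (R : realType) (lm lp : R) (Lam a b : R -> R)
  (hl : lm < lp) (hLam : parameter_shift lm lp Lam)
  (ha : smooth_on `[lm, lp] a) (hb : smooth_on `[lm, lp] b)
  (hb1 : forall lam : R, lm <= lam <= lp -> -1 < b lam)
  (hab : forall lam : R, lm <= lam <= lp -> `|a lam| < Num.sqrt (b lam + 1))
  (p1m p1p p3m p3p : R * R)
  (hp1m : p1 b Lam s @[s --> -oo] --> p1m)
  (hp1p : p1 b Lam s @[s --> +oo] --> p1p)
  (hp3m : p3 b Lam s @[s --> -oo] --> p3m)
  (hp3p : p3 b Lam s @[s --> +oo] --> p3p) :
  let F := field_ab a b in
  let Lame := ext_shift lm lp Lam in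
  (* (1) *)
  (((exists s1 s2 : R,
       s1 < s2 /\ a (Lam s2) < - Num.sqrt (b (Lam s1) + 1)) ->
    exists Lamt : R -> R,
      [/\ parameter_shift lm lp Lamt,
          p1 b Lamt s @[s --> -oo] --> p1m,
          p1 b Lamt s @[s --> +oo] --> p1p &
          R_tipping F Lamt p1m p1p]) /\
   ((exists s1 s2 : R,
       s1 < s2 /\ Num.sqrt (b (Lam s1) + 1) < a (Lam s2)) ->
    exists Lamt : R -> R,
      [/\ parameter_shift lm lp Lamt,
          p3 b Lamt s @[s --> -oo] --> p3m,
          p3 b Lamt s @[s --> +oo] --> p3p &
          R_tipping F Lamt p3m p3p])) /\
  (* (2) *)
  (((forall s1 s2 : \bar R, (s1 < s2)%E ->
       - Num.sqrt (b (Lame s1) + 1) < a (Lame s2)) ->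
    forward_inflowing_stable F lm lp Lam (p1 b Lam) p1m p1p /\
    ~ R_tipping F Lam p1m p1p) /\
   ((forall s1 s2 : \bar R, (s1 < s2)%E ->
       a (Lame s2) < Num.sqrt (b (Lame s1) + 1)) ->
    forward_inflowing_stable F lm lp Lam (p3 b Lam) p3m p3p /\
    ~ R_tipping F Lam p3m p3p)).
Proof.
move=> F Lame.
have [c1m c1p] := p1_cvg hl hb hLam; have [c3m c3p] := p3_cvg hl hb hLam.
have hT : hausdorff_space (R * R)%type by exact: norm_hausdorff.
rewrite (cvg_unique hT hp1m c1m) (cvg_unique hT hp1p c1p).
rewrite (cvg_unique hT hp3m c3m) (cvg_unique hT hp3p c3p).
split; split.
- move=> [s1 [s2 [s12 cross]]].
  have [Lamt [sh tip]] := part1_left hl hLam ha hb hb1 hab s12 cross.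
  by have [? ?] := p1_cvg hl hb sh; exists Lamt.
- move=> [s1 [s2 [s12 cross]]].
  have [Lamt [sh tip]] := part1_right hl hLam ha hb hb1 hab s12 cross.
  by have [? ?] := p3_cvg hl hb sh; exists Lamt.
(* The infinite instances of [h] bring in [lm] and [lp]; they keep the margin between the branches
   from vanishing at infinity. *)
- move=> h; apply: (part2_left hl hLam ha hb hb1 hab).
  + by move=> s1 s2 s12; apply: (h s1%:E s2%:E); rewrite lte_fin.
  + by move=> s; apply: (h -oo%E s%:E); exact: ltNyr.
  + by move=> s; apply: (h s%:E +oo%E); exact: ltry.
  + exact: (h -oo%E +oo%E).
- move=> h; apply: (part2_right hl hLam ha hb hb1 hab).
  + by move=> s1 s2 s12; apply: (h s1%:E s2%:E); rewrite lte_fin.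
  + by move=> s; apply: (h -oo%E s%:E); exact: ltNyr.
  + by move=> s; apply: (h s%:E +oo%E); exact: ltry.
  + exact: (h -oo%E +oo%E).
Qed.
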